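(* Let $M$, $H$, $\mathcal U$, $U$, $V$ and $\Gamma$ be as in the context. For every $f\in C^\infty(S^*M\cap\Gamma)$, one has $\mathsf X f(\gamma)=0$ for all maximal unit bicharacteristics $\gamma$ in $\Gamma$ if and only if $f=X_H\phi$ with some $\phi\in C^\infty(S^*M\cap\Gamma)$ such that $\phi=0$ on $\Gamma_U\cup\Gamma_V$ (intersected with $S^*M$).
   Context: $M$ is a smooth manifold with boundary, $\dim M=n\ge2$. $H\in C^\infty(T^*M\setminus0)$ is positive, homogeneous of degree two ($H(x,\lambda\xi)=\lambda^2H(x,\xi)$ for $\lambda>0$), with $\mathrm dH\ne0$ on $\{H=1/2\}$. $X_H=H_\xi\partial_x-H_x\partial_\xi$ with flow $\Phi^t$; integral curves are bicharacteristics, unit if contained in $S^*M=\{H=1/2\}$. $\iota^*:T^*M|_{\partial M}\to T^*\partial M$ is restriction of covectors to $T\partial M$, written $(x,\xi)\mapsto(x,\xi')$. $U,V\subset\partial M$ are disjoint open sets. $(x_0,\xi^0)\in S^*M$, $x_0\in U$, is incoming, with $\langle\mathrm d\rho,H_\xi\rangle>0$ there ($\rho$ a boundary defining function), and its unit bicharacteristic hits $T^*M|_V$ for the first time, at a positive time, transversally. $\mathcal U\subset T^*U$ is a sufficiently small open neighborhood of $(x_0,\xi^0{}')$ such that for $(x,\xi')\in\mathcal U$ there is a unique $\zeta(x,\xi')=(x,\xi)$ near $(x_0,\xi^0)$, smoothly depending on $(x,\xi')$, with $\iota^*(x,\xi)=(x,\xi')$, $H(x,\xi)=1/2$, and the unit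 bicharacteristic issued from it hits $T^*M|_V$ for the first time, transversally, at time $\ell(x,\xi')>0$. Then $$\Gamma=\{(y,\lambda\eta):\lambda>0,\ (y,\eta)=\Phi^s(\zeta(x,\xi')),\ (x,\xi')\in\mathcal U,\ 0\le s\le\ell(x,\xi')\},$$ and $\Gamma_U$ (resp. $\Gamma_V$) is the set of elements of $\Gamma$ with base point in $U$ (resp. $V$). The Hamiltonian X-ray transform is $\mathsf Xf(\gamma)=\int f\circ\gamma(t)\,\mathrm dt=\int f(x(t),\xi(t))\,\mathrm dt$ over maximal unit bicharacteristics $\gamma=(x(\cdot),\xi(\cdot))$; here, those in $\Gamma$ are the segments $[0,\ell(x,\xi')]\ni s\mapsto\Phi^s(\zeta(x,\xi'))$, $(x,\xi')\in\mathcal U$.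
   Formalization: It is additionally assumed that the unit bicharacteristics in Γ do not meet T*M|_U again strictly between their start and their first hit of T*M|_V; a tangential contact there would put interior points in Γ_U, where φ need not vanish, and the claim fails. *)

(* Defs.v *)
From HB Require Import structures.
From mathcomp Require Import all_boot all_order all_algebra.
From mathcomp Require Import all_classical all_reals all_analysis.
Set Implicit Arguments.
Unset Strict Implicit.
Unset Printing Implicit Defensive.
Import Order.TTheory GRing.Theory Num.Theory.
Import numFieldNormedType.Exports.
Local Open Scope classical_set_scope.
Local Open Scope ring_scope.

(* Meaningful for open O. *)
Fixpoint Ck (R : realType) (N k : nat) (O : set 'rV[R]_N) (f : 'rV[R]_N -> R) :
    Prop :=
  match k with
  | 0%N => forall x, O x -> {for x, continuous f}
  | k'.+1 => (forall x, O x -> {for x, continuous f}) /\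
      forall l : 'I_N,
        (forall x, O x -> derivable f x (delta_mx 0 l)) /\
        Ck k' O (fun x => 'D_(delta_mx 0 l) f x)
  end.

Definition Cinf (R : realType) (N : nat) (O : set 'rV[R]_N)
    (f : 'rV[R]_N -> R) : Prop :=
  forall k, Ck k O f.

Definition gradient (R : realType) (N : nat) (g : 'rV[R]_N -> R)
    (x : 'rV[R]_N) : 'rV[R]_N :=
  \row_(l < N) 'D_(delta_mx 0 l) g x.

(* The family of charts underlying M, T*M and T*(bd M); [ccoord i] is only
   meaningful on [cdom i]. *)
Record charts (R : realType) (T : Type) (N : nat) := Charts {
  cidx : Type;
  cdom : cidx -> set T;
  ccoord : cidx -> T -> 'rV[R]_N }.

(* In chart i, near z, f agrees on A with the smooth function g of the
   coordinates, g being smooth on a full neighbourhood in R^N.  This is the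
   usual smoothness up to the boundary (local smooth extendability). *)
Definition local_rep (R : realType) (T : Type) (N : nat) (X : charts R T N)
    (i : cidx X) (A : set T) (f : T -> R) (z : T) (g : 'rV[R]_N -> R) : Prop :=
  exists O : set 'rV[R]_N,
    [/\ open O, O (ccoord i z), Cinf O g &
      forall w, A w -> cdom i w -> O (ccoord i w) -> f w = g (ccoord i w)].

Definition smooth_on (R : realType) (T : Type) (N : nat) (X : charts R T N)
    (A : set T) (f : T -> R) : Prop :=
  forall z, A z -> exists i : cidx X, cdom i z /\ exists g, local_rep i A f z g.

(* d is the vector of partial derivatives at z, in chart i, of a local smooth
   extension of f|A.  When A is open in a manifold with boundary d is unique;
   for smaller A only its values on directions tangent to A are. *)
Definition is_gradient (R : realType) (T : Type) (N : nat) (X : charts R T N)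
    (i : cidx X) (A : set T) (f : T -> R) (z : T) (d : 'rV[R]_N) : Prop :=
  cdom i z /\ exists2 g, local_rep i A f z g & d = gradient g (ccoord i z).

Definition smooth_map (R : realType) (T T' : Type) (N N' : nat)
    (X : charts R T N) (Y : charts R T' N') (A : set T) (F : T -> T') : Prop :=
  forall z, A z -> exists (i : cidx X) (j : cidx Y),
    [/\ cdom i z, cdom j (F z) &
      exists (O : set 'rV[R]_N) (G : 'rV[R]_N -> 'rV[R]_N'),
        [/\ open O, O (ccoord i z), (forall k, Cinf O (fun x => G x 0 k)) &
          forall w, A w -> cdom i w -> O (ccoord i w) ->
            cdom j (F w) /\ ccoord j (F w) = G (ccoord i w)]].

(* Open sets of the topology for which the charts are homeomorphisms onto open
   subsets of a (half-)space. *)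
Definition chart_open (R : realType) (T : Type) (N : nat) (X : charts R T N)
    (A : set T) : Prop :=
  forall z, A z -> exists i : cidx X, cdom i z /\
    exists O : set 'rV[R]_N, [/\ open O, O (ccoord i z) &
      forall w, cdom i w -> O (ccoord i w) -> A w].

Definition half_space (R : realType) (m : nat) : set 'rV[R]_m.+1 :=
  [set x | 0 <= x 0 ord0].

(* Smooth manifolds with (possibly empty) boundary, of dimension m.+1. *)
Record bmanifold (R : realType) (m : nat) := BManifold {
  bm_space :> topologicalType;
  bm_charts : charts R bm_space m.+1;
  bm_hausdorff : hausdorff_space bm_space;
  bm_second_countable : @second_countable bm_space;
  bm_cover : forall p, exists i : cidx bm_charts, cdom i p;
  bm_dom_open : forall i : cidx bm_charts, open (cdom i);
  bm_coord_inj : forall (i : cidx bm_charts) p q,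
    cdom i p -> cdom i q -> ccoord i p = ccoord i q -> p = q;
  bm_coord_continuous : forall (i : cidx bm_charts) p,
    cdom i p -> {for p, continuous (ccoord i)};
  bm_coord_open : forall (i : cidx bm_charts) (A : set bm_space),
    open A -> A `<=` cdom i ->
    exists2 W, open W & ccoord i @` A = W `&` @half_space R m;
  bm_transition : forall (i j : cidx bm_charts) p k, cdom i p -> cdom j p ->
    exists g, local_rep i (cdom j) (fun q => ccoord j q 0 k) p g }.

Definition bdry (R : realType) (m : nat) (M : bmanifold R m) : set M :=
  [set p | exists i : cidx (bm_charts M), cdom i p /\ ccoord i p 0 ord0 = 0].

(* Jacobian matrix at p of the change of coordinates from chart i to chart j:
   the (k, l) entry is d(y_k)/d(x_l), with x (resp. y) the coordinates i
   (resp. j). *)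
Definition is_jacobian (R : realType) (m : nat) (M : bmanifold R m)
    (i j : cidx (bm_charts M)) (p : M) (D : 'M[R]_m.+1) : Prop :=
  forall k, is_gradient i (cdom j) (fun q => ccoord j q 0 k) p (row k D).

(* Elements of T*M: a base point with the components of the covector in every
   chart at that point, subject to the transformation law of covectors.
   Components in the other charts are set to 0, so that equality in this type
   is equality of covectors. *)
Record cotangent (R : realType) (m : nat) (M : bmanifold R m) := Cotangent {
  ct_base : M;
  ct_comp : cidx (bm_charts M) -> 'rV[R]_m.+1;
  ct_law : forall i j D, cdom i ct_base -> cdom j ct_base ->
    is_jacobian i j ct_base D -> ct_comp i = ct_comp j *m D;
  ct_norm : forall i, ~ cdom i ct_base -> ct_comp i = 0 }.

(* Canonical coordinates (x, xi). *)
Definition ct_charts (R : realType) (m : nat) (M : bmanifold R m) :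
    charts R (cotangent M) (m.+1 + m.+1) :=
  {| cidx := cidx (bm_charts M);
     cdom := fun i => [set z | cdom i (ct_base z)];
     ccoord := fun i z => row_mx (ccoord i (ct_base z)) (ct_comp z i) |}.

(* Elements of T*(bd M).  The charts of bd M are those of M without the
   coordinate x_0, hence their Jacobian matrix is the minor of that of M. *)
Record bcotangent (R : realType) (m : nat) (M : bmanifold R m) := BCotangent {
  bc_base : M;
  bc_comp : cidx (bm_charts M) -> 'rV[R]_m;
  bc_bdry : bdry bc_base;
  bc_law : forall i j D, cdom i bc_base -> cdom j bc_base ->
    is_jacobian i j bc_base D ->
    bc_comp i = bc_comp j *m row' ord0 (col' ord0 D);
  bc_norm : forall i, ~ cdom i bc_base -> bc_comp i = 0 }.

Definition bc_charts (R : realType) (m : nat) (M : bmanifold R m) :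
    charts R (bcotangent M) (m + m) :=
  {| cidx := cidx (bm_charts M);
     cdom := fun i => [set w | cdom i (bc_base w)];
     ccoord := fun i w =>
       row_mx (col' ord0 (ccoord i (bc_base w))) (bc_comp w i) |}.

(* iota^* z = w: over a boundary point, restricting a covector to T(bd M)
   forgets its component along dx_0. *)
Definition is_restriction (R : realType) (m : nat) (M : bmanifold R m)
    (z : cotangent M) (w : bcotangent M) : Prop :=
  ct_base z = bc_base w /\ forall i, bc_comp w i = col' ord0 (ct_comp z i).

Definition nonzero (R : realType) (m : nat) (M : bmanifold R m) :
    set (cotangent M) :=
  [set z | exists i, ct_comp z i != 0].

Section Dilation.
Context (R : realType) (m : nat) (M : bmanifold R m) (lambda : R)
  (z : cotangent M).

Fact dilate_law i j D : cdom i (ct_base z) -> cdom j (ct_base z) ->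
  is_jacobian i j (ct_base z) D ->
  lambda *: ct_comp z i = (lambda *: ct_comp z j) *m D.
Proof. by move=> zi zj zD; rewrite (ct_law zi zj zD) scalemxAl. Qed.

Fact dilate_norm i : ~ cdom i (ct_base z) -> lambda *: ct_comp z i = 0.
Proof. by move=> /ct_norm ->; rewrite scaler0. Qed.

Definition dilate : cotangent M := Cotangent dilate_law dilate_norm.

End Dilation.

Definition cosphere (R : realType) (m : nat) (M : bmanifold R m)
    (H : cotangent M -> R) : set (cotangent M) :=
  [set z | nonzero z /\ H z = 2^-1].

Definition hamiltonian (R : realType) (m : nat) (M : bmanifold R m)
    (H : cotangent M -> R) : Prop :=
  [/\ smooth_on (ct_charts M) (@nonzero R m M) H,
      forall z, nonzero z -> 0 < H z,
      forall z lambda, nonzero z -> 0 < lambda ->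
        H (dilate lambda z) = lambda ^+ 2 * H z &
      forall z (i : cidx (ct_charts M)) d, cosphere H z ->
        is_gradient i (@nonzero R m M) H z d -> d != 0].

Definition boundary_defining (R : realType) (m : nat) (M : bmanifold R m)
    (rho : M -> R) : Prop :=
  [/\ smooth_on (bm_charts M) setT rho,
      forall p, 0 <= rho p,
      forall p, rho p = 0 <-> bdry p &
      forall p (i : cidx (bm_charts M)) e, bdry p ->
        is_gradient i setT rho p e -> e != 0].

(* With d = (H_x, H_xi), the components (H_xi, - H_x) of X_H. *)
Definition hamvec (R : realType) (n : nat) (d : 'rV[R]_(n + n)) :
    'rV[R]_(n + n) :=
  row_mx (rsubmx d) (- lsubmx d).

(* <d rho, H_xi> = v at z *)
Definition drho_Hxi (R : realType) (m : nat) (M : bmanifold R m)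
    (H : cotangent M -> R) (rho : M -> R) (z : cotangent M) (v : R) : Prop :=
  exists (i : cidx (bm_charts M)) (d : 'rV[R]_(m.+1 + m.+1)) (e : 'rV[R]_m.+1),
    [/\ is_gradient (X := ct_charts M) i (@nonzero R m M) H z d,
        is_gradient i setT rho (ct_base z) e &
        v = (rsubmx d *m e^T) 0 0].

(* X_H phi = v at z, for phi defined on a set A to which X_H is tangent. *)
Definition XH_deriv (R : realType) (m : nat) (M : bmanifold R m)
    (H : cotangent M -> R) (A : set (cotangent M)) (phi : cotangent M -> R)
    (z : cotangent M) (v : R) : Prop :=
  exists (i : cidx (ct_charts M)) (d e : 'rV[R]_(m.+1 + m.+1)),
    [/\ is_gradient i (@nonzero R m M) H z d,
        is_gradient i A phi z e &
        v = (hamvec d *m e^T) 0 0].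

(* gamma is an integral curve of X_H on [a, b] (derivatives taken within
   [a, b], thus one-sided at the end points). *)
Definition integral_curve (R : realType) (m : nat) (M : bmanifold R m)
    (H : cotangent M -> R) (a b : R) (gamma : R -> cotangent M) : Prop :=
  forall t, a <= t <= b -> nonzero (gamma t) /\
    exists (i : cidx (ct_charts M)) (d : 'rV[R]_(m.+1 + m.+1)),
      [/\ is_gradient i (@nonzero R m M) H (gamma t) d,
          \forall s \near within `[a, b] (nbhs t), cdom i (gamma s) &
          (s - t)^-1 *: (ccoord i (gamma s) - ccoord i (gamma t))
            @[s --> within `[a, b] t^'] --> hamvec d].

Definition unit_bichar (R : realType) (m : nat) (M : bmanifold R m)
    (H : cotangent M -> R) (a b : R) (gamma : R -> cotangent M) : Prop :=
  integral_curve H a b gamma /\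
  forall t, a <= t <= b -> cosphere H (gamma t).

(* y = Phi^s z, for s >= 0 and z in the cosphere bundle *)
Definition flow (R : realType) (m : nat) (M : bmanifold R m)
    (H : cotangent M -> R) (s : R) (z y : cotangent M) : Prop :=
  exists gamma, [/\ unit_bichar H 0 s gamma, gamma 0 = z & gamma s = y].

(* The unit bicharacteristic issued from z (over U) hits T*M|V for the first
   time, transversally, at the positive time l.  Meeting T*M|U again before is
   excluded: this could only be a tangential contact, at which points of Gamma
   over U would not be initial points of its bicharacteristics. *)
Definition first_hit (R : realType) (m : nat) (M : bmanifold R m)
    (H : cotangent M -> R) (rho : M -> R) (U V : set M) (z : cotangent M)
    (l : R) : Prop :=
  0 < l /\ exists gamma,
    [/\ unit_bichar H 0 l gamma, gamma 0 = z, V (ct_base (gamma l)),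
        (forall s, 0 <= s < l -> ~ V (ct_base (gamma s))) /\
        (forall s, 0 < s < l -> ~ U (ct_base (gamma s))) &
        exists2 v, drho_Hxi H rho (gamma l) v & v != 0].

Definition bdry_open (R : realType) (m : nat) (M : bmanifold R m) (U : set M) :
    Prop :=
  exists2 A, open A & U = A `&` @bdry R m M.

(* UU, zeta, ell are as in the definition of Gamma, where "zeta w is the unique
   point near (x_0, xi^0)" refers to the neighbourhood W of (x_0, xi^0). *)
Definition admissible (R : realType) (m : nat) (M : bmanifold R m)
    (H : cotangent M -> R) (rho : M -> R) (U V : set M) (W : set (cotangent M))
    (UU : set (bcotangent M)) (zeta : bcotangent M -> cotangent M)
    (ell : bcotangent M -> R) : Prop :=
  [/\ forall w, UU w -> U (bc_base w),
      forall w, UU w -> [/\ W (zeta w), is_restriction (zeta w) w,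
        cosphere H (zeta w) & first_hit H rho U V (zeta w) (ell w)],
      forall w z l, UU w -> W z -> is_restriction z w -> cosphere H z ->
        first_hit H rho U V z l -> z = zeta w &
      smooth_map (bc_charts M) (ct_charts M) UU zeta].

Definition Gamma (R : realType) (m : nat) (M : bmanifold R m)
    (H : cotangent M -> R) (UU : set (bcotangent M))
    (zeta : bcotangent M -> cotangent M) (ell : bcotangent M -> R) :
    set (cotangent M) :=
  [set z | exists (lambda : R) (w : bcotangent M) (s : R) (y : cotangent M),
    [/\ 0 < lambda, UU w, 0 <= s <= ell w, flow H s (zeta w) y &
        z = dilate lambda y]].

Definition Gamma_over (R : realType) (m : nat) (M : bmanifold R m)
    (H : cotangent M -> R) (UU : set (bcotangent M))
    (zeta : bcotangent M -> cotangent M) (ell : bcotangent M -> R) (U : set M) :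
    set (cotangent M) :=
  Gamma H UU zeta ell `&` [set z | U (ct_base z)].

(* gamma, restricted to [0, l], is a maximal unit bicharacteristic in Gamma. *)
Definition Gamma_bichar (R : realType) (m : nat) (M : bmanifold R m)
    (H : cotangent M -> R) (UU : set (bcotangent M))
    (zeta : bcotangent M -> cotangent M) (ell : bcotangent M -> R)
    (gamma : R -> cotangent M) (l : R) : Prop :=
  exists w, [/\ UU w, l = ell w, unit_bichar H 0 l gamma & gamma 0 = zeta w].

Definition xray (R : realType) (m : nat) (M : bmanifold R m)
    (f : cotangent M -> R) (gamma : R -> cotangent M) (l : R) : R :=
  (\int[@lebesgue_measure R]_(t in `[0, l]) f (gamma t))%R.

(* Main.v *)
Require Import Defs.
From HB Require Import structures.
From mathcomp Require Import all_boot all_order all_algebra.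
From mathcomp Require Import all_classical all_reals all_analysis.
From mathcomp Require Import ring lra.
Set Implicit Arguments.
Unset Strict Implicit.
Unset Printing Implicit Defensive.
Import Order.TTheory GRing.Theory Num.Theory.
Import numFieldNormedType.Exports.
Local Open Scope classical_set_scope.
Local Open Scope ring_scope.

(** One direction is the fundamental theorem of calculus: along a maximal unit
bicharacteristic [gamma], [phi (gamma t)] has derivative [(X_H phi) (gamma t)],
so for [f = X_H phi] the integral of [f] is the difference of the values of
[phi] over [V] and over [U], which vanish ([xray_XH_deriv]).

For the converse, [phi z] is the integral of [f] along the bicharacteristic
through [z], from its initial point over [U] up to [z].  This does not depend
on the choice of the bicharacteristic: two segments through [z] agree backwards
from [z] ([ic_unique]), so the initial point of the shorter one lies on the
longer one; that point is over [U], which a segment of Gamma meets only at its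
start ([gam_inj]).  By construction [phi] vanishes over [U], it vanishes over
[V] because the X-ray transform of [f] does, and [X_H phi = f] as soon as [phi]
is smooth ([phi_deriv]).

Smoothness up to the boundary is the point of the proof ([phi_smooth]): in a
chart, [phi] has to be the restriction of a function that is smooth on an open
set of the whole coordinate space.  Extended past the boundary, H has a
Hamilton field X on such open sets, and the value of [phi] at a nearby point
[z'] is found by flowing backwards from [z'].

- Near an initial point ([rep_start]), [rho] increases along X with a speed
  [v = <d rho, H_xi>] bounded below.  Flowing along [X / v] for the time
  [- rho z'] leads exactly to the boundary, so no hitting time has to be solved
  for, and the integral of [f / v] along this flow is a smooth function of the
  coordinates of [z'] whose opposite is [phi z'].
- From a smooth expression near [gamma r] to one near [gamma (r + sigma)]
  ([rep_transport]), flow backwards for the fixed time [sigma] and add the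
  integral of [f].  The bicharacteristic through [z'] must not have started
  less than [sigma] ago.  Here the smallness of the neighbourhood [W0] enters:
  it keeps the base points of the initial points in a closed set [C] inside
  [U].  As [gamma] is not over [U] after time 0, a neighbourhood of its points
  contains no initial point.

Both constructions are the time 1 map of [theta *: X / v] for a smooth function
[theta] of the initial point ([flow_back]), and a connectedness argument on
[[0, s]] ([interval_propagation]) puts them together.

This rests on the smooth dependence of solutions of ordinary differential
equations on parameters ([sol_smooth], [flow_param]).  It also rests on the fact
that changes of canonical coordinates are symplectic ([ct_lift_symplectic]), so
that an integral curve satisfies the Hamilton equations in every chart
([ic_chart]), and on the confinement of curves to a chart for a time that
depends only on their speed ([ic_stay]). *)

Notation pd l f := ('D_(delta_mx 0 l) f) (only parsing).

(** * Norms of row vectors and mean value inequalities *)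

Section Norm.
Context {R : realType}.

Lemma rV_norm_le N (x : 'rV[R]_N) C :
  0 <= C -> (forall l, `|x 0 l| <= C) -> `|x| <= C.
Proof.
move=> C0 xC; rewrite [leLHS]/Num.Def.normr/= mx_normrE bigmax_le//= => -[i j] _.
by rewrite ord1 /=.
Qed.

Lemma coord_le_norm N (x : 'rV[R]_N) l : `|x 0 l| <= `|x|.
Proof.
by rewrite [leRHS]/Num.Def.normr/= mx_normrE; exact: (le_bigmax _ _ (0, l)).
Qed.

Lemma delta_norm_le N (l : 'I_N) : `|delta_mx 0 l : 'rV[R]_N| <= 1.
Proof.
apply: rV_norm_le => // k; rewrite mxE; case: (_ && _) => /=; by rewrite ?normr1 ?normr0.
Qed.

Lemma norm_row_mx N N' (x : 'rV[R]_N) (y : 'rV[R]_N') C :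
  `|x| <= C -> `|y| <= C -> `|row_mx x y| <= C.
Proof.
move=> xC yC; apply: rV_norm_le; first exact: le_trans (normr_ge0 _) xC.
move=> l; rewrite mxE; case: (fintype.split l) => k; exact: le_trans (coord_le_norm _ _) _.
Qed.

Lemma norm_lsubmx N N' (x : 'rV[R]_(N + N')) : `|lsubmx x| <= `|x|.
Proof. by apply: rV_norm_le => // l; rewrite mxE coord_le_norm. Qed.

End Norm.

Section OneDim.
Context {R : realType}.
Implicit Types f g : R -> R.

Lemma le_increment f g f' g' a b : a <= b ->
  {within `[a, b], continuous f} -> {within `[a, b], continuous g} ->
  (forall t, a < t < b -> is_derive t 1 f (f' t)) ->
  (forall t, a < t < b -> is_derive t 1 g (g' t)) ->
  (forall t, a < t < b -> f' t <= g' t) -> f b - f a <= g b - g a.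
Proof.
rewrite le_eqVlt => /predU1P[-> |ab] cf cg df dg fg; first by rewrite !subrr.
have [||c cab] := @MVT R (g \- f) (g' \- f') a b ab.
- move=> x; rewrite in_itv /= => xab; have := df _ xab; have := dg _ xab => ? ?.
  exact: is_deriveB.
- by move=> x; apply: continuousB; [exact: cg|exact: cf].
move=> /= E; rewrite -subr_ge0.
have -> : g b - g a - (f b - f a) = (g' c - f' c) * (b - a) by rewrite -E; ring.
by rewrite mulr_ge0 ?subr_ge0 ?fg ?ltW // -?in_itv.
Qed.

(** Growth of [f] dominated by that of a majorant [g], rather than by a constant,
so that exponential bounds can be integrated. *)
Lemma norm_increment f g f' g' a b : a <= b ->
  {within `[a, b], continuous f} -> {within `[a, b], continuous g} ->
  (forall t, a < t < b -> is_derive t 1 f (f' t)) ->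
  (forall t, a < t < b -> is_derive t 1 g (g' t)) ->
  (forall t, a < t < b -> `|f' t| <= g' t) -> `|f b - f a| <= g b - g a.
Proof.
move=> ab cf cg df dg fg; rewrite ler_norml; apply/andP; split; last first.
  apply: (le_increment ab cf cg df dg) => t tab.
  exact: le_trans (ler_norm _) (fg _ tab).
rewrite lerNl opprB.
have -> : f a - f b = (\- f) b - (\- f) a by rewrite /= opprK addrC.
apply: (@le_increment _ _ (\- f') g' _ _ ab _ cg _ dg).
- by move=> x; apply: continuousN; exact: cf.
- by move=> t tab; have := df _ tab => ?; exact: is_deriveN.
- by move=> t tab /=; apply: le_trans (fg _ tab); rewrite -normrN ler_norm.
Qed.

Lemma lip_increment f f' a b C : a <= b ->
  {within `[a, b], continuous f} ->
  (forall t, a < t < b -> is_derive t 1 f (f' t)) ->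
  (forall t, a < t < b -> `|f' t| <= C) -> `|f b - f a| <= C * (b - a).
Proof.
move=> ab cf df fC; rewrite mulrBr.
apply: (@norm_increment f (fun t => C * t) f' (fun=> C)) => //.
- by apply: continuous_subspaceT => x; apply: mulrl_continuous.
- move=> t _; have := @is_deriveZ R R R id C t 1 1 _ => /(_ (is_derive_id _ _)).
  by rewrite /GRing.scale /= mulr1.
Qed.

End OneDim.

(** * First order expansions and the chain rule *)

Section Derivatives.
Context {R : realType}.

(** Unfolds [is_derive] to the limit of difference quotients, the form in which
one-sided and within-interval limits can be compared. *)
Lemma is_deriveP (V W : normedModType R) (f : V -> W) (x v : V) (d : W) :
  is_derive x v f d <->
  (h^-1 *: (f (h *: v + x) - f x)) @[h --> (0 : R)^'] --> d.
Proof.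
split=> [[/= fd <-]|fd]; first exact: fd.
by split; [apply/cvg_ex; exists d|exact: cvg_lim fd].
Qed.

Lemma is_derive_linear (V W : normedModType R) (f : V -> W) (x v : V) :
  (forall (h : R) y z, f (h *: y + z) = h *: f y + f z) -> is_derive x v f (f v).
Proof.
move=> lin; apply/is_deriveP; apply: cvg_near_cst; near=> h.
by rewrite lin addrK scalerA mulVf ?scale1r //; near: h; exact: nbhs_dnbhs_neq.
Unshelve. all: by end_near. Qed.

Lemma is_derive_coord N (k : 'I_N) (x v : 'rV[R]_N) :
  is_derive x v (fun y => y 0 k) (v 0 k).
Proof.
have := @is_derive_linear 'rV[R]_N R (fun y => y 0 k) x v; apply => h y z.
by rewrite !mxE.
Qed.

Definition dotp N (c : 'I_N -> R) (h : 'rV[R]_N) : R := \sum_k h 0 k * c k.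

Lemma dotp_linear N c (h : R) (y z : 'rV[R]_N) :
  dotp c (h *: y + z) = h *: dotp c y + dotp c z.
Proof.
rewrite /dotp scaler_sumr -big_split /=; apply: eq_bigr => k _.
by rewrite !mxE mulrDl /GRing.scale /= mulrA.
Qed.

Lemma dotp_delta N (c : 'I_N -> R) l : dotp c (delta_mx 0 l) = c l.
Proof.
rewrite /dotp (bigD1 l) //= mxE !eqxx mul1r big1 ?addr0 // => k kl.
by rewrite mxE (negbTE kl) mul0r.
Qed.

Lemma dotp0 N c : dotp c (0 : 'rV[R]_N) = 0.
Proof. by rewrite /dotp big1 // => k _; rewrite mxE mul0r. Qed.

Lemma dotpZ N c (h : R) (y : 'rV[R]_N) : dotp c (h *: y) = h * dotp c y.
Proof. by rewrite -[h *: y]addr0 dotp_linear dotp0 addr0. Qed.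

Lemma dotpB N c (y z : 'rV[R]_N) : dotp c (y - z) = dotp c y - dotp c z.
Proof. by rewrite addrC -scaleN1r dotp_linear scaleN1r addrC. Qed.

Lemma dotp_norm N (c : 'I_N -> R) h C : (forall k, `|c k| <= C) ->
  `|dotp c h| <= N%:R * C * `|h|.
Proof.
move=> cC; apply: le_trans (ler_norm_sum _ _ _) _.
apply: (@le_trans _ _ (\sum_(k < N) C * `|h|)); last first.
  by rewrite sumr_const card_ord -mulrA mulr_natl.
by apply: ler_sum => k _; rewrite normrM mulrC ler_pM // coord_le_norm.
Qed.

Definition in_box N (a b y : 'rV[R]_N) :=
  forall l, exists2 t, 0 <= t <= 1 & y 0 l = a 0 l + t * (b 0 l - a 0 l).

Lemma in_box_norm N (a b y : 'rV[R]_N) : in_box a b y -> `|y - a| <= `|b - a|.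
Proof.
move=> yb; apply: rV_norm_le => // l; have [t /andP[t0 t1] yE] := yb l.
rewrite !mxE yE addrAC subrr add0r normrM (ger0_norm t0).
apply: (@le_trans _ _ `|b 0 l - a 0 l|); first by rewrite ler_piMl.
by have := coord_le_norm (b - a) l; rewrite !mxE.
Qed.

Lemma in_box_ball N (a b y c : 'rV[R]_N) r : in_box a b y ->
  `|a - c| <= r -> `|b - c| <= r -> `|y - c| <= r.
Proof.
move=> yb ar br; apply: rV_norm_le => [|l]; first exact: le_trans ar.
have [t /andP[t0 t1] yE] := yb l.
have -> : (y - c) 0 l = (1 - t) * (a - c) 0 l + t * (b - c) 0 l.
  by rewrite !mxE yE; ring.
apply: le_trans (ler_normD _ _) _; rewrite !normrM (ger0_norm t0).
rewrite (ger0_norm (_ : 0 <= 1 - t)) ?subr_ge0 //.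
have -> : r = (1 - t) * r + t * r by ring.
by rewrite lerD // ler_wpM2l ?subr_ge0 // (le_trans (coord_le_norm _ _)).
Qed.

(** Mean value inequality, moving from [a] to [b] one coordinate at a time; the
intermediate points stay in the box, not on the segment. *)
Lemma box_lipschitz N (f : 'rV[R]_N -> R) (a b : 'rV[R]_N) C :
  (forall y, in_box a b y -> forall l,
     derivable f y (delta_mx 0 l) /\ `|pd l f y| <= C) ->
  `|f b - f a| <= N%:R * C * `|b - a|.
Proof.
move=> fC; pose y (j : nat) : 'rV[R]_N := \row_l (if (l < j)%N then b 0 l else a 0 l).
have y0 : y 0%N = a by apply/rowP => l; rewrite mxE.
have yN : y N = b by apply/rowP => l; rewrite mxE ltn_ord.
have -> : f b - f a = \sum_(j < N) (f (y j.+1) - f (y j)).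
  rewrite -y0 -[in f b]yN -(big_mkord predT (fun j => f (y j.+1) - f (y j))) /=.
  by rewrite (@telescope_sumr_eq _ 0 N (f \o y)).
apply: le_trans (ler_norm_sum _ _ _) _.
apply: (@le_trans _ _ (\sum_(k < N) C * `|b - a|)); last first.
  by rewrite sumr_const card_ord -mulrA mulr_natl.
apply: ler_sum => j _.
pose d := b 0 j - a 0 j; pose c t := y j + t *: (d *: delta_mx 0 j).
have c0 : c 0 = y j by rewrite /c scale0r addr0.
have c1 : c 1 = y j.+1.
  apply/rowP => l; rewrite !mxE mul1r ltnS (leq_eqVlt l j).
  case: (eqVneq l j) => [-> |lj] /=.
    by rewrite ltnn eqxx /= mulr1 /d addrC subrK.
  by rewrite mulr0 addr0 (_ : (l == j :> nat) = false) //; apply/negbTE; rewrite eqE /= in lj.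
have cbox (t : R) : 0 <= t <= 1 -> in_box a b (c t).
  move=> t01 l; rewrite !mxE; case: (ltngtP l j) => lj /=.
  - exists 1; first by rewrite ler01 lexx.
    by rewrite eqE /= (ltn_eqF lj) !mulr0; ring.
  - exists 0; first by rewrite ler01 lexx.
    by rewrite eqE /= (gtn_eqF lj) !mulr0; ring.
  - exists t => //; have -> : l = j by exact/val_inj.
    by rewrite eqxx /d /= mulr1.
have dc (t : R) : 0 <= t <= 1 -> is_derive t 1 (f \o c) (d * pd j f (c t)).
  move=> t01; have [fd _] := fC _ (cbox _ t01) j.
  have /is_deriveP H : is_derive (c t) (delta_mx 0 j) f (pd j f (c t)) by exact: derivableP.
  have Hs : is_derive (0 : R) (1 : R) (fun s : R => f (s *: delta_mx 0 j + c t)) (pd j f (c t)).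
    apply/is_deriveP; move: H; apply: cvg_trans; apply: near_eq_cvg; near=> h.
    by rewrite addr0 scale0r add0r /= [h *: 1]mulr1.
  pose g (u : R) := d * (u - t).
  have Hg : is_derive t 1 g d.
    have := @is_deriveZ R R R (fun u => u - t) d t 1 1 _.
    rewrite /GRing.scale /= mulr1; apply.
    have := @is_deriveB R R R id (cst t) t 1 1 0 (is_derive_id _ _) (is_derive_cst _ _ _).
    by rewrite subr0.
  have := @is_derive1_comp R (fun s => f (s *: delta_mx 0 j + c t)) g t (pd j f (c t)) d.
  rewrite {1}/g subrr mulr0 mulrC => /(_ Hs Hg).
  congr (is_derive _ _ _ _); apply/funext => u /=; congr f.
  by apply/rowP => k; rewrite /g !mxE; ring.
rewrite -c0 -c1.
apply: (@le_trans _ _ (C * `|b - a| * (1 - 0))); last by rewrite subr0 mulr1.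
apply: (@lip_increment R (f \o c) (fun t => d * pd j f (c t))) => //.
- apply: derivable_within_continuous => t; rewrite in_itv /= => t01.
  by have [] := dc _ t01.
- by move=> t /andP[t0 t1]; apply: dc; rewrite !ltW.
move=> t /andP[t0 t1]; rewrite normrM mulrC ler_pM //.
  by have [] := fC (c t) (cbox t _) j; rewrite // !ltW.
by have := coord_le_norm (b - a) j; rewrite !mxE.
Unshelve. all: by end_near. Qed.

Definition C1at N (f : 'rV[R]_N -> R) x :=
  (\forall y \near x, forall l, derivable f y (delta_mx 0 l)) /\
  forall l, {for x, continuous (pd l f)}.

(** Continuous partial derivatives imply differentiability: the remainder is
[f] minus its linear part at [x], whose partial derivatives are small near [x], so
[box_lipschitz] applies. *)
Lemma first_order N (f : 'rV[R]_N -> R) x : C1at f x ->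
  forall e, 0 < e -> \forall y \near x,
    `|f y - f x - dotp (fun k => pd k f x) (y - x)| <= e * `|y - x|.
Proof.
move=> [fd fc] e e0.
pose c k := pd k f x; pose g z := f z - dotp c z.
have e'0 : 0 < e / N.+1%:R by rewrite divr_gt0 // ltr0n.
have : \forall y \near x, forall l, derivable f y (delta_mx 0 l) /\
    `|pd l f y - pd l f x| <= e / N.+1%:R.
  near=> y => l; split; first by move: l; near: y.
  rewrite distrC; move: l; near: y; apply: filter_forall => l.
  by move/cvgrPdist_le : (fc l); apply.
move=> /nbhs_ballP[r /= r0 rP]; apply/nbhs_ballP; exists r => //= y xy.
have -> : f y - f x - dotp c (y - x) = g y - g x.
  by rewrite /g dotpB; ring.
have {xy} yr : `|y - x| < r by move: xy; rewrite -ball_normE /= distrC.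
apply: le_trans (_ : N%:R * (e / N.+1%:R) * `|y - x| <= _).
  apply: box_lipschitz => z /in_box_norm zx l.
  have [] := rP z _ l.
    by rewrite -ball_normE /= distrC (le_lt_trans zx).
  move=> /derivableP fz fzx.
  have Hc := @is_derive_linear _ _ (dotp c) z (delta_mx 0 l) (@dotp_linear _ c).
  have [gd ->] := @is_deriveB _ _ _ f (dotp c) z (delta_mx 0 l) _ _ fz Hc.
  by rewrite dotp_delta.
rewrite ler_wpM2r // mulrCA ler_piMr ?(ltW e0) // ler_pdivrMr ?ltr0n // mul1r ler_nat //.
Unshelve. all: by end_near. Qed.

(** The chain rule for difference quotients along an arbitrary filter.  It serves
for ordinary derivatives and for derivatives within an interval alike. *)
Lemma chain_cvg N (f : 'rV[R]_N -> R) x (T : Type) (F : set_system T) (FF : Filter F)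
    (r : T -> R) (c : T -> 'rV[R]_N) (w : 'rV[R]_N) : C1at f x ->
  c s @[s --> F] --> x ->
  (r s)^-1 *: (c s - x) @[s --> F] --> w ->
  (r s)^-1 * (f (c s) - f x) @[s --> F] --> dotp (fun k => pd k f x) w.
Proof.
move=> fC cx rw; pose L := dotp (fun k => pd k f x).
apply/cvgrPdist_le => e e0.
pose C := \big[Num.max/0]_k `|pd k f x|.
have CP k : `|pd k f x| <= C by exact: le_bigmax.
have C0 : 0 <= C by exact: bigmax_ge_id.
have NC0 : 0 <= N%:R * C by rewrite mulr_ge0.
(* e1 controls the remainder of first_order, e2 the distance of the quotient to w *)
pose e1 := e / 2 / (`|w| + 1); pose e2 := Num.min 1 (e / 2 / (N%:R * C + 1)).
have e10 : 0 < e1 by rewrite !divr_gt0 // ltr_wpDl.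
have e20 : 0 < e2 by rewrite lt_min ltr01 !divr_gt0 // ltr_wpDl.
have H1 := first_order fC e10.
near=> s.
have A1 : `|f (c s) - f x - L (c s - x)| <= e1 * `|c s - x|.
  by near: s; exact: (cx _ H1).
have A2 : `|w - (r s)^-1 *: (c s - x)| <= e2.
  by near: s; move/cvgrPdist_le : rw; apply.
have -> : L w - (r s)^-1 * (f (c s) - f x) =
   L (w - (r s)^-1 *: (c s - x)) - (r s)^-1 * (f (c s) - f x - L (c s - x)).
  by rewrite /L dotpB dotpZ; ring.
apply: le_trans (ler_normB _ _) _; rewrite [e]splitr lerD //.
  apply: le_trans (dotp_norm _ CP) _.
  apply: (@le_trans _ _ (N%:R * C * (e / 2 / (N%:R * C + 1)))).
    by rewrite ler_wpM2l // (le_trans A2) // ge_min lexx orbT.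
  rewrite mulrCA ler_piMr ?divr_ge0 ?(ltW e0) // ler_pdivrMr ?ltr_wpDl // mul1r lerDl; exact: ler01.
rewrite normrM; apply: le_trans (ler_wpM2l _ A1) _ => //.
rewrite mulrCA -normrZ.
apply: (@le_trans _ _ (e1 * (`|w| + 1))).
  rewrite ler_wpM2l ?(ltW e10) // -lerBlDl (le_trans (lerB_dist _ _)) //.
  rewrite [X in `|X|](_ : _ = - (w - (r s)^-1 *: (c s - x))) ?normrN.
    by rewrite (le_trans A2) // ge_min lexx.
  by rewrite opprB.
by rewrite /e1 divfK // gt_eqF // ltr_wpDl.
Unshelve. all: by end_near. Qed.

Lemma cvg_mx N (T : Type) (F : set_system T) (FF : Filter F) (c : T -> 'rV[R]_N) (x : 'rV[R]_N) :
  (forall k, c s 0 k @[s --> F] --> x 0 k) <-> c s @[s --> F] --> x.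
Proof.
split=> [H|H k]; last first.
  exact: (cvg_comp _ _ H (@coord_continuous R 1 N 0 k x)).
apply/cvgrPdist_le => e e0; near=> s.
apply: rV_norm_le; first exact: ltW.
move=> l; rewrite !mxE; move: l; near: s; apply: filter_forall => l.
by move/cvgrPdist_le : (H l); apply.
Unshelve. all: by end_near. Qed.

Lemma is_derive_chain (V : normedModType R) N (f : 'rV[R]_N -> R) (G : V -> 'rV[R]_N) x v (w : 'rV[R]_N) :
  C1at f (G x) -> (forall k, is_derive x v (fun y => G y 0 k) (w 0 k)) ->
  is_derive x v (fun y => f (G y)) (dotp (fun k => pd k f (G x)) w).
Proof.
move=> fC Gw; apply/is_deriveP.
apply: (@chain_cvg _ f (G x) R (0^') _ id (fun h => G (h *: v + x))) => //.
  apply/cvg_mx => k;   have /is_deriveP Gk := Gw k.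
  have : (h * (h^-1 *: (G (h *: v + x) 0 k - G x 0 k)) + G x 0 k) @[h --> (0:R)^'] --> 0 * w 0 k + G x 0 k.
    apply: cvgD; last exact: cvg_cst.
    by apply: cvgM => //; exact: nbhs_dnbhs.
  rewrite mul0r add0r; apply: cvg_trans; apply: near_eq_cvg; near=> h.
  rewrite /GRing.scale /= mulrA mulfV ?mul1r ?subrK //.
  by near: h; exact: nbhs_dnbhs_neq.
apply/cvg_mx => k; have /is_deriveP Gk := Gw k.
by move: Gk; apply: cvg_trans; apply: near_eq_cvg; near=> h; rewrite !mxE.
Unshelve. all: by end_near. Qed.

End Derivatives.

(** * Functions of class C^k on open sets *)

Section Ck_theory.
Context {R : realType}.

Lemma is_derive_line (V : normedModType R) (f : V -> R) (v z : V) (t d : R) :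
  is_derive (t *: v + z) v f d -> is_derive t (1 : R) (fun s : R => f (s *: v + z)) d.
Proof.
move=> /is_deriveP fd; apply/is_deriveP; move: fd; apply: cvg_trans.
apply: near_eq_cvg; near=> h; rewrite /= [h *: 1]mulr1 scalerDl addrA //.
Unshelve. all: by end_near. Qed.

Implicit Types (N M k : nat).

Lemma Ck_continuous N k (O : set 'rV[R]_N) f x : Ck k O f -> O x -> {for x, continuous f}.
Proof. by case: k => [|k] /= => [H|[H _]]; exact: H. Qed.

Lemma CkS_is_derive N k (O : set 'rV[R]_N) f x l : Ck k.+1 O f -> O x ->
  is_derive x (delta_mx 0 l) f (pd l f x).
Proof. by move=> [_ /(_ l)[fd _]] Ox; apply: derivableP; exact: fd. Qed.

Lemma CkS_pd N k (O : set 'rV[R]_N) f l : Ck k.+1 O f -> Ck k O (pd l f).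
Proof. by move=> [_ /(_ l)[]]. Qed.

Lemma Ck_eq N k (O : set 'rV[R]_N) f g : open O ->
  (forall x, O x -> f x = g x) -> Ck k O f -> Ck k O g.
Proof.
elim: k f g => [|k IH] f g oO fg.
  move=> fc x Ox; have := fc _ Ox; rewrite /prop_for /continuous_at -(fg _ Ox).
  apply: cvg_trans; apply: (@near_eq_cvg _ _ (nbhs x)); near=> y.
  by apply: fg; near: y; exact: open_nbhs_nbhs.
move=> fC; split.
  move=> x Ox; have := Ck_continuous fC Ox; rewrite /prop_for /continuous_at -(fg _ Ox).
  apply: cvg_trans; apply: (@near_eq_cvg _ _ (nbhs x)); near=> y.
  by apply: fg; near: y; exact: open_nbhs_nbhs.
move=> l.
have fgd x : O x -> is_derive x (delta_mx 0 l) g (pd l f x).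
  move=> Ox; apply: near_eq_is_derive (CkS_is_derive l fC Ox).
  by near=> y; apply: fg; near: y; exact: open_nbhs_nbhs.
split=> [x /fgd[]//|]; apply: (IH (pd l f)) => // [x /fgd[]//|]; exact: CkS_pd.
Unshelve. all: by end_near. Qed.

Lemma CkS_intro N k (O : set 'rV[R]_N) f : open O ->
  (forall x, O x -> {for x, continuous f}) ->
  (forall l, exists2 g, (forall x, O x -> is_derive x (delta_mx 0 l) f (g x)) & Ck k O g) ->
  Ck k.+1 O f.
Proof.
move=> oO fc H; split=> // l; have [g fg gC] := H l.
by split=> [x /fg[]//|]; apply: Ck_eq gC => // x /fg[].
Qed.

Lemma CkW N k (O : set 'rV[R]_N) f : Ck k.+1 O f -> Ck k O f.
Proof.
elim: k f => [|k IH] f [fc fd]; first by [].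
by split=> // l; have [? ?] := fd l; split=> //; exact: IH.
Qed.

Lemma Ck_sub N k (O O' : set 'rV[R]_N) f : O' `<=` O -> Ck k O f -> Ck k O' f.
Proof.
move=> O'O; elim: k f => [|k IH] f; first by move=> fc x /O'O; exact: fc.
move=> [fc fd]; split=> [x /O'O|l]; first exact: fc.
by have [fl /IH ?] := fd l; split=> // x /O'O; exact: fl.
Qed.

(** The derivatives in [Ck] are full derivatives at each point, so the condition is
of local nature. *)
Lemma Ck_local N k (O : set 'rV[R]_N) f :
  (forall x, O x -> exists B, [/\ B x & Ck k B f]) -> Ck k O f.
Proof.
elim: k f => [|k IH] f H.
  by move=> x /H [B [Bx fc]]; exact: fc.
split=> [x /H [B [Bx [fc _]]]|l]; first exact: fc.
split=> [x /H [B [Bx [_ /(_ l)[fd _]]]]|]; first exact: fd.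
apply: IH => x /H [B [Bx [_ /(_ l)[_ fd]]]]; by exists B.
Qed.

Lemma C1at_Ck N k (O : set 'rV[R]_N) f x : open O -> O x -> Ck k.+1 O f -> C1at f x.
Proof.
move=> oO Ox [fc fd]; split.
  near=> y => l; have [+ _] := fd l; apply; near: y; exact: open_nbhs_nbhs.
by move=> l; have [_ /Ck_continuous] := fd l; apply.
Unshelve. all: by end_near. Qed.

Lemma Ck_cst N k (O : set 'rV[R]_N) (a : R) : open O -> Ck k O (fun=> a).
Proof.
move=> oO; elim: k a => [|k IH] a; first by move=> x _; exact: (@cst_continuous _ _ a x).
apply: CkS_intro => // [x _|l]; first exact: (@cst_continuous _ _ a x).
by exists (fun=> 0) => // x _; exact: is_derive_cst.
Qed.

Lemma Ck_coord N k (O : set 'rV[R]_N) i : open O -> Ck k O (fun x => x 0 i).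
Proof.
move=> oO; have cc x : {for x, continuous (fun y : 'rV[R]_N => y 0 i)}.
  exact: coord_continuous.
case: k => [|k]; first by [].
apply: CkS_intro => // l; exists (fun=> (delta_mx 0 l : 'rV[R]_N) 0 i); last exact: Ck_cst.
by move=> x _; exact: is_derive_coord.
Qed.

Lemma Ck_add N k (O : set 'rV[R]_N) f g : open O -> Ck k O f -> Ck k O g ->
  Ck k O (fun x => f x + g x).
Proof.
move=> oO; elim: k f g => [|k IH] f g fC gC.
  by move=> x Ox; apply: continuousD; [exact: fC|exact: gC].
apply: CkS_intro => // [x Ox|l].
  by apply: continuousD; apply: Ck_continuous Ox; eassumption.
exists (fun x => pd l f x + pd l g x).
  by move=> x Ox; exact: (is_deriveD (CkS_is_derive l fC Ox) (CkS_is_derive l gC Ox)).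
by apply: IH; exact: CkS_pd.
Qed.

Lemma Ck_mul N k (O : set 'rV[R]_N) f g : open O -> Ck k O f -> Ck k O g ->
  Ck k O (fun x => f x * g x).
Proof.
move=> oO; elim: k f g => [|k IH] f g fC gC.
  by move=> x Ox; apply: continuousM; [exact: fC|exact: gC].
apply: CkS_intro => // [x Ox|l].
  by apply: continuousM; apply: Ck_continuous Ox; eassumption.
exists (fun x => f x * pd l g x + g x * pd l f x).
  by move=> x Ox; exact: (is_deriveM (CkS_is_derive l fC Ox) (CkS_is_derive l gC Ox)).
by apply: Ck_add => //; apply: IH; rewrite //; by [exact: CkS_pd|exact: CkW].
Qed.

Lemma Ck_opp N k (O : set 'rV[R]_N) f : open O -> Ck k O f -> Ck k O (fun x => - f x).
Proof.
move=> oO fC; apply: (@Ck_eq _ _ _ (fun x => -1 * f x)) => // [x _|]; first by rewrite mulN1r.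
by apply: Ck_mul => //; exact: Ck_cst.
Qed.

Lemma Ck_sum N k (O : set 'rV[R]_N) (I : finType) (f : I -> 'rV[R]_N -> R) : open O ->
  (forall i, Ck k O (f i)) -> Ck k O (fun x => \sum_i f i x).
Proof.
move=> oO fC; elim: (index_enum I) => [|i s IH].
  by apply: (@Ck_eq _ _ _ (fun=> 0)) => // [x _|]; [rewrite big_nil|exact: Ck_cst].
apply: (@Ck_eq _ _ _ (fun x => f i x + \sum_(j <- s) f j x)) => // [x _|].
  by rewrite big_cons.
exact: Ck_add.
Qed.

Lemma Ck_inv N k (O : set 'rV[R]_N) f : open O -> (forall x, O x -> f x != 0) ->
  Ck k O f -> Ck k O (fun x => (f x)^-1).
Proof.
move=> oO f0; elim: k f f0 => [|k IH] f f0 fC.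
  by move=> x Ox; apply: continuousV; [exact: f0|exact: fC].
apply: CkS_intro => // [x Ox|l].
  by apply: continuousV; [exact: f0|apply: Ck_continuous Ox; eassumption].
exists (fun x => - ((f x)^-1 * (f x)^-1) * pd l f x).
  move=> x Ox; have [fd _] := CkS_is_derive l fC Ox.
  apply: DeriveDef; first exact: derivableV (f0 _ Ox) fd.
  by rewrite (deriveV (f0 _ Ox) fd) /GRing.scale /= -exprVn expr2.
have Vk : Ck k O (fun x => (f x)^-1) by apply: IH => //; exact: CkW.
apply: Ck_mul => //; last exact: CkS_pd.
by apply: Ck_opp => //; exact: Ck_mul.
Qed.

(** By induction on the order of differentiability, the partial derivatives of
the composition being sums of products given by the chain rule. *)
Lemma Ck_comp N M k (O : set 'rV[R]_M) (O' : set 'rV[R]_N) f (G : 'rV[R]_M -> 'rV[R]_N) :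
  open O -> open O' -> (forall x, O x -> O' (G x)) ->
  (forall a, Ck k O (fun x => G x 0 a)) -> Ck k O' f -> Ck k O (fun x => f (G x)).
Proof.
move=> oO oO' OO'; elim: k f => [|k IH] f GC fC.
all: have fGc : forall x, O x -> {for x, continuous (fun x => f (G x))}.
1,3: move=> x Ox; apply: continuous_comp; [|exact: Ck_continuous fC (OO' _ Ox)];
  apply: (@cvg_mx R N _ (nbhs x) _ G (G x)).1 => a; exact: Ck_continuous (GC a) Ox.
  by [].
apply: CkS_intro => // l.
exists (fun x => \sum_a pd l (fun y => G y 0 a) x * pd a f (G x)).
  move=> x Ox; pose w : 'rV[R]_N := \row_a pd l (fun y => G y 0 a) x.
  have := @is_derive_chain R _ N f G x (delta_mx 0 l) w (C1at_Ck oO' (OO' _ Ox) fC).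
  rewrite /dotp; under eq_bigr do rewrite mxE; apply => a.
  by rewrite mxE; exact: CkS_is_derive (GC a) Ox.
apply: Ck_sum => // a; apply: Ck_mul => //; first exact: CkS_pd.
by apply: (IH (pd a f)); [move=> b; exact: CkW|exact: CkS_pd].
Qed.

(** The second difference of [f] over a square of side [h] is [h * h] times the
mixed derivative, by two applications of the mean value inequality. *)
Lemma mixed_increment N (f : 'rV[R]_N -> R) x (i j : 'I_N) h c e : 0 <= h ->
  (forall y, `|y - x| <= h + h -> [/\ derivable f y (delta_mx 0 i),
    derivable (pd i f) y (delta_mx 0 j) & `|pd j (pd i f) y - c| <= e]) ->
  `|f (h *: delta_mx 0 i + (h *: delta_mx 0 j + x)) - f (h *: delta_mx 0 j + x)
    - f (h *: delta_mx 0 i + x) + f x - h * h * c| <= e * h * h.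
Proof.
move=> h0 H.
pose p s r : 'rV[R]_N := s *: delta_mx 0 i + (r *: delta_mx 0 j + x).
have pH s r : 0 <= s <= h -> 0 <= r <= h -> `|p s r - x| <= h + h.
  move=> /andP[s0 sh] /andP[r0 rh]; rewrite /p addrA addrK.
  apply: le_trans (ler_normD _ _) _; rewrite !normrZ !ger0_norm //.
  by rewrite lerD // -[h]mulr1 ler_pM // delta_norm_le.
have px s : p s 0 = s *: delta_mx 0 i + x by rewrite /p scale0r add0r.
have pC s r : p s r = r *: delta_mx 0 j + (s *: delta_mx 0 i + x).
  by rewrite /p addrCA.
(* the increment of phi over [0, h] is the second difference minus h * h * c *)
pose phi s := f (p s h) - f (p s 0) - s * (h * c).
have hh : 0 <= h <= h by rewrite h0 lexx.
have h00 : (0 : R) <= 0 <= h by rewrite lexx h0.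
have dphi (s : R) : 0 <= s <= h -> is_derive s (1 : R) phi (pd i f (p s h) - pd i f (p s 0) - h * c).
  move=> sh.
  have d1 r : 0 <= r <= h -> is_derive s (1 : R) (fun s => f (p s r)) (pd i f (p s r)).
    by move=> rh; apply: is_derive_line; apply: derivableP; case: (H _ (pH s r sh rh)).
  apply: is_deriveB; first exact: (is_deriveB (d1 _ hh) (d1 _ h00)).
  have := @is_derive_linear R R R (fun s => s * (h * c)) s 1; rewrite mul1r; apply.
  by move=> a y z; rewrite /GRing.scale /=; ring.
have bphi s : 0 <= s <= h -> `|pd i f (p s h) - pd i f (p s 0) - h * c| <= e * h.
  move=> sh; pose psi (r : R) := pd i f (p s r) - r * c.
  have dpsi (r : R) : 0 <= r <= h -> is_derive r (1 : R) psi (pd j (pd i f) (p s r) - c).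
    move=> rh; apply: is_deriveB.
      have -> : (fun r => pd i f (p s r)) = fun r => pd i f (r *: delta_mx 0 j + (s *: delta_mx 0 i + x)).
        by apply/funext => u; rewrite pC.
      by apply: (@is_derive_line _ (pd i f)); rewrite -pC; apply: derivableP; case: (H _ (pH s r sh rh)).
    have := @is_derive_linear R R R (fun s => s * c) r 1; rewrite mul1r; apply.
    by move=> a y z; rewrite /GRing.scale /=; ring.
  have lt01 (r : R) : 0 < r < h -> 0 <= r <= h by move=> /andP[? ?]; rewrite !ltW.
  have := @lip_increment R psi _ 0 h e h0 _ (fun r rh => dpsi r (lt01 r rh)) _.
  have -> : pd i f (p s h) - pd i f (p s 0) - h * c = psi h - psi 0 by rewrite /psi; ring.
  rewrite subr0; apply=> [|r rh].
  - apply: derivable_within_continuous => r; rewrite in_itv /= => rh.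
    by case: (dpsi _ rh).
  - by case: (H (p s r) (pH _ _ sh (lt01 _ rh))).
have lt01 (r : R) : 0 < r < h -> 0 <= r <= h by move=> /andP[? ?]; rewrite !ltW.
have := @lip_increment R phi _ 0 h (e * h) h0 _ (fun s sh => dphi s (lt01 s sh)) _.
have -> : f (h *: delta_mx 0 i + (h *: delta_mx 0 j + x)) - f (h *: delta_mx 0 j + x) -
  f (h *: delta_mx 0 i + x) + f x - h * h * c = phi h - phi 0.
  rewrite /phi !px scale0r add0r -/(p h h).
  have -> : p 0 h = h *: delta_mx 0 j + x by rewrite /p scale0r add0r.
  by ring.
rewrite subr0; apply=> [|r rh].
- apply: derivable_within_continuous => r; rewrite in_itv /= => rh.
  by case: (dphi _ rh).
- exact: bphi (lt01 _ rh).
Qed.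

(** The second difference is symmetric in the two directions, so both mixed
derivatives are its limit after division by [h * h]. *)
Lemma schwarz N (O : set 'rV[R]_N) f x i j : open O -> Ck 2 O f -> O x ->
  pd j (pd i f) x = pd i (pd j f) x.
Proof.
move=> oO fC Ox; apply/eqP; rewrite -subr_eq0 -normr_le0; apply/ler_addgt0Pr => e e0.
rewrite add0r.
pose c := pd j (pd i f) x; pose c' := pd i (pd j f) x.
have P a b : \forall y \near x, [/\ derivable f y (delta_mx 0 a),
    derivable (pd a f) y (delta_mx 0 b) & `|pd b (pd a f) y - pd b (pd a f) x| <= e / 2].
  near=> y; have Oy : O y by near: y; exact: open_nbhs_nbhs.
  split.
  - by have [] := CkS_is_derive a fC Oy.
  - by have [] := CkS_is_derive b (CkS_pd a fC) Oy.
  rewrite distrC; near: y; have := Ck_continuous (CkS_pd b (CkS_pd a fC)) Ox.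
  by move=> /cvgrPdist_le; apply; rewrite divr_gt0.
have [r /= r0 rP] := (nbhs_ballP _ _).1 (filterI (P i j) (P j i)).
pose h := r / 3; have h0 : 0 < h by rewrite divr_gt0.
have hr y : `|y - x| <= h + h -> ball x r y.
  move=> yx; rewrite -ball_normE /= distrC (le_lt_trans yx) // /h.
  have -> : r / 3 + r / 3 = r - r / 3 by field.
  by rewrite ltrBlDr ltrDl divr_gt0.
have A1 := @mixed_increment N f x i j h c (e / 2) (ltW h0) (fun y yx => (rP y (hr y yx)).1).
have A2 := @mixed_increment N f x j i h c' (e / 2) (ltW h0) (fun y yx => (rP y (hr y yx)).2).
move: A1 A2; rewrite [h *: delta_mx 0 j + (h *: delta_mx 0 i + x)]addrCA.
set D := f _; set D1 := f _; set D2 := f _; move=> A1 A2.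
rewrite -/c -/c'; clearbody D D1 D2 c c'.
have : `|h * h * (c - c')| <= e * (h * h).
  have -> : h * h * (c - c') = (D - D2 - D1 + f x - h * h * c') - (D - D1 - D2 + f x - h * h * c) by ring.
  apply: le_trans (ler_normB _ _) _.
  have -> : e * (h * h) = e / 2 * h * h + e / 2 * h * h by field.
  exact: (lerD A2 A1).
rewrite normrM (ger0_norm (mulr_ge0 (ltW h0) (ltW h0))) [h * h * _]mulrC ler_pM2r //.
by rewrite mulr_gt0.
Unshelve. all: by end_near. Qed.

End Ck_theory.

(** * Primitives, Gronwall inequality and global solutions of Lipschitz equations *)

Section Clamp.
Context {R : realType}.
Implicit Types a b s t : R.

(** Retraction onto [[a, b]], used to turn functions given on an interval into
functions on the whole line. *)
Definition clamp a b t : R := Num.max a (Num.min t b).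

Lemma clamp_itv a b t : a <= b -> a <= clamp a b t <= b.
Proof.
move=> ab; rewrite /clamp minEle; case: (lerP t b) => ?; rewrite maxEle.
  by case: (lerP a t) => ?; lra.
by rewrite ab lexx ab.
Qed.

Lemma clamp_id a b t : a <= t <= b -> clamp a b t = t.
Proof.
by move=> /andP[a_t tb]; rewrite /clamp minEle tb maxEle a_t.
Qed.

Lemma clamp_lip a b s t : a <= b -> `|clamp a b s - clamp a b t| <= `|s - t|.
Proof.
have := ler_norm (s - t); have := ler_norm (t - s); rewrite distrC ler_norml.
rewrite /clamp !maxEle !minEle.
by case: (lerP t b) => ?; case: (lerP s b) => ?; (case: (lerP a t) => ?);
  (case: (lerP a s) => ?); (case: (lerP a b) => ?); lra.
Qed.

Lemma clamp_continuous a b : continuous (clamp a b).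
Proof.
move=> t; apply: (@continuous_max R R (cst a) (fun t => Num.min t b) t).
  exact: cst_continuous.
by apply: (@continuous_min R R id (cst b) t); [exact: cvg_id|exact: cst_continuous].
Qed.

Lemma clamp_near a b t : a < t < b -> \forall s \near t, clamp a b s = s.
Proof.
move=> /andP[a_t tb]; near=> s; apply: clamp_id; apply/andP; split; apply: ltW; near: s.
  exact: lt_nbhsr.
exact: lt_nbhsl.
Unshelve. all: by end_near. Qed.

Lemma continuous_clamp (T : topologicalType) (f : R -> T) a b : a <= b ->
  (forall t, a <= t <= b -> f s @[s --> within `[a, b] (nbhs t)] --> f t) ->
  continuous (f \o clamp a b).
Proof.
move=> ab fc t; apply: cvg_trans (fc _ (clamp_itv t ab)).
move=> A; rewrite /within /= => H; have H2 : nbhs t (fun s => clamp a b s \in `[a, b] -> A (f (clamp a b s))) :=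
  @clamp_continuous a b t _ H.
by apply: (filterS _ H2) => s; apply; rewrite in_itv /= clamp_itv.
Qed.

(** The integral from [a - 1] is differentiable at [a] and beyond; clamping makes
it continuous on the whole line. *)
Lemma primitive (h : R -> R) a b : continuous h -> a < b ->
  exists P : R -> R, [/\ continuous P,
    (forall t, a < t < b -> is_derive t (1 : R) P (h t)) &
    (\int[@lebesgue_measure R]_(t in `[a, b]) h t)%R = P b - P a].
Proof.
move=> ch ab.
pose c := a - 1; have ca : c < a by rewrite /c ltrBlDr ltrDl.
have ih u : (@lebesgue_measure R).-integrable `[c, u] (EFin \o h).
  apply: continuous_compact_integrable; first exact: segment_compact.
  exact: continuous_subspaceT.
pose Q x := (\int[@lebesgue_measure R]_(t in [set` `[c, x]]) h t)%R.
have dQ (t : R) : c < t -> is_derive t (1 : R) Q (h t).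
  move=> ct; have tt1 : t < t + 1 by rewrite ltrDl.
  have : derivable Q t 1 /\ (Q^`()%classic) t = h t.
    exact: (@continuous_FTC1_closed R h c t (t + 1) tt1 (ih _) ct (ch t)).
  by clearbody Q; rewrite derive1E => -[? ?]; exact: DeriveDef.
have cQ (t : R) : c < t -> {for t, continuous Q}.
  by move=> ct; have [? _] := dQ _ ct; exact/differentiable_continuous/derivable1_diffP.
clearbody Q; exists (Q \o clamp a b); split.
- move=> t; apply: continuous_comp; first exact: clamp_continuous.
  by apply: cQ; have /andP[+ _] := clamp_itv t (ltW ab); exact: lt_le_trans.
- move=> t tab; apply: near_eq_is_derive (dQ t _); last first.
    by have /andP[+ _] := tab; exact: lt_trans.
  by near=> s; rewrite /= (near (clamp_near tab)).
rewrite /= !clamp_id ?lexx ?(ltW ab) //.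
rewrite /Rintegral (@continuous_FTC2 R h Q a b ab) //.
- exact: continuous_subspaceT.
- split=> [t||].
  + by rewrite in_itv /= => /andP[/(lt_trans ca)/dQ[]].
  + by apply: cvg_at_right_filter; exact: cQ.
  + by apply: cvg_at_left_filter; apply: cQ; exact: lt_trans ab.
- move=> t; rewrite in_itv /= => /andP[/(lt_trans ca)/dQ[_ +] _].
  by rewrite derive1E.
Unshelve. all: by end_near. Qed.

Lemma constant_on (F : R -> R) a b : a <= b -> continuous F ->
  (forall t : R, a < t < b -> is_derive t (1 : R) F 0) -> F b = F a.
Proof.
move=> ab cF dF; apply/eqP; rewrite -subr_eq0 -normr_le0 -[leRHS](mul0r (b - a)).
apply: (@lip_increment R F (fun=> 0)) => //; first exact: continuous_subspaceT cF.
by move=> t _; rewrite normr0.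
Qed.

(** Derivatives at the end points are two-sided here, as the primitive is taken
on the larger interval [[a - 1, b + 1]]. *)
Lemma primitive_on (h : R -> R) a b : continuous h -> a < b ->
  exists F : R -> R, [/\ continuous F, F a = 0,
    (forall t, a <= t <= b -> is_derive t (1 : R) F (h t)) &
    (\int[@lebesgue_measure R]_(t in `[a, b]) h t)%R = F b].
Proof.
move=> ch ab; have [P [cP dP iP]] := primitive ch ab.
have ab' : a - 1 < b + 1 by lra.
have [Q [cQ dQ _]] := primitive ch ab'.
have dQ' (t : R) : a <= t <= b -> is_derive t (1 : R) Q (h t).
  by move=> /andP[? ?]; apply: dQ; apply/andP; split; lra.
exists (fun t => Q t - Q a); split.
- by move=> t; exact: (cvgB (cQ t) (cvg_cst _)).
- by rewrite subrr.
- move=> t /dQ' d; have := is_deriveB d (is_derive_cst (Q a) t (1 : R)); rewrite subr0; exact.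
- rewrite iP; have := @constant_on (fun t => Q t - P t) a b (ltW ab).
  suff H : Q b - P b = Q a - P a -> P b - P a = Q b - Q a.
    move=> H2; apply: H; apply: H2.
      by move=> t; exact: (cvgB (cQ t) (cP t)).
    move=> t tab; have tab' : a <= t <= b by move/andP: tab => [? ?]; rewrite !ltW.
    by have := is_deriveB (dQ' _ tab') (dP _ tab); rewrite subrr; exact.
  move: (Q b) (P b) (Q a) (P a) => x1 x2 x3 x4; clear; lra.
Qed.

Lemma geometric_limit (x : nat -> R) A : (forall n, `|x n.+1 - x n| <= A / 2 ^+ n) ->
  exists l, forall n, `|l - x n| <= 2 * A / 2 ^+ n.
Proof.
move=> H.
have A0 : 0 <= A by have := le_trans (normr_ge0 _) (H 0%N); rewrite expr0 divr1.
pose b n : R := 2 * A / 2 ^+ n.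
have bE n : A / 2 ^+ n = b n - b n.+1.
  by rewrite /b exprS; field; rewrite expf_neq0 // pnatr_eq0.
have b0 n : 0 <= b n by rewrite divr_ge0 ?mulr_ge0 // exprn_ge0.
have hn m n : `|x (m + n)%N - x n| <= b n - b (m + n)%N.
  elim: m => [|m IH]; first by rewrite add0n !subrr normr0.
  have := H (m + n)%N; rewrite bE addSn => H1.
  have -> : x (m + n).+1 - x n = (x (m + n).+1 - x (m + n)%N) + (x (m + n)%N - x n) by ring.
  by apply: le_trans (ler_normD _ _) _; lra.
pose y n := x n - b n.
have ymono : {homo y : n m / (n <= m)%N >-> n <= m}.
  move=> n m /subnK <-; have := hn (m - n)%N n; rewrite /y ler_norml; lra.
have yub : has_ubound (range y).
  exists (x 0%N + b 0%N) => _ [n _ <-]; have := hn n 0%N; rewrite addn0 /y ler_norml.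
  have := b0 n; lra.
have cy := nondecreasing_is_cvgn ymono yub.
have yl := nondecreasing_cvgn_le ymono cy.
exists (limn y) => n; have := yl n; rewrite {1}/y ler_norml -/(b n) => H1.
suff : limn y <= x n + b n by lra.
apply: limr_le => //; near=> k.
have nk : (n <= k)%N by near: k; exists n.
have := hn (k - n)%N n; rewrite subnK // /y ler_norml; have := b0 k; lra.
Unshelve. all: by end_near. Qed.

Lemma le_geometric0 (x A : R) : 0 <= A -> (forall n, x <= A / 2 ^+ n) -> x <= 0.
Proof.
move=> A0 H; apply: (@ler_cvg_to _ (\oo) _ _ (fun=> x) (geometric A 2^-1)).
- exact: cvg_cst.
- by apply: cvg_geometric; rewrite ger0_norm ?invr_ge0 // invf_lt1 // ltr1n.
- by near=> n; rewrite /= exprVn.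
Unshelve. all: by end_near. Qed.

End Clamp.

Section ODE.
Context {R : realType}.
Implicit Types (N : nat).

Definition sol N (F : R -> 'rV[R]_N -> 'rV[R]_N) (u : R -> 'rV[R]_N) :=
  (forall k, continuous (fun t => u t 0 k)) /\
  forall t : R, 0 < t < 1 -> forall k,
    is_derive t (1 : R) (fun s => u s 0 k) (F t (u t) 0 k).

(** The factor [N.+1] comes from comparing the sup norm with the sum of squares,
which is the differentiable quantity; in the exponent the first term is due to
the factor [L] and the second one to the source [e]. *)
Definition gronwall_cst N (L : R) : R := N.+1%:R * expR (2 * N%:R * L + N%:R).

Lemma gronwall_cst_ge1 N L : 0 <= L -> 1 <= gronwall_cst N L.
Proof.
move=> L0; have e1 : 1 <= expR (2 * N%:R * L + N%:R).
  apply: le_trans (expR_ge1Dx _); rewrite lerDl addr_ge0 //.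
  by rewrite mulr_ge0 // mulr_ge0.
rewrite /gronwall_cst -[leLHS]mulr1; apply: ler_pM => //.
by rewrite ler1n.
Qed.

(** The sum of squares of the components of [w], plus [e ^+ 2], times
[expR (- C * t)], is nonincreasing for [C = 2 * N * L + N]. *)
Lemma gronwall N (w w' : R -> 'rV[R]_N) L e : 0 <= L -> 0 <= e ->
  (forall k, continuous (fun t => w t 0 k)) ->
  (forall t : R, 0 < t < 1 -> forall k, is_derive t (1 : R) (fun s => w s 0 k) (w' t 0 k)) ->
  (forall t : R, 0 < t < 1 -> `|w' t| <= L * `|w t| + e) ->
  forall t : R, 0 <= t <= 1 -> `|w t| <= gronwall_cst N L * (`|w 0| + e).
Proof.
move=> L0 e0 cw dw bw t /andP[t0 t1].
pose C := 2 * N%:R * L + N%:R.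
have N0 : (0 : R) <= N%:R by [].
have C0 : 0 <= C by rewrite addr_ge0 // !mulr_ge0.
pose E s := \sum_k (w s 0 k) ^+ 2.
pose E' s := \sum_k (2 * w s 0 k * w' s 0 k).
have wE s : `|w s| ^+ 2 <= E s.
  have E0 : 0 <= E s by apply: sumr_ge0 => k _; exact: sqr_ge0.
  rewrite -[leRHS]sqr_sqrtr // ler_pXn2r ?nnegrE ?sqrtr_ge0 //.
  apply: rV_norm_le; first exact: sqrtr_ge0.
  move=> k; rewrite -sqrtr_sqr ler_wsqrtr // /E (bigD1 k) //= lerDl.
  by apply: sumr_ge0 => j _; exact: sqr_ge0.
have Ew s : E s <= N%:R * `|w s| ^+ 2.
  apply: (@le_trans _ _ (\sum_(k < N) `|w s| ^+ 2)); last first.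
    by rewrite sumr_const card_ord mulr_natl.
  apply: ler_sum => k _; rewrite -[leLHS]ger0_norm ?sqr_ge0 // normrX.
  by rewrite ler_pXn2r ?nnegrE // coord_le_norm.
have cE : continuous E.
  move=> s; rewrite /E; have : {for s, continuous (fun s => \sum_(k <- index_enum 'I_N) w s 0 k ^+ 2)}.
    elim: (index_enum _) => [|k r IH].
      by rewrite (_ : (fun s => _) = fun=> 0); [exact: cst_continuous|apply/funext => u; rewrite big_nil].
    rewrite (_ : (fun s => _) = fun u => w u 0 k ^+ 2 + \sum_(j <- r) w u 0 j ^+ 2); last first.
      by apply/funext => u; rewrite big_cons.
    by apply: continuousD => //; apply: continuousM; exact: cw.
  by [].
have dE (s : R) : 0 < s < 1 -> is_derive s (1 : R) E (E' s).
  move=> s01; have := @is_derive_sum R R R N (fun k s => w s 0 k ^+ 2) s 1 (fun k => 2 * w s 0 k * w' s 0 k).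
  rewrite (_ : \sum_(i < N) _ = E); last by apply/funext => u; rewrite fct_sumE.
  apply => k; have H := dw _ s01 k.
  have := @is_deriveM R R _ _ s 1 _ _ H H; rewrite /GRing.scale /=.
  by have -> : w s 0 k * w' s 0 k + w s 0 k * w' s 0 k = 2 * w s 0 k * w' s 0 k by ring.
pose Z s := (E s + e ^+ 2) * expR (- C * s).
pose Z' s := (E' s - C * (E s + e ^+ 2)) * expR (- C * s).
have dZ (s : R) : 0 < s < 1 -> is_derive s (1 : R) Z (Z' s).
  move=> s01; have H1 := dE _ s01.
  have H2 : is_derive s (1 : R) (fun s => expR (- C * s)) (expR (- C * s) * - C).
    apply: (@is_derive1_comp R expR (fun s => - C * s)).
    have := @is_derive_linear R R R (fun s => - C * s) s 1; rewrite mulr1; apply.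
    by move=> a y z; rewrite /GRing.scale /=; ring.
  have H3 : is_derive s (1 : R) (fun s => E s + e ^+ 2) (E' s).
    by have := @is_deriveD R R R E (cst (e ^+ 2)) s 1 _ _ H1 (is_derive_cst _ _ _); rewrite addr0.
  have := @is_deriveM R R _ _ s 1 _ _ H3 H2; rewrite /GRing.scale /=.
  by congr (is_derive _ _ _ _); rewrite /Z'; ring.
have cZ : continuous Z.
  move=> s; apply: (@continuousM R R (fun s => E s + e ^+ 2) (fun s => expR (- C * s)) s).
    by apply: continuousD; [exact: cE|exact: cst_continuous].
  apply: (@continuous_comp _ _ _ (fun s => - C * s) expR); first exact: mulrl_continuous.
  exact: continuous_expR.
have Z'0 (s : R) : 0 < s < 1 -> Z' s <= 0.
  move=> s01; rewrite /Z' pmulr_lle0 ?expR_gt0 // subr_le0.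
  apply: (@le_trans _ _ (\sum_(k < N) (2 * L * E s + (E s + e ^+ 2)))); last first.
    rewrite sumr_const card_ord -mulr_natl /C.
    have : 0 <= N%:R * L * e ^+ 2 by rewrite !mulr_ge0 // sqr_ge0.
    by set n := N%:R; move=> ?; nra.
  apply: ler_sum => k _.
  have A1 := coord_le_norm (w s) k; have A2 := coord_le_norm (w' s) k.
  have A3 := bw _ s01; have A4 := wE s; have A5 := normr_ge0 (w s).
  apply: le_trans (ler_norm _) _; rewrite !normrM ger0_norm //.
  have A6 : `|w s 0 k| * `|w' s 0 k| <= `|w s| * (L * `|w s| + e).
    by apply: ler_pM => //; exact: le_trans A3.
  have A7 : 0 <= (`|w s| - e) ^+ 2 by exact: sqr_ge0.
  set a := `|w s| in A1 A3 A4 A5 A6 A7 *.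
  have A8 : L * a ^+ 2 <= L * E s by rewrite ler_wpM2l.
  rewrite -mulrA; nra.
have Zt : Z t <= Z 0.
  have := @le_increment R Z (fun=> 0) Z' (fun=> 0) 0 t t0 (continuous_subspaceT cZ).
  rewrite subrr subr_le0; apply.
  - by apply: continuous_subspaceT; exact: cst_continuous.
  - by move=> s /andP[s0 st]; apply: dZ; rewrite s0 (lt_le_trans st).
  - by move=> s /andP[s0 st]; apply: Z'0; rewrite s0 (lt_le_trans st).
have Et : E t + e ^+ 2 <= (E 0 + e ^+ 2) * expR C.
  move: Zt; rewrite /Z mulr0 expR0 mulr1 => Zt.
  have := ler_wpM2r (ltW (expR_gt0 (C * t))) Zt.
  rewrite -mulrA -expRD mulNr addNr expR0 mulr1 => /le_trans; apply.
  rewrite ler_wpM2l //; last by rewrite ler_expR ler_piMr.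
  by rewrite addr_ge0 ?sqr_ge0 // sumr_ge0 // => k _; exact: sqr_ge0.
have K1 := gronwall_cst_ge1 N L0; set K := gronwall_cst N L in K1 *.
have w0e : 0 <= `|w 0| + e by rewrite addr_ge0.
have K0 : 0 <= K by exact: le_trans K1.
rewrite -(@ler_pXn2r _ 2) ?nnegrE ?mulr_ge0 // exprMn.
apply: (@le_trans _ _ (K * (`|w 0| + e) ^+ 2)); last first.
  by rewrite ler_wpM2r ?sqr_ge0 // expr2 ler_peMl.
have B1 := wE t; have B2 := Ew 0; have B3 := sqr_ge0 e.
apply: (@le_trans _ _ ((E 0 + e ^+ 2) * expR C)); first by lra.
rewrite /K /gronwall_cst -/C [_ * expR C]mulrC -mulrA [leRHS]mulrCA.
rewrite ler_pM2l ?expR_gt0 // -natr1.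
set n := N%:R in B2 N0 *; have := normr_ge0 (w 0); set a := `|w 0| in B2 *.
move=> a0; have n1 := mulr_ge0 N0 (mulr_ge0 a0 e0).
have n2 := mulr_ge0 N0 B3; have n3 := mulr_ge0 a0 e0; have n4 := sqr_ge0 a.
have -> : (n + 1) * (a + e) ^+ 2 = n * a ^+ 2 + e ^+ 2 +
  (2 * (n * (a * e)) + n * e ^+ 2 + 2 * (a * e) + a ^+ 2) by ring.
have n5 : 0 <= 2 * (n * (a * e)) + n * e ^+ 2 + 2 * (a * e) + a ^+ 2.
  by rewrite !addr_ge0 // mulr_ge0.
by rewrite -[leLHS]addr0 lerD // lerD.
Qed.

(** Picard iterates: consecutive ones differ by at most [M / 2 ^+ n * expR (2 * L * t)],
the weight making the iteration a contraction by one half on all of [[0, 1]]. *)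
Lemma picard N (F : R -> 'rV[R]_N -> 'rV[R]_N) L : 0 <= L ->
  (forall t a b, `|F t a - F t b| <= L * `|a - b|) ->
  (forall w : R -> 'rV[R]_N, (forall k, continuous (fun t => w t 0 k)) ->
     forall k, continuous (fun t => F t (w t) 0 k)) ->
  forall w0, exists2 w, w 0 = w0 & sol F w.
Proof.
wlog L0 : L / 0 < L.
  move=> H L0 FL; apply: (H (L + 1)); rewrite ?ltr_wpDl ?addr_ge0 // => t a b.
  by apply: le_trans (FL t a b) _; rewrite ler_wpM2r // lerDl.
move=> _ FL Fc w0.
pose cont (w : R -> 'rV[R]_N) := forall k, continuous (fun t => w t 0 k).
pose stepP (w w' : R -> 'rV[R]_N) := [/\ cont w', w' 0 = w0 &
  forall t : R, 0 < t < 1 -> forall k, is_derive t (1 : R) (fun s => w' s 0 k) (F t (w t) 0 k)].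
have /choice [step stepE] : forall w, exists w', cont w -> stepP w w'.
  move=> w; case: (pselect (cont w)) => [cw|ncw]; last by exists w.
  have [P PE] := choice (fun k => primitive (Fc _ cw k) (ltr01 : (0 : R) < 1)).
  exists (fun t => \row_k (P k t - P k 0 + w0 0 k)) => _; split.
  - move=> k t; under eq_fun do rewrite mxE.
    have [cP _ _] := PE k.
    exact: (cvgD (cvgB (cP t) (cvg_cst _)) (cvg_cst _)).
  - by apply/rowP => k; rewrite mxE subrr add0r.
  - move=> t t01 k; under eq_fun do rewrite mxE -addrA.
    have [_ dP _] := PE k; have H := dP _ t01.
    have := is_deriveD H (@is_derive_cst R R R (- P k 0 + w0 0 k) t 1).
    by rewrite addr0.
pose W n := iter n step (fun=> w0).
have cW n : cont (W n).
  elim: n => [k|n IH]; first exact: cst_continuous.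
  by have [] := stepE _ IH.
have WS n : stepP (W n) (W n.+1) by exact: stepE.
have W0 n : W n 0 = w0 by case: n => [//|n]; have [] := WS n.
pose e (t : R) := expR (2 * L * t).
have de (c t : R) : is_derive t (1 : R) (fun t => c * e t) (2 * L * c * e t).
  have H : is_derive t (1 : R) (fun s => expR (2 * L * s)) (expR (2 * L * t) * (2 * L)).
    apply: (@is_derive1_comp R expR (fun s => 2 * L * s)).
    have := @is_derive_linear R R R (fun s => 2 * L * s) t 1; rewrite mulr1; apply.
    by move=> a y z; rewrite /GRing.scale /=; ring.
  have := @is_deriveZ R R R _ c t 1 _ H; rewrite /GRing.scale /=.
  by congr (is_derive _ _ _ _); rewrite /e; ring.
have e0 t : 0 < e t by exact: expR_gt0.
have [M M0 MP] : exists2 M, 0 <= M & forall t : R, 0 <= t <= 1 -> `|W 1%N t - W 0%N t| <= M.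
  have bk k : exists Mk, forall t : R, 0 <= t <= 1 -> `|W 1%N t 0 k - w0 0 k| <= Mk.
    have c1 : continuous (fun t => `|W 1%N t 0 k - w0 0 k|).
      move=> t; apply: (@continuous_comp _ _ _ (fun t => W 1%N t 0 k - w0 0 k) Num.norm).
        exact: (cvgB (cW 1%N k t) (cvg_cst _)).
      exact: norm_continuous.
    have [c _ cP] := @EVT_max R _ 0 1 ler01 (continuous_subspaceT c1).
    by exists `|W 1%N c 0 k - w0 0 k| => t t01; apply: cP; rewrite in_itv.
  have [Mk MkP] := choice bk.
  exists (\big[Num.max/0]_k Mk k); first exact: bigmax_ge_id.
  move=> t t01; apply: rV_norm_le; first exact: bigmax_ge_id.
  by move=> k; rewrite !mxE; apply: le_trans (le_bigmax _ _ k); exact: MkP.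
have WW n t : 0 <= t <= 1 -> `|W n.+1 t - W n t| <= M / 2 ^+ n * e t.
  elim: n t => [|n IH] t t01.
    rewrite expr0 divr1; apply: le_trans (MP _ t01) _; rewrite ler_peMr //.
    rewrite /e -expR0 ler_expR mulr_ge0 //; first by rewrite mulr_ge0 // ltW.
    by case/andP: t01.
  have t0 : 0 <= t by case/andP: t01.
  have ct k : `|W n.+2 t 0 k - W n.+1 t 0 k| <= M / 2 ^+ n.+1 * e t - M / 2 ^+ n.+1 * e 0.
    have -> : W n.+2 t 0 k - W n.+1 t 0 k =
       (W n.+2 t 0 k - W n.+1 t 0 k) - (W n.+2 0 0 k - W n.+1 0 0 k) by rewrite !W0 subrr subr0.
    apply: (@norm_increment R (fun t => W n.+2 t 0 k - W n.+1 t 0 k)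
      (fun t => M / 2 ^+ n.+1 * e t) (fun t => F t (W n.+1 t) 0 k - F t (W n t) 0 k)
      (fun t => 2 * L * (M / 2 ^+ n.+1) * e t) 0 t t0).
    - apply: continuous_subspaceT => s.
      exact: (cvgB (cW n.+2 k s) (cW n.+1 k s)).
    - apply: derivable_within_continuous => s _; by case: (de (M / 2 ^+ n.+1) s).
    - move=> s /andP[s0 st]; have s01 : 0 < s < 1.
        by rewrite s0 (lt_le_trans st) //; case/andP: t01.
      have [_ _ d2] := WS n.+1; have [_ _ d1] := WS n.
      exact: is_deriveB (d2 _ s01 k) (d1 _ s01 k).
    - move=> s /andP[s0 st]; have s01 : 0 <= s <= 1.
        by rewrite (ltW s0) (le_trans (ltW st)) //; case/andP: t01.
      have := coord_le_norm (F s (W n.+1 s) - F s (W n s)) k; rewrite !mxE => /le_trans; apply.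
      apply: le_trans (FL _ _ _) _; apply: le_trans (ler_wpM2l (ltW L0) (IH _ s01)) _.
      rewrite exprS le_eqVlt; apply/orP; left; apply/eqP; field.
      by rewrite expf_neq0 // pnatr_eq0.
  have Mn : 0 <= M / 2 ^+ n.+1 by rewrite divr_ge0 // exprn_ge0.
  apply: rV_norm_le; first by rewrite mulr_ge0 // ltW.
  move=> k; rewrite !mxE; apply: le_trans (ct k) _.
  by rewrite lerBlDr lerDl mulr_ge0 // ltW.
pose A := M * e 1.
have A0 : 0 <= A by rewrite mulr_ge0 // ltW.
have WA n t : 0 <= t <= 1 -> `|W n.+1 t - W n t| <= A / 2 ^+ n.
  move=> t01; apply: le_trans (WW _ _ t01) _.
  rewrite /A mulrAC ler_wpM2r ?invr_ge0 ?exprn_ge0 // ler_wpM2l //.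
  rewrite /e ler_expR ler_pM2l ?mulr_gt0 //; by case/andP: t01.
have lim k t : exists l, forall n, 0 <= t <= 1 -> `|l - W n t 0 k| <= 2 * A / 2 ^+ n.
  case: (boolP (0 <= t <= 1)) => t01; last by exists 0.
  have [|l lP] := @geometric_limit R (fun n => W n t 0 k) A; last by exists l.
  by move=> n; have := coord_le_norm (W n.+1 t - W n t) k; rewrite !mxE => /le_trans; apply; exact: WA.
pose w k := projT1 (choice (lim k)).
have wP k (x : R) n : 0 <= x <= 1 -> `|w k x - W n x 0 k| <= 2 * A / 2 ^+ n.
  exact: (projT2 (choice (lim k))).
clearbody w.
have A2n n : 0 <= 2 * A / 2 ^+ n by rewrite divr_ge0 ?exprn_ge0 // mulr_ge0.
pose u t : 'rV[R]_N := \row_k w k (clamp 0 1 t).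
have c01 (t : R) : 0 <= clamp 0 1 t <= 1 by exact: clamp_itv.
have uW n t : `|u t - W n (clamp 0 1 t)| <= 2 * A / 2 ^+ n.
  apply: rV_norm_le => [|k]; first exact: A2n.
  by rewrite !mxE; exact: wP.
have small (d : R) : 0 < d -> exists n, 2 * A / 2 ^+ n <= d.
  move=> d0; case: (pselect (exists n, 2 * A / 2 ^+ n <= d)) => // nH.
  have : d <= 0; last by rewrite leNgt d0.
  apply: (@le_geometric0 _ d (2 * A)); first by rewrite mulr_ge0.
  by move=> n; rewrite leNgt; apply/negP => /ltW H; apply: nH; exists n.
have cu : cont u.
  move=> k t; apply/cvgrPdist_le => d d0.
  have [n nP] := small (d / 3) (divr_gt0 d0 (ltr0n _ 3)).
  have cWc : continuous (fun t => W n (clamp 0 1 t) 0 k).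
    by move=> s; apply: (@continuous_comp _ _ _ (clamp 0 1) (fun t => W n t 0 k)); [exact: clamp_continuous|exact: cW].
  near=> s.
  have B1 := le_trans (coord_le_norm (u t - W n (clamp 0 1 t)) k) (le_trans (uW n t) nP).
  have B2 := le_trans (coord_le_norm (u s - W n (clamp 0 1 s)) k) (le_trans (uW n s) nP).
  have B3 : `|W n (clamp 0 1 t) 0 k - W n (clamp 0 1 s) 0 k| <= d / 3.
    by near: s; have /cvgrPdist_le := cWc t; apply; rewrite divr_gt0.
  move: B1 B2 B3; rewrite !mxE; set a := W n _ 0 k; set b := W n _ 0 k.
  have -> : w k (clamp 0 1 t) - w k (clamp 0 1 s) =
     (w k (clamp 0 1 t) - a) + (a - b) - (w k (clamp 0 1 s) - b) by ring.
  move=> B1 B2 B3; apply: le_trans (ler_normB _ _) _; rewrite (_ : d = d / 3 + d / 3 + d / 3); last by field.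
  by rewrite lerD // (le_trans (ler_normD _ _)) // lerD.
have uW1 n t : 0 <= t <= 1 -> `|u t - W n t| <= 2 * A / 2 ^+ n.
  by move=> t01; have := uW n t; rewrite clamp_id.
have zero01 : ((0 : R) <= 0) && ((0 : R) <= 1) by rewrite lexx ler01.
have eq0 (a b B : R) : (forall n, `|a - b| <= B / 2 ^+ n) -> 0 <= B -> a = b.
  move=> H B0; apply/eqP; rewrite -subr_eq0 -normr_le0; exact: le_geometric0 B0 H.
exists u.
  apply/rowP => k; apply: (eq0 _ _ (2 * A)); last by rewrite mulr_ge0.
  move=> n; have := le_trans (coord_le_norm (u 0 - W n 0) k) (uW1 n 0 zero01).
  by rewrite W0 [(u 0 - w0) 0 k]mxE [(- w0) 0 k]mxE.
split=> // t t01 k.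
have [P [cP dP _]] := primitive (Fc _ cu k) (ltr01 : (0 : R) < 1).
have uP (s : R) : 0 <= s <= 1 -> u s 0 k = w0 0 k + (P s - P 0).
  move=> s01; have s0 : 0 <= s by case/andP: s01.
  apply: (eq0 _ _ (2 * A + 2 * L * (2 * A))) => [n|]; last first.
    by rewrite addr_ge0 // !mulr_ge0 // ltW.
  have B1 := le_trans (coord_le_norm (u s - W n.+1 s) k) (uW1 n.+1 s s01).
  have B2 : `|(W n.+1 s 0 k - P s) - (W n.+1 0 0 k - P 0)| <= L * (2 * A / 2 ^+ n) * (s - 0).
    apply: (@lip_increment R (fun s => W n.+1 s 0 k - P s) (fun s => F s (W n s) 0 k - F s (u s) 0 k) 0 s _ s0).
    - apply: continuous_subspaceT => r.
      exact: (cvgB (cW n.+1 k r) (cP r)).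
    - move=> r /andP[r0 rs]; have r01 : 0 < r < 1.
        by rewrite r0 (lt_le_trans rs) //; case/andP: s01.
      by have [_ _ d1] := WS n; exact: is_deriveB (d1 _ r01 k) (dP _ r01).
    - move=> r /andP[r0 rs]; have r01 : 0 <= r <= 1.
        by rewrite (ltW r0) (le_trans (ltW rs)) //; case/andP: s01.
      have := coord_le_norm (F r (W n r) - F r (u r)) k; rewrite !mxE => /le_trans; apply.
      apply: le_trans (FL _ _ _) _; rewrite ler_wpM2l ?(ltW L0) // distrC; exact: uW1.
  have p2 : 0 < 2 ^+ n :> R by rewrite exprn_gt0.
  have -> : u s 0 k - (w0 0 k + (P s - P 0)) = (u s 0 k - W n.+1 s 0 k) + ((W n.+1 s 0 k - P s) - (W n.+1 0 0 k - P 0)).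
    by rewrite W0; ring.
  apply: le_trans (ler_normD _ _) _.
  rewrite mulrDl lerD //.
    move: B1; rewrite !mxE => /le_trans; apply; rewrite exprS invfM mulrA.
    rewrite ler_wpM2r ?invr_ge0 ?(ltW p2) //.
    by move: A0; clear; move: A => a a0; lra.
  apply: le_trans B2 _; rewrite subr0.
  have -> : 2 * L * (2 * A) / 2 ^+ n = L * (2 * A / 2 ^+ n) * 2 by field; rewrite gt_eqF.
  rewrite ler_wpM2l //; first by rewrite mulr_ge0 // ltW.
  by case/andP: s01 => _ s1; apply: le_trans s1 _; rewrite ler1n.
apply: near_eq_is_derive (_ : is_derive t (1 : R) (fun s => w0 0 k + (P s - P 0)) _); last first.
  have := is_deriveD (@is_derive_cst R R R (w0 0 k - P 0) t 1) (dP _ t01); rewrite add0r.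
  by congr (is_derive _ _ _ _); apply/funext => s /=; rewrite -[(_ + P) s]/((w0 0 k - P 0) + P s); ring.
near=> s; apply/esym/uP; apply/andP; split; apply: ltW; near: s.
  by apply: lt_nbhsr; case/andP: t01.
by apply: lt_nbhsl; case/andP: t01.
Unshelve. all: by end_near. Qed.

End ODE.

(** * Smooth dependence of solutions on parameters *)

Section Regularity.
Context {R : realType}.
Implicit Types (N M k : nat).

Lemma continuous_sum (T : topologicalType) (I : finType) (f : I -> T -> R) x :
  (forall i, {for x, continuous (f i)}) -> {for x, continuous (fun y => \sum_i f i y)}.
Proof.
move=> fc; elim: (index_enum I) => [|i s IH].
  by rewrite (_ : (fun y => _) = fun=> 0); [exact: cst_continuous|apply/funext => y; rewrite big_nil].
rewrite (_ : (fun y => _) = fun y => f i y + \sum_(j <- s) f j y).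
  exact: (cvgD (fc i) IH).
by apply/funext => y; rewrite big_cons.
Qed.

Lemma bounded_on_ball N (O : set 'rV[R]_N) (f : 'rV[R]_N -> R) c r : 0 <= r ->
  (forall y, `|y - c| <= r -> O y) -> (forall y, O y -> {for y, continuous f}) ->
  exists2 C, 0 <= C & forall y, `|y - c| <= r -> `|f y| <= C.
Proof.
move=> r0 BO fc; pose A : set 'rV[R]_N := closed_ball_ Num.norm c r.
have AE y : A y <-> `|y - c| <= r by rewrite /A /closed_ball_ /= distrC.
have A0 : A !=set0 by exists c; apply/AE; rewrite subrr normr0.
have cA : compact A.
  apply: bounded_closed_compact; last exact: closed_closed_ball_.
  exists (`|c| + r); split; first exact: num_real.
  move=> C HC y /AE yc /=; apply: le_trans (ltW HC).
  by rewrite -[y](subrK c) addrC (le_trans (ler_normD _ _)) // lerD.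
have fcA : {within A, continuous (fun y => `|f y|)}.
  apply: continuous_in_subspaceT => y; rewrite inE => /AE /BO Oy.
  exact: (@continuous_comp _ _ _ f Num.norm y (fc _ Oy) (@norm_continuous _ _ _)).
have [y0 _ yP] := EVT_max_rV A0 cA fcA.
by exists `|f y0| => // y /AE Ay; apply: yP; rewrite inE.
Qed.

Lemma bounded_family_on_ball N (O : set 'rV[R]_N) (I : finType) (f : I -> 'rV[R]_N -> R) c r : 0 <= r ->
  (forall y, `|y - c| <= r -> O y) -> (forall i y, O y -> {for y, continuous (f i)}) ->
  exists2 C, 0 <= C & forall i y, `|y - c| <= r -> `|f i y| <= C.
Proof.
move=> r0 BO fc.
have bk i : exists C, forall y, `|y - c| <= r -> `|f i y| <= C.
  by have [C _ CP] := bounded_on_ball r0 BO (fc i); exists C.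
have [C CP] := choice bk.
exists (\big[Num.max/0]_i C i); first exact: bigmax_ge_id.
by move=> i y yr; apply: le_trans (CP i y yr) _; exact: (le_bigmax _ _ i).
Qed.

Definition dfield N (X : 'rV[R]_N -> 'rV[R]_N) y v : 'rV[R]_N :=
  \row_k dotp (fun j => pd j (fun z => X z 0 k) y) v.

Lemma dfield_lip N (O : set 'rV[R]_N) (X : 'rV[R]_N -> 'rV[R]_N) c r : open O -> 0 <= r ->
  (forall y, `|y - c| <= r -> O y) -> (forall a, Cinf O (fun y => X y 0 a)) ->
  exists2 L, 0 <= L & forall y v, `|y - c| <= r -> `|dfield X y v| <= L * `|v|.
Proof.
move=> oO r0 BO XC.
have [|C C0 CP] := @bounded_family_on_ball N O ('I_N * 'I_N)%type
    (fun i => pd i.1 (fun z => X z 0 i.2)) c r r0 BO.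
  by move=> [i j] y Oy; exact: (@Ck_continuous R N 0 O _ y (CkS_pd _ (XC _ 1%N))).
exists (N%:R * C); first by rewrite mulr_ge0.
move=> y v yr; apply: rV_norm_le; first by rewrite !mulr_ge0.
by move=> k; rewrite mxE; apply: dotp_norm => j; exact: (CP (j, k)).
Qed.

Lemma field_lip N (O : set 'rV[R]_N) (X : 'rV[R]_N -> 'rV[R]_N) c r : open O -> 0 <= r ->
  (forall y, `|y - c| <= r -> O y) -> (forall a, Cinf O (fun y => X y 0 a)) ->
  exists2 L, 0 <= L & forall a b, `|a - c| <= r -> `|b - c| <= r -> `|X a - X b| <= L * `|a - b|.
Proof.
move=> oO r0 BO XC.
have [|C C0 CP] := @bounded_family_on_ball N O ('I_N * 'I_N)%type
    (fun i => pd i.1 (fun z => X z 0 i.2)) c r r0 BO.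
  by move=> [i j] y Oy; exact: (@Ck_continuous R N 0 O _ y (CkS_pd _ (XC _ 1%N))).
exists (N%:R * C); first by rewrite mulr_ge0.
move=> a b ar br; apply: rV_norm_le; first by rewrite !mulr_ge0.
move=> k; rewrite !mxE.
apply: (@box_lipschitz R N (fun z => X z 0 k) b a) => y yab l.
have yr := in_box_ball yab br ar.
split; last exact: (CP (l, k)).
by have [] := CkS_is_derive l (XC k 1%N) (BO _ yr).
Qed.

(** The second order bound that makes the difference quotients of a flow satisfy
the linearised equation up to an error of the size of the increment. *)
Lemma field_taylor N (O : set 'rV[R]_N) (X : 'rV[R]_N -> 'rV[R]_N) c r : open O -> 0 <= r ->
  (forall y, `|y - c| <= r -> O y) -> (forall a, Cinf O (fun y => X y 0 a)) ->
  exists2 C, 0 <= C & forall a b, `|a - c| <= r -> `|b - c| <= r ->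
    `|X b - X a - dfield X a (b - a)| <= C * `|b - a| ^+ 2.
Proof.
move=> oO r0 BO XC.
have [|C C0 CP] := @bounded_family_on_ball N O ('I_N * 'I_N * 'I_N)%type
    (fun i => pd i.1.1 (pd i.1.2 (fun z => X z 0 i.2))) c r r0 BO.
  move=> [[i j] k] y Oy.
  exact: (@Ck_continuous R N 0 O _ y (CkS_pd _ (CkS_pd _ (XC _ 2%N)))).
exists (N%:R * (N%:R * C)); first by rewrite !mulr_ge0.
move=> a b ar br; apply: rV_norm_le; first by rewrite !mulr_ge0 ?sqr_ge0.
move=> k; rewrite !mxE.
pose f z := X z 0 k; pose d j := pd j f a; pose g z := f z - dotp d z.
have -> : X b 0 k - X a 0 k - dotp (fun j => pd j (fun z => X z 0 k) a) (b - a) = g b - g a.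
  by rewrite /g dotpB /f /d; ring.
rewrite (_ : _ * _ ^+ 2 = N%:R * (N%:R * C * `|b - a|) * `|b - a|); last by ring.
apply: (@box_lipschitz R N g a b) => y yab l.
have yr := in_box_ball yab ar br.
have H1 := CkS_is_derive l (XC k 1%N) (BO _ yr).
have H2 := @is_derive_linear _ _ _ (dotp d) y (delta_mx 0 l) (@dotp_linear _ _ d).
have [gd ->] := is_deriveB H1 H2; split=> //.
rewrite dotp_delta /d.
apply: (@le_trans _ _ (N%:R * C * `|y - a|)); last first.
  by rewrite ler_wpM2l ?mulr_ge0 // in_box_norm.
apply: (@box_lipschitz R N (pd l f) a y C) => z zay j.
have zr := in_box_ball zay ar yr.
split; last exact: (CP (j, l, k)).
by have [] := CkS_is_derive j (CkS_pd l (XC k 2%N)) (BO _ zr).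
Qed.

Lemma sol_stable N M (O : set 'rV[R]_N) (X : 'rV[R]_N -> 'rV[R]_N) c r (P : set 'rV[R]_M)
  (u : 'rV[R]_M -> R -> 'rV[R]_N) : open O -> 0 <= r ->
  (forall y, `|y - c| <= r -> O y) -> (forall a, Cinf O (fun y => X y 0 a)) ->
  (forall p, P p -> sol (fun=> X) (u p)) ->
  (forall p, P p -> forall t : R, 0 <= t <= 1 -> `|u p t - c| <= r) ->
  exists2 K, 0 <= K & forall p q, P p -> P q -> forall t : R, 0 <= t <= 1 ->
     `|u p t - u q t| <= K * `|u p 0 - u q 0|.
Proof.
move=> oO r0 BO XC uS uB; have [L L0 LP] := field_lip oO r0 BO XC.
exists (gronwall_cst N L); first exact: le_trans (gronwall_cst_ge1 N L0).
move=> p q Pp Pq t t01.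
have [cp dp] := uS _ Pp; have [cq dq] := uS _ Pq.
have := @gronwall R N (fun t => u p t - u q t) (fun t => X (u p t) - X (u q t)) L 0 L0 (lexx _).
rewrite addr0; apply=> //.
- move=> k s; under eq_fun do rewrite !mxE; exact: (cvgB (cp k s) (cq k s)).
- move=> s s01 k; under eq_fun do rewrite !mxE; rewrite !mxE.
  exact: is_deriveB (dp _ s01 k) (dq _ s01 k).
- move=> s /andP[s0 s1]; rewrite addr0; apply: LP; apply: uB => //; by rewrite !ltW.
Qed.

Lemma sol_continuous N M (O : set 'rV[R]_N) (X : 'rV[R]_N -> 'rV[R]_N) c r (P : set 'rV[R]_M)
  (u : 'rV[R]_M -> R -> 'rV[R]_N) : open O -> 0 <= r ->
  (forall y, `|y - c| <= r -> O y) -> (forall a, Cinf O (fun y => X y 0 a)) ->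
  open P -> (forall p, P p -> sol (fun=> X) (u p)) ->
  (forall p, P p -> forall t : R, 0 <= t <= 1 -> `|u p t - c| <= r) ->
  (forall a, Cinf P (fun p => u p 0 0 a)) ->
  forall t : R, 0 <= t <= 1 -> forall a p, P p -> {for p, continuous (fun p => u p t 0 a)}.
Proof.
move=> oO r0 BO XC oP uS uB u0C t t01 a p Pp.
have [K K0 KP] := sol_stable oO r0 BO XC uS uB.
have cu : {for p, continuous (fun p => u p 0)}.
  apply: (@cvg_mx R N _ (nbhs p) _ _ _).1 => b.
  exact: (Ck_continuous (u0C b 0%N) Pp).
suff : u q t 0 a @[q --> p] --> u p t 0 a by [].
apply: (@cvgrPdist_le R R _ (nbhs p) (nbhs_filter p) _ _).2 => d d0.
have d1 : 0 < d / (K + 1) by rewrite divr_gt0 // ltr_wpDl.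
near=> q; have Pq : P q by near: q; exact: open_nbhs_nbhs.
have := coord_le_norm (u p t - u q t) a; rewrite !mxE => /le_trans; apply.
apply: le_trans (KP _ _ Pp Pq _ t01) _.
apply: (@le_trans _ _ (K * (d / (K + 1)))).
  by rewrite ler_wpM2l //; near: q; move/cvgrPdist_le : cu; apply.
rewrite mulrCA ler_piMr ?(ltW d0) // ler_pdivrMr ?ltr_wpDl // mul1r lerDl; exact: ler01.
Unshelve. all: by end_near. Qed.

(** The difference quotient of the solutions minus the solution [Y] of the
linearised equation satisfies a linear inequality whose initial value and source
tend to 0, so it tends to 0 by Gronwall. *)
Lemma sol_derivable N M (O : set 'rV[R]_N) (X : 'rV[R]_N -> 'rV[R]_N) c r (P : set 'rV[R]_M)
  (u : 'rV[R]_M -> R -> 'rV[R]_N) : open O -> 0 <= r ->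
  (forall y, `|y - c| <= r -> O y) -> (forall a, Cinf O (fun y => X y 0 a)) ->
  open P -> (forall p, P p -> sol (fun=> X) (u p)) ->
  (forall p, P p -> forall t : R, 0 <= t <= 1 -> `|u p t - c| <= r) ->
  forall p l (Y : R -> 'rV[R]_N), P p ->
  (forall a, is_derive p (delta_mx 0 l) (fun q => u q 0 0 a) (Y 0 0 a)) ->
  sol (fun t => dfield X (u p (clamp 0 1 t))) Y ->
  forall t : R, 0 <= t <= 1 -> forall a, is_derive p (delta_mx 0 l) (fun q => u q t 0 a) (Y t 0 a).
Proof.
move=> oO r0 BO XC oP uS uB p l Y Pp Y0 YS t t01 a.
have [K K0 KP] := sol_stable oO r0 BO XC uS uB.
have [L L0 LP] := dfield_lip oO r0 BO XC.
have [C C0 CP] := field_taylor oO r0 BO XC.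
pose q h : 'rV[R]_M := h *: delta_mx 0 l + p.
pose e h s : 'rV[R]_N := h^-1 *: (u (q h) s - u p s) - Y s.
have e0 : e h 0 @[h --> (0 : R)^'] --> (0 : 'rV[R]_N).
  apply/cvg_mx => k; have -> : (0 : 'rV[R]_N) 0 k = Y 0 0 k - Y 0 0 k by rewrite mxE subrr.
  have /is_deriveP H := Y0 k; rewrite /e; under eq_fun do rewrite !mxE.
  exact: cvgB H (cvg_cst _).
have Pq : \forall h \near (0 : R)^', P (q h).
  have : q h @[h --> (0 : R)^'] --> p.
    have : q h @[h --> (0 : R)^'] --> (0 : R) *: delta_mx 0 l + p.
      apply: cvgD; last exact: cvg_cst.
      by apply: cvgZr_tmp; exact: nbhs_dnbhs.
    by rewrite scale0r add0r.
  by apply; exact: open_nbhs_nbhs.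
pose V := `|Y 0| + 1.
have V0 : 0 <= V by rewrite addr_ge0.
pose G := gronwall_cst N L.
have G0 : 0 <= G by exact: le_trans (gronwall_cst_ge1 N L0).
(* D * |h| bounds the error in the linearised equation for e h *)
pose D := C * K ^+ 2 * V ^+ 2.
have D0 : 0 <= D by rewrite !mulr_ge0 ?sqr_ge0.
have key : \forall h \near (0 : R)^', `|e h t| <= G * (`|e h 0| + D * `|h|).
  near=> h.
  have h0 : h != 0 by near: h; exact: nbhs_dnbhs_neq.
  have Ph : P (q h) by near: h.
  have e1 : `|e h 0| <= 1.
    by near: h; move/cvgrPdist_le : e0 => /(_ 1 ltr01); apply: filterS => h; rewrite sub0r normrN.
  have B0 : `|u (q h) 0 - u p 0| <= V * `|h|.
    have -> : u (q h) 0 - u p 0 = h *: (e h 0 + Y 0) by rewrite /e subrK scalerA mulfV // scale1r.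
    rewrite normrZ mulrC ler_wpM2r // /V addrC (le_trans (ler_normD _ _)) //.
    by rewrite lerD.
  have [cq dq] := uS _ Ph; have [cp dp] := uS _ Pp; have [cY dY] := YS.
  apply: (@gronwall R N (e h) (fun s => h^-1 *: (X (u (q h) s) - X (u p s)) - dfield X (u p (clamp 0 1 s)) (Y s)) L (D * `|h|) L0) => //.
  - by rewrite mulr_ge0.
  - move=> k s; rewrite /e; under eq_fun do rewrite !mxE.
    exact: (cvgB (cvgM (cvg_cst _) (cvgB (cq k s) (cp k s))) (cY k s)).
  - move=> s s01 k; rewrite /e; under eq_fun do rewrite !mxE; rewrite [X in is_derive _ _ _ X]mxE [X in is_derive _ _ _ (_ + X)]mxE.
    apply: is_deriveB; last exact: dY.
    have := is_deriveZ h^-1 (is_deriveB (dq _ s01 k) (dp _ s01 k)).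
    by rewrite !mxE.
  - move=> s /andP[s0 s1]; have s01 : 0 <= s <= 1 by rewrite !ltW.
    rewrite clamp_id //.
    set A := u (q h) s; set B := u p s.
    have HA : `|A - c| <= r by exact: uB.
    have HB : `|B - c| <= r by exact: uB.
    have -> : h^-1 *: (X A - X B) - dfield X B (Y s) =
       dfield X B (e h s) + h^-1 *: (X A - X B - dfield X B (A - B)).
      by apply/rowP => k; rewrite /e !mxE !dotpB !dotpZ !dotpB -/A -/B; ring.
    apply: le_trans (ler_normD _ _) _; apply: lerD; first exact: LP.
    rewrite normrZ; apply: le_trans (ler_wpM2l _ (CP _ _ HB HA)) _ => //.
    have AB : `|A - B| ^+ 2 <= (K * (V * `|h|)) ^+ 2.
      rewrite ler_pXn2r ?nnegrE ?mulr_ge0 //.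
      by apply: le_trans (KP _ _ Ph Pp s s01) _; rewrite ler_wpM2l.
    apply: le_trans (ler_wpM2l _ (ler_wpM2l C0 AB)) _ => //.
    rewrite normfV le_eqVlt; apply/orP; left; apply/eqP; rewrite /D; field.
    by rewrite normr_eq0.
apply/is_deriveP; apply/cvgrPdist_le => d d0.
have lim0 : G * (`|e h 0| + D * `|h|) @[h --> (0 : R)^'] --> G * (`|0 : 'rV[R]_N| + D * `|0 : R|).
  apply: cvgM; first exact: cvg_cst.
  apply: cvgD; first exact: cvg_norm.
  apply: cvgM; first exact: cvg_cst.
  by apply: cvg_norm; exact: nbhs_dnbhs.
move: lim0; rewrite !normr0 mulr0 addr0 mulr0 => /cvgrPdist_le /(_ _ d0) lim0.
near=> h.
have := coord_le_norm (e h t) a; rewrite !mxE /= distrC => /le_trans; apply.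
apply: (@le_trans _ _ (G * (`|e h 0| + D * `|h|))); first by near: h.
have : `|0 - G * (`|e h 0| + D * `|h|)| <= d by near: h.
by rewrite sub0r normrN; apply: le_trans; exact: ler_norm.
Unshelve. all: by end_near. Qed.

(** The field whose solutions are pairs of a solution of [X] and a solution of the
linearised equation along it. *)
Definition tangent_lift N (X : 'rV[R]_N -> 'rV[R]_N) (y : 'rV[R]_(N + N)) : 'rV[R]_(N + N) :=
  row_mx (X (lsubmx y)) (dfield X (lsubmx y) (rsubmx y)).

Lemma lsubmx_continuous N M : continuous (@lsubmx R 1 N M).
Proof.
move=> x; apply: (@cvg_mx R N _ (nbhs x) _ _ _).1 => k.
rewrite mxE; under eq_fun do rewrite mxE; exact: coord_continuous.
Qed.

Lemma rsubmx_continuous N M : continuous (@rsubmx R 1 N M).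
Proof.
move=> x; apply: (@cvg_mx R M _ (nbhs x) _ _ _).1 => k.
rewrite mxE; under eq_fun do rewrite mxE; exact: coord_continuous.
Qed.

Lemma open_lsubmx N M (O : set 'rV[R]_N) : open O -> open [set y : 'rV[R]_(N + M) | O (lsubmx y)].
Proof. by move=> oO; apply: open_comp => // y _; exact: lsubmx_continuous. Qed.

Lemma tangent_lift_smooth N (O : set 'rV[R]_N) (X : 'rV[R]_N -> 'rV[R]_N) : open O ->
  (forall a, Cinf O (fun y => X y 0 a)) ->
  forall a, Cinf [set y | O (lsubmx y)] (fun y => tangent_lift X y 0 a).
Proof.
move=> oO XC a k; have oO' := @open_lsubmx N N O oO.
have Cl f : Ck k O f -> Ck k [set y : 'rV[R]_(N + N) | O (lsubmx y)] (fun y => f (lsubmx y)).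
  apply: Ck_comp => // b.
  apply: (@Ck_eq _ _ _ _ (fun y => y 0 (lshift N b))) => // [y _|]; first by rewrite mxE.
  exact: Ck_coord.
case: (split_ordP a) => b ->.
  by apply: (@Ck_eq _ _ _ _ (fun y => X (lsubmx y) 0 b)) => // [y _|]; [rewrite /tangent_lift row_mxEl|exact: Cl (XC b k)].
apply: (@Ck_eq _ _ _ _ (fun y => \sum_j y 0 (rshift N j) * pd j (fun z => X z 0 b) (lsubmx y))) => //.
  by move=> y _; rewrite /tangent_lift row_mxEr mxE /dotp; apply: eq_bigr => j _; rewrite mxE.
apply: Ck_sum => // j; apply: Ck_mul => //; first exact: Ck_coord.
by apply: (Cl (pd j (fun z => X z 0 b))); apply: CkS_pd; exact: (XC b k.+1).
Qed.

(** By induction on the order: the partial derivatives in the parameter are the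
second components of solutions of the tangent lift, which is again a smooth
field.  This is why the dimension and the field are generalised. *)
Lemma sol_smooth k : forall N M (O : set 'rV[R]_N) (X : 'rV[R]_N -> 'rV[R]_N) c r (P : set 'rV[R]_M)
  (u : 'rV[R]_M -> R -> 'rV[R]_N), open O -> 0 < r ->
  (forall y, `|y - c| <= r -> O y) -> (forall a, Cinf O (fun y => X y 0 a)) ->
  open P -> (forall p, P p -> sol (fun=> X) (u p)) ->
  (forall p, P p -> forall t : R, 0 <= t <= 1 -> `|u p t - c| <= r) ->
  (forall a, Cinf P (fun p => u p 0 0 a)) ->
  forall t : R, 0 <= t <= 1 -> forall a, Ck k P (fun p => u p t 0 a).
Proof.
elim: k => [|k IH] N M O X c r P u oO r0 BO XC oP uS uB u0C t t01.
  by move=> a p Pp; apply: (sol_continuous oO (ltW r0) BO XC oP uS uB u0C t01).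
have uc a p : P p -> {for p, continuous (fun p => u p t 0 a)}.
  exact: (sol_continuous oO (ltW r0) BO XC oP uS uB u0C t01).
move=> a; apply: Ck_local => p0 Pp0.
have [L L0 LP] := dfield_lip oO (ltW r0) BO XC.
pose y0 l p : 'rV[R]_N := \row_b pd l (fun p => u p 0 0 b) p.
have y0C l b j : Ck j P (fun p => y0 l p 0 b).
  apply: (@Ck_eq _ _ _ _ (pd l (fun p => u p 0 0 b))) => // [p _|]; first by rewrite mxE.
  by apply: CkS_pd; exact: (u0C b j.+1).
have y0c l p : P p -> {for p, continuous (y0 l)}.
  by move=> Pp; apply: (@cvg_mx R N _ (nbhs p) _ _ _).1 => b; exact: Ck_continuous (y0C l b 0%N) Pp.
(* on P' the initial values of the linearised equations are bounded by V *)
pose V := \big[Num.max/0]_l `|y0 l p0| + 1.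
have V0 : 0 <= V by rewrite addr_ge0 // bigmax_ge_id.
pose Pn := P `&` [set p | forall l, `|y0 l p| < V].
have : nbhs p0 Pn.
  apply: filterI; first exact: open_nbhs_nbhs.
  apply: (@filter_forall _ _ (fun l p => `|y0 l p| < V) (nbhs p0)) => l.
  apply: (@cvgr_lt R _ (nbhs p0) (nbhs_filter p0) (fun p => `|y0 l p|) _ (cvg_norm (y0c l p0 Pp0))).
  apply: (@le_lt_trans _ _ (\big[Num.max/0]_l `|y0 l p0|)).
    exact: (le_bigmax _ (fun l => `|y0 l p0|) l).
  by rewrite /V ltrDl; exact: ltr01.
rewrite nbhsE => -[P' [oP' P'p0] P'P].
exists P'; split=> //.
have P'1 p : P' p -> P p by move=> /P'P[].
have lin p l : P p -> exists2 Y, Y 0 = y0 l p & sol (fun t => dfield X (u p (clamp 0 1 t))) Y.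
  move=> Pp; apply: (@picard R N _ L L0).
  - move=> s v w; have -> : dfield X (u p (clamp 0 1 s)) v - dfield X (u p (clamp 0 1 s)) w =
        dfield X (u p (clamp 0 1 s)) (v - w) by apply/rowP => b; rewrite !mxE dotpB.
    by apply: LP; apply: uB => //; exact: clamp_itv.
  - move=> w cw b s; rewrite /dfield /dotp; under eq_fun do rewrite mxE.
    apply: continuous_sum => j; apply: cvgM; first exact: cw.
    apply: (@continuous_comp _ _ _ (fun s => u p (clamp 0 1 s)) (pd j (fun z => X z 0 b))).
      apply: (@cvg_mx R N _ (nbhs s) _ _ _).1 => i.
      apply: (@continuous_comp _ _ _ (clamp 0 1) (fun s => u p s 0 i)); first exact: clamp_continuous.
      by have [cu _] := uS _ Pp; exact: cu.
    apply: (@Ck_continuous R N 0 O); first by apply: CkS_pd; exact: (XC b 1%N).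
    by apply: BO; apply: uB => //; exact: clamp_itv.
have [Y YP] : exists Y : 'rV[R]_M -> 'I_M -> R -> 'rV[R]_N, forall p l, P p ->
   Y p l 0 = y0 l p /\ sol (fun t => dfield X (u p (clamp 0 1 t))) (Y p l).
  have H pl : exists Y, P pl.1 -> Y 0 = y0 pl.2 pl.1 /\ sol (fun t => dfield X (u pl.1 (clamp 0 1 t))) Y.
    case: (pselect (P pl.1)) => [Pp|nP]; last by exists (fun=> 0).
    by have [Y ? ?] := lin _ pl.2 Pp; exists Y.
  have [Y YP] := choice H; exists (fun p l => Y (p, l)) => p l; exact: (YP (p, l)).
have Yd p l : P p -> forall s : R, 0 <= s <= 1 -> forall b, is_derive p (delta_mx 0 l) (fun q => u q s 0 b) (Y p l s 0 b).
  move=> Pp; have [Y0 YS] := YP p l Pp.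
  apply: (sol_derivable oO (ltW r0) BO XC oP uS uB Pp) => // b.
  by rewrite Y0 mxE; exact: CkS_is_derive (u0C b 1%N) Pp.
pose G := gronwall_cst N L.
have G0 : 0 <= G by exact: le_trans (gronwall_cst_ge1 N L0).
have Yb p l : P' p -> forall s : R, 0 <= s <= 1 -> `|Y p l s| <= G * V.
  move=> P'p s s01; have [Y0 [cY dY]] := YP p l (P'1 _ P'p).
  apply: (@le_trans _ _ (G * (`|Y p l 0| + 0))).
    apply: (@gronwall R N (Y p l) _ L 0 L0 (lexx _) cY dY) => // x /andP[x0 x1].
    by rewrite addr0; apply: LP; apply: uB; [exact: P'1|exact: clamp_itv].
  rewrite addr0 ler_wpM2l // Y0 ltW //; by have [_] := P'P _ P'p.
apply: CkS_intro => // [p P'p|l].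
  exact: uc (P'1 _ P'p).
exists (fun p => Y p l t 0 a) => [p P'p|]; first exact: Yd (P'1 _ P'p) _ t01 _.
have GV : 0 < G * V + 1 by rewrite ltr_wpDl // mulr_ge0.
(* scaling the linearised solution by d keeps the pair in the ball of radius r *)
pose d := r / (G * V + 1); have d0 : 0 < d by rewrite divr_gt0.
pose w p s : 'rV[R]_(N + N) := row_mx (u p s) (d *: Y p l s).
have wC : Ck k P' (fun p => w p t 0 (rshift N a)).
  apply: (IH _ _ [set y | O (lsubmx y)] (tangent_lift X) (row_mx c 0) r) => //.
  - exact: open_lsubmx.
  - move=> y yr /=; apply: BO; apply: le_trans yr.
    by have := norm_lsubmx (y - row_mx c 0); rewrite linearB /= row_mxKl.
  - exact: tangent_lift_smooth.
  - move=> p P'p; have [cu du] := uS _ (P'1 _ P'p); have [_ [cY dY]] := YP p l (P'1 _ P'p).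
    split=> [b|s s01 b]; case: (split_ordP b) => j ->; rewrite /w /tangent_lift.
    + by under eq_fun do rewrite row_mxEl; exact: cu.
    + under eq_fun do rewrite row_mxEr mxE; move=> s; exact: (cvgM (cvg_cst _) (cY j s)).
    + by under eq_fun do rewrite row_mxEl; rewrite row_mxEl row_mxKl; exact: du.
    + under eq_fun do rewrite row_mxEr mxE; rewrite row_mxEr row_mxKl row_mxKr mxE dotpZ.
      have := is_deriveZ d (dY _ s01 j); rewrite mxE clamp_id //.
      by move/andP: s01 => [? ?]; rewrite !ltW.
  - move=> p P'p s s01.
    have -> : w p s - row_mx c 0 = row_mx (u p s - c) (d *: Y p l s).
      by rewrite /w opp_row_mx add_row_mx subr0.
    apply: norm_row_mx; first exact: uB (P'1 _ P'p) _ s01.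
    rewrite normrZ gtr0_norm // (le_trans (ler_wpM2l (ltW d0) (Yb p l P'p s s01))) //.
    by rewrite /d mulrAC ler_pdivrMr // ler_wpM2l ?(ltW r0) // lerDl; exact: ler01.
  - move=> b j; case: (split_ordP b) => i ->.
      apply: (@Ck_eq _ _ _ _ (fun p => u p 0 0 i)) => // [p _|]; first by rewrite /w row_mxEl.
      exact: Ck_sub P'1 (u0C i j).
    apply: (@Ck_eq _ _ _ _ (fun p => d * y0 l p 0 i)) => // [p P'p|].
      by rewrite /w row_mxEr [RHS]mxE; have [-> _] := YP p l (P'1 _ P'p).
    by apply: Ck_mul => //; [exact: Ck_cst|exact: Ck_sub P'1 (y0C l i j)].
apply: (@Ck_eq _ _ _ _ (fun p => d^-1 * w p t 0 (rshift N a))) => // [p _|].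
  by rewrite /w row_mxEr mxE mulrA mulVf ?mul1r // gt_eqF.
by apply: Ck_mul => //; exact: Ck_cst.
Unshelve. all: by end_near. Qed.

End Regularity.

(** * Flow of a field for a parameter-dependent time *)

Section Flow.
Context {R : realType}.
Implicit Types (N M : nat).

(** The two velocities are only compared with one another, so that the same lemma
applies to reparametrised curves and to equations with a time-dependent factor. *)
Lemma curves_agree N (u v u' v' : R -> 'rV[R]_N) L : 0 <= L ->
  (forall k, continuous (fun t => u t 0 k)) -> (forall k, continuous (fun t => v t 0 k)) ->
  (forall t : R, 0 < t < 1 -> forall k, is_derive t (1 : R) (fun s => u s 0 k) (u' t 0 k)) ->
  (forall t : R, 0 < t < 1 -> forall k, is_derive t (1 : R) (fun s => v s 0 k) (v' t 0 k)) ->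
  (forall t : R, 0 < t < 1 -> `|u' t - v' t| <= L * `|u t - v t|) ->
  u 0 = v 0 -> forall t : R, 0 <= t <= 1 -> u t = v t.
Proof.
move=> L0 cu cv du dv uv uv0 t t01.
apply/eqP; rewrite -subr_eq0 -normr_le0.
have := @gronwall R N (fun t => u t - v t) (fun t => u' t - v' t) L 0 L0 (lexx _).
rewrite uv0 subrr normr0 addr0 mulr0; apply=> //.
- move=> k s; under eq_fun do rewrite !mxE; exact: (cvgB (cu k s) (cv k s)).
- move=> s s01 k; under eq_fun do rewrite !mxE; rewrite !mxE.
  exact: is_deriveB (du _ s01 k) (dv _ s01 k).
- by move=> s s01; rewrite addr0; exact: uv.
Qed.

(** Clamping coordinatewise is 1-Lipschitz for the sup norm, which makes a field
on a ball into a globally Lipschitz one. *)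
Definition ball_clamp N (c : 'rV[R]_N) r (y : 'rV[R]_N) : 'rV[R]_N :=
  \row_k clamp (c 0 k - r) (c 0 k + r) (y 0 k).

Lemma ball_clamp_in N (c : 'rV[R]_N) r y : 0 <= r -> `|ball_clamp c r y - c| <= r.
Proof.
move=> r0; apply: rV_norm_le => // k; rewrite !mxE.
have rr : c 0 k - r <= c 0 k + r by rewrite lerD2l (le_trans _ r0) // oppr_le0.
have := clamp_itv (y 0 k) rr; rewrite ler_norml; lra.
Qed.

Lemma ball_clamp_id N (c : 'rV[R]_N) r y : `|y - c| <= r -> ball_clamp c r y = y.
Proof.
move=> yr; apply/rowP => k; rewrite mxE clamp_id //.
have := le_trans (coord_le_norm (y - c) k) yr; rewrite !mxE ler_norml; lra.
Qed.

Lemma ball_clamp_lip N (c : 'rV[R]_N) r y z : 0 <= r ->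
  `|ball_clamp c r y - ball_clamp c r z| <= `|y - z|.
Proof.
move=> r0; apply: rV_norm_le => // k; rewrite !mxE.
have rr : c 0 k - r <= c 0 k + r by rewrite lerD2l (le_trans _ r0) // oppr_le0.
apply: le_trans (clamp_lip _ _ rr) _.
by have := coord_le_norm (y - z) k; rewrite !mxE.
Qed.

Lemma local_solution N (O : set 'rV[R]_N) (X : 'rV[R]_N -> 'rV[R]_N) c r :
  open O -> 0 < r -> (forall y, `|y - c| <= r -> O y) ->
  (forall a, Cinf O (fun y => X y 0 a)) ->
  (forall y, `|y - c| <= r -> `|X y| <= r / 2) ->
  forall x, `|x - c| <= r / 2 -> exists u, [/\ u 0 = x, sol (fun=> X) u &
    forall t : R, 0 <= t <= 1 -> `|u t - c| <= r].
Proof.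
move=> oO r0 BO XC Xr x xr; have r0' := ltW r0.
have [L L0 LP] := field_lip oO r0' BO XC.
have bi y := ball_clamp_in c y r0'.
have [||u u0 [cu du]] := @picard R N (fun=> X \o ball_clamp c r) L L0 _ _ x.
- move=> _ a b /=; apply: le_trans (LP _ _ (bi a) (bi b)) _.
  by rewrite ler_wpM2l // ball_clamp_lip.
- move=> w cw k s.
  apply: (@continuous_comp _ _ _ (fun s => ball_clamp c r (w s)) (fun y => X y 0 k)).
    apply: (@cvg_mx R N _ (nbhs s) _ _ _).1 => j.
    rewrite mxE; under eq_fun do rewrite mxE.
    by apply: (@continuous_comp _ _ _ (fun s => w s 0 j) (clamp _ _)); [exact: cw|exact: clamp_continuous].
  exact: (@Ck_continuous R N 0 O) (XC k 0%N) (BO _ (bi _)).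
have ub (t : R) : 0 <= t <= 1 -> `|u t - c| <= r.
  move=> /andP[t0 t1]; have -> : u t - c = (u t - u 0) + (x - c) by rewrite u0 addrA subrK.
  rewrite (splitr r) (le_trans (ler_normD _ _)) // lerD //.
  apply: rV_norm_le => [|k]; first by rewrite divr_ge0.
  rewrite !mxE; apply: (@le_trans _ _ (r / 2 * (t - 0))); last first.
    by rewrite subr0 ler_piMr // divr_ge0.
  apply: (@lip_increment R (fun t => u t 0 k) (fun t => X (ball_clamp c r (u t)) 0 k)) => //.
  - exact: continuous_subspaceT (cu k).
  - move=> s /andP[s0 st]; have s01 : 0 < s < 1 by rewrite s0 (lt_le_trans st).
    exact: du _ s01 k.
  - by move=> s _; apply: le_trans (coord_le_norm _ _) _; exact: Xr.
exists u; split=> //; split=> // t t01 k.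
rewrite -(@ball_clamp_id _ c r (u t)); first exact: du.
by apply: ub; move/andP: t01 => [? ?]; rewrite !ltW.
Qed.

(** A parameter-dependent multiple [theta p] of a field is handled by adjoining to
the state a constant component equal to [theta p]: the parameter then enters only
through the initial value, as in [sol_smooth]. *)
Lemma flow_param N M (O : set 'rV[R]_N) (X : 'rV[R]_N -> 'rV[R]_N) c r :
  open O -> 0 < r -> (forall y, `|y - c| <= r -> O y) ->
  (forall a, Cinf O (fun y => X y 0 a)) ->
  exists2 kappa, 0 < kappa & forall (P : set 'rV[R]_M) (iota : 'rV[R]_M -> 'rV[R]_N) (theta : 'rV[R]_M -> R),
    open P -> (forall a, Cinf P (fun p => iota p 0 a)) -> Cinf P theta ->
    (forall p, P p -> `|iota p - c| <= r / 2) -> (forall p, P p -> `|theta p| <= kappa) ->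
    exists u : 'rV[R]_M -> R -> 'rV[R]_N,
      (forall p, P p -> [/\ u p 0 = iota p, sol (fun _ y => theta p *: X y) (u p) &
         forall t : R, 0 <= t <= 1 -> `|u p t - c| <= r]) /\
      forall a, Cinf P (fun p => u p 1 0 a).
Proof.
move=> oO r0 BO XC; have r0' := ltW r0.
have [K K0 KP] := bounded_family_on_ball r0' BO (fun a y Oy => Ck_continuous (XC a 0%N) Oy).
have Xb y : `|y - c| <= r -> `|X y| <= K by move=> yr; apply: rV_norm_le => // k; exact: KP.
have K1 : 0 < K + 1 by rewrite ltr_wpDl.
pose kappa := r / (4 * (K + 1)).
have kappa0 : 0 < kappa by rewrite divr_gt0 // mulr_gt0.
exists kappa => // P iota theta oP iC tC ib tb.
(* s is such that the adjoined component theta p / s is at most r / 2 in modulus *)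
pose s := 2 * kappa / r; have s0 : 0 < s by rewrite divr_gt0 // mulr_gt0.
pose Z (y : 'rV[R]_(N + 1)) : 'rV[R]_(N + 1) := row_mx ((s * y 0 (rshift N 0)) *: X (lsubmx y)) 0.
pose c' : 'rV[R]_(N + 1) := row_mx c 0.
pose O' := [set y : 'rV[R]_(N + 1) | O (lsubmx y)].
have oO' : open O' := @open_lsubmx R N 1 O oO.
have Bl y : `|y - c'| <= r -> `|lsubmx y - c| <= r.
  move=> yr; apply: le_trans yr.
  by have := norm_lsubmx (y - c'); rewrite linearB /= /c' row_mxKl.
have BO' y : `|y - c'| <= r -> O' y by move=> /Bl /BO.
have ZC a : Cinf O' (fun y => Z y 0 a).
  move=> k; case: (split_ordP a) => b ->; last first.
    apply: (@Ck_eq _ _ _ _ (fun=> 0)) => // [y _|]; last exact: Ck_cst.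
    by rewrite /Z row_mxEr mxE.
  apply: (@Ck_eq _ _ _ _ (fun y => s * y 0 (rshift N 0) * X (lsubmx y) 0 b)) => // [y _|].
    by rewrite /Z row_mxEl mxE.
  apply: Ck_mul => //; first by apply: Ck_mul => //; [exact: Ck_cst|exact: Ck_coord].
  apply: (Ck_comp oO' oO _ _ (XC b k)) => // j.
  apply: (@Ck_eq _ _ _ _ (fun y => y 0 (lshift 1 j))) => // [y _|]; first by rewrite mxE.
  exact: Ck_coord.
have Zb y : `|y - c'| <= r -> `|Z y| <= r / 2.
  move=> yr; apply: norm_row_mx; last by rewrite normr0 divr_ge0.
  rewrite normrZ normrM (gtr0_norm s0).
  have y0r : `|y 0 (rshift N 0)| <= r.
    have := le_trans (coord_le_norm (y - c') (rshift N 0)) yr.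
    by rewrite mxE [(- c') _ _]mxE /c' row_mxEr mxE subr0.
  apply: (@le_trans _ _ (s * r * K)).
    apply: ler_pM => //; last exact: Xb (Bl _ yr).
      by rewrite mulr_ge0 // ltW.
    by rewrite ler_wpM2l // ltW.
  rewrite /s divfK ?gt_eqF // /kappa.
  have -> : r / 2 = 2 * (r / (4 * (K + 1))) * (K + 1) by field; rewrite gt_eqF.
  have k2 : 0 <= 2 * (r / (4 * (K + 1))) by rewrite mulr_ge0 // (ltW kappa0).
  by rewrite (ler_wpM2l k2) // lerDl ler01.
pose ini p : 'rV[R]_(N + 1) := row_mx (iota p) (const_mx (theta p / s)).
have inib p : P p -> `|ini p - c'| <= r / 2.
  move=> Pp; rewrite /ini /c' opp_row_mx add_row_mx subr0; apply: norm_row_mx; first exact: ib.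
  apply: rV_norm_le => [|k]; first by rewrite divr_ge0.
  rewrite mxE normrM normfV (gtr0_norm s0) ler_pdivrMr //.
  apply: le_trans (tb _ Pp) _; rewrite /s le_eqVlt; apply/orP; left; apply/eqP.
  by field; rewrite gt_eqF.
have [w wP] : exists w, forall p, P p -> [/\ w p 0 = ini p, sol (fun=> Z) (w p) &
    forall t : R, 0 <= t <= 1 -> `|w p t - c'| <= r].
  have H p : exists w, P p -> [/\ w 0 = ini p, sol (fun=> Z) w & forall t : R, 0 <= t <= 1 -> `|w t - c'| <= r].
    case: (pselect (P p)) => [Pp|nP]; last by exists (fun=> 0).
    by have [w wP] := local_solution oO' r0 BO' ZC Zb (inib _ Pp); exists w.
  by have [w wP] := choice H; exists w.
have wC a : Cinf P (fun p => w p 1 0 a).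
  move=> k; apply: (@sol_smooth R k _ _ O' Z c' r P w oO' r0 BO' ZC oP _ _ _ 1 _ a).
  - by move=> p /wP[].
  - by move=> p /wP[].
  - move=> b j; apply: (@Ck_eq _ _ _ _ (fun p => ini p 0 b)) => // [p /wP[->]//|].
    case: (split_ordP b) => i ->.
      by apply: (@Ck_eq _ _ _ _ (fun p => iota p 0 i)) => // [p _|]; [rewrite /ini row_mxEl|exact: iC].
    apply: (@Ck_eq _ _ _ _ (fun p => theta p * s^-1)) => // [p _|].
      by rewrite /ini row_mxEr mxE.
    by apply: Ck_mul => //; exact: Ck_cst.
  - by rewrite ler01 lexx.
exists (fun p t => lsubmx (w p t)); split=> [p Pp|a k]; last first.
  apply: (@Ck_eq _ _ _ _ (fun p => w p 1 0 (lshift 1 a))) => // [p _|]; first by rewrite mxE.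
  exact: wC.
have [w0 [cw dw] wb] := wP _ Pp.
have wt (t : R) : 0 <= t <= 1 -> s * w p t 0 (rshift N 0) = theta p.
  move=> /andP[t0 t1].
  have : `|w p t 0 (rshift N 0) - w p 0 0 (rshift N 0)| <= 0 * (t - 0).
    apply: (@lip_increment R (fun t => w p t 0 (rshift N 0)) (fun=> 0)) => //.
    - exact: continuous_subspaceT (cw _).
    - move=> x /andP[x0 xt]; have x01 : 0 < x < 1 by rewrite x0 (lt_le_trans xt).
      by have := dw _ x01 (rshift N 0); rewrite /Z row_mxEr mxE.
    - by move=> x _; rewrite normr0.
  rewrite mul0r normr_le0 subr_eq0 => /eqP ->; rewrite w0 /ini row_mxEr mxE.
  by rewrite mulrCA mulfV ?mulr1 // gt_eqF.
split.
- by rewrite w0 /ini row_mxKl.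
- split=> [k|t t01 k].
    by under eq_fun do rewrite mxE; exact: cw.
  under eq_fun do rewrite mxE; rewrite mxE -(wt t).
    by have := dw _ t01 (lshift 1 k); rewrite /Z row_mxEl mxE.
  by move/andP: t01 => [? ?]; rewrite !ltW.
- by move=> t t01; exact: Bl (wb _ t01).
Qed.

End Flow.

(** * Charts of a manifold with boundary and covectors *)

Section HalfSpace.
Context {R : realType}.

(** A partial derivative at a point of a half-space is determined by the values in
the half-space: for increments of positive sign, every coordinate direction points
into it, the boundary direction included. *)
Lemma pd_half_eq N (g g' : 'rV[R]_N -> R) (x : 'rV[R]_N) (i0 l : 'I_N) :
  derivable g x (delta_mx 0 l) -> derivable g' x (delta_mx 0 l) ->
  0 <= x 0 i0 -> nbhs x [set y : 'rV[R]_N | 0 <= y 0 i0 -> g y = g' y] ->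
  pd l g x = pd l g' x.
Proof.
move=> gd gd' x0 gg.
have H : h^-1 *: (g (h *: delta_mx 0 l + x) - g x) @[h --> (0 : R)^'+] --> pd l g x.
  by apply: cvg_dnbhs_at_right; exact: gd.
have H' : h^-1 *: (g' (h *: delta_mx 0 l + x) - g' x) @[h --> (0 : R)^'+] --> pd l g' x.
  by apply: cvg_dnbhs_at_right; exact: gd'.
apply: (@cvg_unique _ _ ((h^-1 *: (g (h *: delta_mx 0 l + x) - g x)) @[h --> (0 : R)^'+]) _ _ _ H); first exact: norm_hausdorff.
apply: cvg_trans H'; apply: near_eq_cvg.
have gx : g x = g' x by exact: (nbhs_singleton gg x0).
have qc : (h *: delta_mx 0 l + x) @[h --> (0 : R)^'+] --> x.
  have : (h *: delta_mx 0 l + x) @[h --> (0 : R)^'+] --> (0 : R) *: delta_mx 0 l + x.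
    apply: cvgD; last exact: cvg_cst.
    apply: cvgZr_tmp; apply: cvg_at_right_filter; exact: cvg_id.
  by rewrite scale0r add0r.
have gg' : \forall h \near (0 : R)^'+, (0 <= (h *: delta_mx 0 l + x) 0 i0 -> g (h *: delta_mx 0 l + x) = g' (h *: delta_mx 0 l + x)) := qc _ gg.
near=> h.
rewrite gx (_ : g (h *: delta_mx 0 l + x) = g' (h *: delta_mx 0 l + x)) //.
apply: (near gg' h) => //.
have h0 : 0 <= h by rewrite ltW //; near: h; exact: nbhs_right_gt.
by rewrite !mxE addr_ge0 // mulr_ge0 // ler0n.
Unshelve. all: by end_near. Qed.

End HalfSpace.

Section Manifold.
Context {R : realType} {m : nat} {M : bmanifold R m}.
Notation n := m.+1.
Implicit Types (i j : cidx (bm_charts M)) (p q : M).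

Definition jacobian_mx N N' (h : 'rV[R]_N -> 'rV[R]_N') (x : 'rV[R]_N) : 'M[R]_(N', N) :=
  \matrix_(a, l) pd l (fun y => h y 0 a) x.

Lemma chart_half i p : cdom i p -> half_space (ccoord i p).
Proof.
move=> ip; have [W _ WE] := bm_coord_open (bm_dom_open i) (fun x => id).
have : (W `&` @half_space R m) (ccoord i p) by rewrite -WE; exists p.
by case.
Qed.

(** Openness of chart images relative to the half-space, in the two forms in which
it is used: points of [A] exist for all nearby coordinates in the half-space, and
all points with nearby coordinates are in [A]. *)
Lemma chart_nbhd i p (A : set M) : open A -> A p -> cdom i p ->
  exists W : set 'rV[R]_n, [/\ open W, W (ccoord i p),
    (forall x, W x -> half_space x -> exists q, [/\ A q, cdom i q & ccoord i q = x]) &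
    forall q, cdom i q -> W (ccoord i q) -> A q].
Proof.
move=> oA Ap ip.
have [W oW WE] := @bm_coord_open R m M i (A `&` cdom i) (openI oA (bm_dom_open i)) (@subIsetr _ _ _).
exists W; split=> //.
- have : (W `&` @half_space R m) (ccoord i p) by rewrite -WE; exists p.
  by case.
- move=> x Wx hx; have : (W `&` @half_space R m) x by [].
  by rewrite -WE => -[q [Aq iq] <-]; exists q.
- move=> q iq Wq; have : (W `&` @half_space R m) (ccoord i q) by split=> //; exact: chart_half.
  by rewrite -WE => -[q' [Aq' iq'] /(bm_coord_inj iq' iq) <-].
Qed.

Lemma near_coord i p (A : set M) : open A -> A p -> cdom i p ->
  \forall x \near ccoord i p, forall q, cdom i q -> ccoord i q = x -> A q.
Proof.
move=> oA Ap ip; have [W [oW Wp _ WA]] := chart_nbhd oA Ap ip.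
apply: (@filterS _ (nbhs (ccoord i p)) _ W); last exact: open_nbhs_nbhs.
by move=> x Wx q iq qx; apply: (WA _ iq); rewrite qx.
Qed.

Lemma near_coord_exists i p : cdom i p ->
  nbhs (ccoord i p) [set x : 'rV[R]_n | 0 <= x 0 ord0 -> exists2 q, cdom i q & ccoord i q = x].
Proof.
move=> ip; have [W [oW Wp WA _]] := chart_nbhd (bm_dom_open i) ip ip.
apply: (@filterS _ (nbhs (ccoord i p)) _ W); last exact: open_nbhs_nbhs.
by move=> x Wx hx; have [q [_ iq qx]] := WA _ Wx hx; exists q.
Qed.

Lemma local_rep_near (T : Type) N (X : charts R T N) (i : cidx X) (A : set T) f z g :
  local_rep i A f z g -> \forall x \near ccoord i z, forall w, A w -> cdom i w -> ccoord i w = x -> f w = g x.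
Proof.
move=> [B [oO Oz gC fg]].
apply: (@filterS _ (nbhs (ccoord i z)) _ B); last exact: open_nbhs_nbhs.
by move=> x Ox w Aw iw wx; rewrite fg // wx.
Qed.

Lemma local_rep_C1 (T : Type) N (X : charts R T N) (i : cidx X) (A : set T) f z g :
  local_rep i A f z g -> C1at g (ccoord i z).
Proof. by move=> [B [oO Oz gC fg]]; exact: C1at_Ck oO Oz (gC 1%N). Qed.

Lemma C1at_derivable N (g : 'rV[R]_N -> R) x l : C1at g x -> derivable g x (delta_mx 0 l).
Proof. by move=> [/nbhs_singleton]. Qed.

Lemma local_rep_continuous (T : Type) N (X : charts R T N) (i : cidx X) (A : set T) f z g :
  local_rep i A f z g -> {for ccoord i z, continuous g}.
Proof. by move=> [B [oO Oz gC fg]]; exact: (Ck_continuous (gC 0%N) Oz). Qed.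

Lemma local_rep_self (T : Type) N (X : charts R T N) (i : cidx X) (A : set T) f z g :
  local_rep i A f z g -> A z -> cdom i z -> f z = g (ccoord i z).
Proof. by move=> [B [oO Oz gC fg]] Az iz; exact: fg. Qed.

Lemma jacobian_rep i j p D : is_jacobian i j p D ->
  exists g, forall a, local_rep i (cdom j) (fun q => ccoord j q 0 a) p (g a) /\
    forall l, D a l = pd l (g a) (ccoord i p).
Proof.
move=> HD; suff H a : exists g, local_rep i (cdom j) (fun q => ccoord j q 0 a) p g /\
    forall l, D a l = pd l g (ccoord i p) by have [g gP] := choice H; exists g.
have [_ [g gr Dg]] := HD a; exists g; split=> // l.
by have := congr1 (fun v : 'rV_n => v 0 l) Dg; rewrite !mxE.
Qed.

(** The chain rule for transition maps; at boundary points the two local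
extensions only agree on the half-space, hence [pd_half_eq]. *)
Lemma jacobian_comp i j (k : cidx (bm_charts M)) p D E F : cdom i p -> cdom j p -> cdom k p ->
  is_jacobian i j p D -> is_jacobian j k p E -> is_jacobian i k p F -> F = E *m D.
Proof.
move=> ip jp kp HD HE HF.
have [g gP] := jacobian_rep HD; have [e eP] := jacobian_rep HE; have [f fP] := jacobian_rep HF.
pose G x : 'rV[R]_n := \row_a g a x.
have Gp : G (ccoord i p) = ccoord j p.
  apply/rowP => a; rewrite mxE; have [gr _] := gP a.
  by rewrite -(local_rep_self gr).
have gC a : C1at (g a) (ccoord i p) by case: (gP a) => r _; exact: local_rep_C1 r.
have eC a : C1at (e a) (ccoord j p) by case: (eP a) => r _; exact: local_rep_C1 r.
have fC a : C1at (f a) (ccoord i p) by case: (fP a) => r _; exact: local_rep_C1 r.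
apply/matrixP => a l.
have [fr Fa] := fP a; have [er Ea] := eP a.
rewrite Fa.
have dG b : is_derive (ccoord i p) (delta_mx 0 l) (fun x => G x 0 b) ((\row_c D c l : 'rV[R]_n) 0 b).
  have [gr Db] := gP b.
  have Hd : is_derive (ccoord i p) (delta_mx 0 l) (g b) (pd l (g b) (ccoord i p)).
    exact: derivableP (C1at_derivable (gC b)).
  rewrite [X in is_derive _ _ _ X]mxE Db (_ : (fun x => G x 0 b) = g b) //.
  by apply/funext => x; rewrite mxE.
have eC' : C1at (e a) (G (ccoord i p)) by rewrite Gp; exact: eC.
have [dd vv] := is_derive_chain eC' dG.
have -> : pd l (f a) (ccoord i p) = pd l (fun x => e a (G x)) (ccoord i p).
  apply: (@pd_half_eq R n _ _ _ ord0 l); [exact: C1at_derivable (fC a)|exact: dd|exact: chart_half|].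
have Gc : G x @[x --> ccoord i p] --> ccoord j p.
    rewrite -Gp; apply: (@cvg_mx R n _ (nbhs _) _ _ _).1 => b.
    rewrite mxE; under eq_fun do rewrite mxE.
    by have [gr _] := gP b; exact: local_rep_continuous gr.
  have N1 : \forall x \near ccoord i p, forall w, cdom k w -> cdom j w -> ccoord j w = G x ->
      ccoord k w 0 a = e a (G x) := Gc _ (local_rep_near er).
  have N2 := local_rep_near fr.
  have N3 : \forall x \near ccoord i p, forall b w, cdom j w -> cdom i w -> ccoord i w = x -> ccoord j w 0 b = g b x.
    apply: (@filter_forall _ _ _ (nbhs (ccoord i p))) => b.
    by have [gr _] := gP b; exact: local_rep_near gr.
  have N4 := near_coord_exists ip.
  have N5 := near_coord (bm_dom_open j) jp ip.
  have N6 := near_coord (bm_dom_open k) kp ip.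
  near=> x => x0.
  have [q iq qx] : exists2 q, cdom i q & ccoord i q = x by apply: (near N4 x).
  have jq : cdom j q by apply: (near N5 x).
  have kq : cdom k q by apply: (near N6 x).
  have Gx : ccoord j q = G x.
    by apply/rowP => b; rewrite mxE; apply: (near N3 x).
  rewrite -(near N2 x _ q) //; have H : forall w, cdom k w -> cdom j w -> ccoord j w = G x -> ccoord k w 0 a = e a (G x).
    exact: (near N1 x).
  exact: H.
by rewrite vv /dotp mxE; apply: eq_bigr => b _; rewrite !mxE mulrC Gp Ea.
Unshelve. all: by end_near. Qed.

Lemma jacobian_id i p : cdom i p -> is_jacobian i i p 1%:M.
Proof.
move=> ip a; split=> //; exists (fun x => x 0 a).
  exists setT; split=> //; first exact: openT.
  by move=> k; apply: Ck_coord; exact: openT.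
apply/rowP => l; rewrite !mxE.
have [_ ->] := is_derive_coord a (ccoord i p) (delta_mx 0 l).
by rewrite mxE eqxx /=.
Qed.

Lemma jacobian_unique i j p D E : cdom i p -> cdom j p ->
  is_jacobian i j p D -> is_jacobian i j p E -> D = E.
Proof.
move=> ip jp HD HE.
by have := jacobian_comp ip jp jp HD (jacobian_id jp) HE; rewrite mul1mx.
Qed.

Definition trans_map i j p (O : set 'rV[R]_n) (h : 'rV[R]_n -> 'rV[R]_n) :=
  [/\ open O, O (ccoord i p), (forall a, Cinf O (fun x => h x 0 a)) &
    forall w, cdom j w -> cdom i w -> O (ccoord i w) -> ccoord j w = h (ccoord i w)].

Lemma trans_map_exists i j p : cdom i p -> cdom j p -> exists O h, trans_map i j p O h.
Proof.
move=> ip jp; have [g gP] := choice (fun a => @bm_transition R m M i j p a ip jp).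
have [B BP] := choice gP.
have : nbhs (ccoord i p) [set x | forall a, B a x].
  apply: (@filter_forall _ _ (fun a x => B a x) (nbhs (ccoord i p))) => a.
  by have [oB Bp _ _] := BP a; exact: open_nbhs_nbhs.
rewrite nbhsE => -[B' [oO Op] OB].
exists B', (fun x => \row_a g a x); split=> // [a k|w jw iw Ow].
  apply: (@Ck_eq _ _ _ _ (g a)) => // [x _|]; first by rewrite mxE.
  have [_ _ gC _] := BP a; apply: Ck_sub (gC k) => x Ox; exact: OB.
by apply/rowP => a; rewrite mxE; have [_ _ _] := BP a; apply => //; exact: OB.
Qed.

Lemma trans_map_jacobian i j p O h w : trans_map i j p O h -> cdom i w -> cdom j w ->
  O (ccoord i w) -> is_jacobian i j w (jacobian_mx h (ccoord i w)).
Proof.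
move=> [oO Op hC hE] iw jw Ow a; split=> //; exists (fun x => h x 0 a).
  by exists O; split=> // v jv iv Ov; rewrite (hE v).
by apply/rowP => l; rewrite !mxE.
Qed.

Lemma jacobian_exists i j p : cdom i p -> cdom j p -> exists D, is_jacobian i j p D.
Proof.
move=> ip jp; have [B [h hT]] := trans_map_exists ip jp.
by exists (jacobian_mx h (ccoord i p)); apply: (trans_map_jacobian hT) => //; case: hT.
Qed.

Lemma jacobian_inv i j p D E : cdom i p -> cdom j p ->
  is_jacobian i j p D -> is_jacobian j i p E -> E *m D = 1%:M.
Proof. by move=> ip jp HD HE; rewrite -(jacobian_comp ip jp ip HD HE (jacobian_id ip)). Qed.

Lemma ct_eq i (z z' : cotangent M) : cdom i (ct_base z) -> ct_base z = ct_base z' ->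
  ct_comp z i = ct_comp z' i -> z = z'.
Proof.
case: z z' => [b c cl cn] [b' c' cl' cn'] /= ib bb'; subst b' => cc.
have E : c = c'.
  apply/funext => j; case: (pselect (cdom j b)) => [jb|nj]; last by rewrite cn // cn'.
  have [D HD] := jacobian_exists jb ib.
  by rewrite (cl j i D) // (cl' j i D) // cc.
subst c'; congr Cotangent; exact: Prop_irrelevance.
Qed.

(** The transformation law determines the components in all charts from those in
one; it is consistent by the chain rule for Jacobian matrices. *)
Lemma ct_exists i p (xi : 'rV[R]_n) : cdom i p ->
  exists z : cotangent M, ct_base z = p /\ ct_comp z i = xi.
Proof.
move=> ip.
have [D DP] : exists D, forall j, cdom j p -> is_jacobian j i p (D j).
  have H j : exists D, cdom j p -> is_jacobian j i p D.
    case: (pselect (cdom j p)) => [jp|nj]; last by exists 0.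
    by have [D HD] := jacobian_exists jp ip; exists D.
  by have [D DP] := choice H; exists D.
pose c j := if `[< cdom j p >] then xi *m D j else 0.
have cl j (k : cidx (bm_charts M)) E : cdom j p -> cdom k p -> is_jacobian j k p E -> c j = c k *m E.
  move=> jp kp HE; rewrite /c !asboolT //.
  by rewrite -mulmxA -(jacobian_comp jp kp ip HE (DP _ kp) (DP _ jp)).
have cn j : ~ cdom j p -> c j = 0 by move=> nj; rewrite /c asboolF.
exists (Cotangent cl cn); split=> //=; rewrite /c asboolT //.
by rewrite (jacobian_unique ip ip (DP _ ip) (jacobian_id ip)) mulmx1.
Qed.

Lemma nonzeroP i (z : cotangent M) : cdom i (ct_base z) -> nonzero z <-> ct_comp z i != 0.
Proof.
move=> iz; split=> [[j zj]|zi]; last by exists i.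
apply: contraNneq zj => zi0; case: (pselect (cdom j (ct_base z))) => [jz|nj].
  have [D HD] := jacobian_exists jz iz.
  by rewrite (ct_law jz iz HD) zi0 mul0mx.
by rewrite ct_norm.
Qed.

End Manifold.

(** * Cotangent lifts are symplectic *)

Section Symplectic.
Context {R : realType}.

Lemma is_derive_sumf (V : normedModType R) (I : finType) (f : I -> V -> R) (d : I -> R) x v :
  (forall i, is_derive x v (f i) (d i)) -> is_derive x v (fun y => \sum_i f i y) (\sum_i d i).
Proof.
move=> fd; elim: (index_enum I) => [|i s IH].
  rewrite big_nil (_ : (fun y => _) = cst 0); first exact: is_derive_cst.
  by apply/funext => y; rewrite big_nil.
rewrite big_cons (_ : (fun y => _) = f i \+ (fun y => \sum_(j <- s) f j y)).
  exact: is_deriveD (fd i) IH.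
by apply/funext => y; rewrite big_cons.
Qed.

Lemma lsubmx_delta N N' (l : 'I_N) : lsubmx (delta_mx 0 (lshift N' l) : 'rV[R]_(N + N')) = delta_mx 0 l.
Proof. by apply/rowP => a; rewrite !mxE eq_lshift. Qed.

Lemma rsubmx_delta N N' (l : 'I_N') : rsubmx (delta_mx 0 (rshift N l) : 'rV[R]_(N + N')) = delta_mx 0 l.
Proof. by apply/rowP => a; rewrite !mxE eq_rshift. Qed.

Lemma lsubmx_delta_r N N' (l : 'I_N') : lsubmx (delta_mx 0 (rshift N l) : 'rV[R]_(N + N')) = 0.
Proof. by apply/rowP => a; rewrite !mxE eq_lrshift. Qed.

Lemma rsubmx_delta_l N N' (l : 'I_N) : rsubmx (delta_mx 0 (lshift N' l) : 'rV[R]_(N + N')) = 0.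
Proof. by apply/rowP => a; rewrite !mxE eq_rlshift. Qed.

Lemma pd_lsubmx N N' (f : 'rV[R]_N -> R) (y : 'rV[R]_(N + N')) k :
  pd (lshift N' k) (fun y => f (lsubmx y)) y = pd k f (lsubmx y).
Proof.
have E := lsubmx_delta N' k.
have El (h : R) : lsubmx (h *: (delta_mx 0 (lshift N' k) : 'rV[R]_(N + N')) + y) = h *: delta_mx 0 k + lsubmx y.
  by rewrite -E; apply/rowP => l; rewrite !mxE.
by rewrite /derive; apply: (congr1 (fun F : R -> R => lim (F @ 0^'))); apply/funext => h /=; rewrite El.
Qed.

Lemma pd_lsubmx0 N N' (f : 'rV[R]_N -> R) (y : 'rV[R]_(N + N')) k :
  pd (rshift N k) (fun y => f (lsubmx y)) y = 0.
Proof.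
have E := lsubmx_delta_r N k.
have -> : pd (rshift N k) (fun y => f (lsubmx y)) y = 'D_0 f (lsubmx y).
  have El (h : R) : lsubmx (h *: (delta_mx 0 (rshift N k) : 'rV[R]_(N + N')) + y) = h *: 0 + lsubmx y.
    by rewrite -E; apply/rowP => l; rewrite !mxE.
  by rewrite /derive; apply: (congr1 (fun F : R -> R => lim (F @ 0^'))); apply/funext => h /=; rewrite El.
by rewrite derive0.
Qed.

(** Matrix of the symplectic form, for row vectors. *)
Definition Omega N : 'M[R]_(N + N) := block_mx 0 (- 1%:M) 1%:M 0.

Lemma hamvecE N (d : 'rV[R]_(N + N)) : hamvec d = d *m Omega N.
Proof.
rewrite /hamvec /Omega -[in RHS](hsubmxK d) mul_row_block.
by rewrite !mulmx0 !mulmx1 mulmxN mulmx1 add0r addr0.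
Qed.

(** Action on covectors of a change of coordinates [h] with inverse [k]. *)
Definition ct_lift N (h k : 'rV[R]_N -> 'rV[R]_N) (y : 'rV[R]_(N + N)) : 'rV[R]_(N + N) :=
  row_mx (h (lsubmx y)) (rsubmx y *m jacobian_mx k (h (lsubmx y))).

Lemma ct_lift_smooth N (h k : 'rV[R]_N -> 'rV[R]_N) (A B : set 'rV[R]_N) :
  open A -> open B -> (forall a, Cinf A (fun x => h x 0 a)) ->
  (forall a, Cinf B (fun x => k x 0 a)) -> (forall x, A x -> B (h x)) ->
  forall a, Cinf [set y | A (lsubmx y)] (fun y => ct_lift h k y 0 a).
Proof.
move=> oA oB hC kC AB a c; have oA' := @open_lsubmx R N N A oA.
have lC b : Ck c [set y : 'rV[R]_(N + N) | A (lsubmx y)] (fun y => lsubmx y 0 b).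
  apply: (@Ck_eq _ _ _ _ (fun y => y 0 (lshift N b))) => // [y _|]; first by rewrite mxE.
  exact: Ck_coord.
have hlC b : Ck c [set y : 'rV[R]_(N + N) | A (lsubmx y)] (fun y => h (lsubmx y) 0 b).
  exact: (Ck_comp oA' oA _ lC (hC b c)).
case: (split_ordP a) => b ->.
  apply: (@Ck_eq _ _ _ _ (fun y => h (lsubmx y) 0 b)) => // y _.
  by rewrite /ct_lift row_mxEl.
apply: (@Ck_eq _ _ _ _ (fun y => \sum_j y 0 (rshift N j) * pd b (fun z => k z 0 j) (h (lsubmx y)))) => //.
  by move=> y _; rewrite /ct_lift row_mxEr mxE; apply: eq_bigr => j _; rewrite !mxE.
apply: Ck_sum => // j; apply: Ck_mul => //; first exact: Ck_coord.
apply: (Ck_comp oA' oB _ hlC (CkS_pd b (kC j c.+1))) => y /=; exact: AB.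
Qed.

(** The Jacobian matrix is [block_mx P 0 (S *m P) K^T], where [P *m K = 1] and [S]
collects second derivatives of [k]; the identity reduces to the symmetry of [S]. *)
Lemma ct_lift_symplectic N (h k : 'rV[R]_N -> 'rV[R]_N) (A B : set 'rV[R]_N) y :
  open A -> open B -> (forall a, Cinf A (fun x => h x 0 a)) ->
  (forall a, Cinf B (fun x => k x 0 a)) -> A (lsubmx y) -> B (h (lsubmx y)) ->
  jacobian_mx h (lsubmx y) *m jacobian_mx k (h (lsubmx y)) = 1%:M ->
  jacobian_mx (ct_lift h k) y *m Omega N *m (jacobian_mx (ct_lift h k) y)^T = Omega N.
Proof.
move=> oA oB hC kC Ay By.
set x := lsubmx y in Ay By *; set xi := rsubmx y.
set P := jacobian_mx h x; set K := jacobian_mx k (h x) => PK.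
(* S is the derivative of xi *m Dk with respect to the point where Dk is taken *)
pose S : 'M[R]_N := \matrix_(c, e) \sum_b xi 0 b * pd e (pd c (fun z => k z 0 b)) (h x).
have S_sym : S^T = S.
  apply/matrixP => c e; rewrite [LHS]mxE [LHS]mxE [RHS]mxE; apply: eq_bigr => b _.
  by rewrite (schwarz e c oB (kC b 2%N) By).
have dl v a : is_derive y v (fun z : 'rV[R]_(N + N) => h (lsubmx z) 0 a) (dotp (fun e => P a e) (lsubmx v)).
  have := @is_derive_chain R _ N (fun z => h z 0 a) lsubmx y v (lsubmx v) (C1at_Ck oA Ay (hC a 1%N)).
  rewrite (_ : (fun e => P a e) = fun e => pd e (fun z => h z 0 a) (lsubmx y)); last first.
    by apply/funext => e; rewrite mxE.
  apply => b; under eq_fun do rewrite mxE; rewrite mxE; exact: is_derive_coord.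
have dr v c : is_derive y v (fun z : 'rV[R]_(N + N) => (rsubmx z *m jacobian_mx k (h (lsubmx z))) 0 c)
    (\sum_b (xi 0 b * (dotp (fun e => pd e (pd c (fun z => k z 0 b)) (h x)) (\row_e dotp (fun j => P e j) (lsubmx v)))
       + K b c * rsubmx v 0 b)).
  rewrite (_ : (fun z => _) = fun z => \sum_b (rsubmx z 0 b * pd c (fun z => k z 0 b) (h (lsubmx z)))); last first.
    by apply/funext => z; rewrite mxE; apply: eq_bigr => b _; rewrite !mxE.
  apply: is_derive_sumf => b.
  have d1 : is_derive y v (fun z : 'rV[R]_(N + N) => rsubmx z 0 b) (rsubmx v 0 b).
    by under eq_fun do rewrite mxE; rewrite mxE; exact: is_derive_coord.
  have d2 : is_derive y v (fun z : 'rV[R]_(N + N) => pd c (fun z => k z 0 b) (h (lsubmx z)))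
      (dotp (fun e => pd e (pd c (fun z => k z 0 b)) (h x)) (\row_e dotp (fun j => P e j) (lsubmx v))).
    apply: (@is_derive_chain R _ N (pd c (fun z => k z 0 b)) (fun z => h (lsubmx z))).
      exact: (C1at_Ck oB By (CkS_pd c (kC b 2%N))).
    by move=> e; rewrite mxE; exact: dl.
  have := is_deriveM d1 d2; rewrite /GRing.scale /=.
  by rewrite [K b c]mxE.
have JE : jacobian_mx (ct_lift h k) y = block_mx P 0 (S *m P) K^T.
  apply/matrixP => a l; rewrite [LHS]mxE.
  case: (split_ordP a) => c ->; case: (split_ordP l) => e ->.
  - rewrite block_mxEul (_ : (fun z => _) = fun z => h (lsubmx z) 0 c); last first.
      by apply/funext => z; rewrite /ct_lift row_mxEl.
    by have [_ ->] := dl (delta_mx 0 (lshift N e)) c; rewrite lsubmx_delta dotp_delta.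
  - rewrite block_mxEur (_ : (fun z => _) = fun z => h (lsubmx z) 0 c); last first.
      by apply/funext => z; rewrite /ct_lift row_mxEl.
    by have [_ ->] := dl (delta_mx 0 (rshift N e)) c; rewrite lsubmx_delta_r dotp0 mxE.
  - rewrite block_mxEdl (_ : (fun z => _) = fun z => (rsubmx z *m jacobian_mx k (h (lsubmx z))) 0 c); last first.
      by apply/funext => z; rewrite /ct_lift row_mxEr.
    have [_ ->] := dr (delta_mx 0 (lshift N e)) c.
    rewrite lsubmx_delta rsubmx_delta_l mxE.
    under [RHS]eq_bigr do rewrite mxE mulr_suml.
    rewrite exchange_big /=; apply: eq_bigr => b _.
    rewrite (_ : (\row_e0 dotp _ _) = \row_j P j e); last first.
      by apply/rowP => j; rewrite [LHS]mxE [RHS]mxE dotp_delta.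
    rewrite [X in _ + _ * X]mxE mulr0 addr0 /dotp mulr_sumr; apply: eq_bigr => j _.
    by rewrite [(\row_j P j e) 0 j]mxE; ring.
  - rewrite block_mxEdr (_ : (fun z => _) = fun z => (rsubmx z *m jacobian_mx k (h (lsubmx z))) 0 c); last first.
      by apply/funext => z; rewrite /ct_lift row_mxEr.
    have [_ ->] := dr (delta_mx 0 (rshift N e)) c.
    rewrite lsubmx_delta_r rsubmx_delta (_ : K^T c e = K e c); last by rewrite mxE.
    rewrite (bigD1 e) //= big1 ?addr0 => [|b be].
      rewrite (_ : (\row_e0 dotp _ _) = 0) ?dotp0 ?mulr0 ?add0r; last first.
        by apply/rowP => j; rewrite [LHS]mxE dotp0 [RHS]mxE.
      by rewrite [X in _ * X]mxE !eqxx mulr1.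
    rewrite (_ : (\row_e0 dotp _ _) = 0) ?dotp0 ?mulr0 ?add0r; last first.
      by apply/rowP => j; rewrite [LHS]mxE dotp0 [RHS]mxE.
    by rewrite [X in _ * X]mxE (negbTE be) mulr0.
rewrite JE /Omega mulmx_block tr_block_mx mulmx_block !trmx0 trmxK.
rewrite !(mulmx0, mul0mx, mulmx1, mulmxN, add0r, addr0) !mulNmx PK.
congr block_mx; first by rewrite -trmx_mul PK trmx1.
rewrite -mulmxA PK mulmx1 trmx_mul S_sym mulmxA -trmx_mul PK trmx1 mul1mx.
by rewrite subrr.
Qed.

End Symplectic.

(** * Canonical coordinates *)

Section CotangentCharts.
Context {R : realType} {m : nat} {M : bmanifold R m}.
Notation n := m.+1.
Notation cm i q := (@ccoord R _ _ (bm_charts M) i q).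
Notation cz i z := (@ccoord R _ _ (ct_charts M) i z).
Implicit Types (i j : cidx (ct_charts M)) (z w : cotangent M).

Lemma lsubmx_cz i z : lsubmx (cz i z) = ccoord (c := bm_charts M) i (ct_base z).
Proof. exact: row_mxKl. Qed.

Lemma rsubmx_cz i z : rsubmx (cz i z) = ct_comp z i.
Proof. exact: row_mxKr. Qed.

Lemma cz_half i z : cdom i z -> 0 <= cz i z 0 (lshift n ord0).
Proof. by move=> iz; rewrite row_mxEl; exact: chart_half. Qed.

Lemma cz_inj i z w : cdom i z -> cdom i w -> cz i z = cz i w -> z = w.
Proof.
move=> iz iw /eq_row_mx[bb cc].
by apply: (@ct_eq _ _ _ i) => //; exact: (bm_coord_inj iz iw bb).
Qed.

Lemma near_cz i z (A : set M) : open A -> A (ct_base z) -> cdom i z ->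
  \forall y \near cz i z, forall w, cdom i w -> cz i w = y -> A (ct_base w).
Proof.
move=> oA Az iz; have H := near_coord oA Az iz; rewrite -lsubmx_cz in H.
have H2 : nbhs (cz i z) (fun y => forall q, cdom (c := bm_charts M) i q -> cm i q = lsubmx y -> A q) :=
  @lsubmx_continuous R n n _ _ H.
by apply: filterS H2 => y yP w iw wy; apply: (yP _ iw); rewrite -wy lsubmx_cz.
Qed.

(** The set of nonzero covectors is open, so that near one of them its image in
canonical coordinates fills a neighbourhood in the half-space. *)
Lemma near_cz_exists i z : cdom i z -> nonzero z ->
  nbhs (cz i z) [set y : 'rV[R]_(n + n) | 0 <= y 0 (lshift n ord0) ->
     exists w, [/\ cdom i w, nonzero w & cz i w = y]].
Proof.
move=> iz nz; have H := near_coord_exists iz; rewrite -lsubmx_cz in H.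
have H2 : nbhs (cz i z) (fun y => 0 <= lsubmx y 0 ord0 -> exists2 q, cdom (c := bm_charts M) i q & cm i q = lsubmx y) :=
  @lsubmx_continuous R n n _ _ H.
have H3 : nbhs (cz i z) [set y : 'rV[R]_(n + n) | rsubmx y != 0].
  have : open [set v : 'rV[R]_n | v != 0].
    rewrite (_ : [set v | _] = ~` [set 0]); last by apply/seteqP; split=> v /= /eqP.
    apply: closed_openC; apply: accessible_closed_set1.
    by apply: hausdorff_accessible; exact: norm_hausdorff.
  move=> o0; have := open_comp (fun y _ => @rsubmx_continuous R n n y) o0.
  move=> o1; apply: open_nbhs_nbhs; split; first exact: o1.
  by rewrite /= rsubmx_cz; apply/(nonzeroP iz).
apply: filterS2 H2 H3 => y yP ry y0.
have [|q iq qy] := yP; first by rewrite mxE.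
have [w [wq wr]] := ct_exists (rsubmx y) iq.
have iw : cdom i w by rewrite /= wq.
exists w; split=> //; first by apply/(nonzeroP iw); rewrite wr.
by rewrite /= wq wr qy hsubmxK.
Qed.

Lemma local_rep_pd_unique i (H : cotangent M -> R) z g g' l : nonzero z -> cdom i z ->
  local_rep (X := ct_charts M) i (@nonzero R m M) H z g ->
  local_rep (X := ct_charts M) i (@nonzero R m M) H z g' ->
  pd l g (cz i z) = pd l g' (cz i z).
Proof.
move=> nz iz gr gr'; apply: (@pd_half_eq R _ g g' _ (lshift n ord0) l).
- exact: C1at_derivable (local_rep_C1 gr).
- exact: C1at_derivable (local_rep_C1 gr').
- exact: cz_half.
have N1 := near_cz_exists iz nz; have N2 := local_rep_near gr; have N3 := local_rep_near gr'.
apply: filterS3 N1 N2 N3 => y y1 y2 y3 y0; have [w [iw nw wy]] := y1 y0.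
by rewrite -(y2 w) // -(y3 w).
Qed.

(** The local extension of H past the boundary is not unique, its first
derivatives at a point of the manifold are. *)
Lemma gradient_unique i (H : cotangent M -> R) z d d' : nonzero z ->
  is_gradient (X := ct_charts M) i (@nonzero R m M) H z d ->
  is_gradient (X := ct_charts M) i (@nonzero R m M) H z d' -> d = d'.
Proof.
move=> nz [iz [g gr ->]] [_ [g' gr' ->]]; apply/rowP => l; rewrite !mxE.
exact: local_rep_pd_unique gr gr'.
Qed.

Definition ct_trans i j z (B : set 'rV[R]_(n + n)) (T : 'rV[R]_(n + n) -> 'rV[R]_(n + n)) :=
  [/\ open B, B (cz i z), (forall a, Cinf B (fun y => T y 0 a)) &
    forall w, cdom i w -> cdom j w -> B (cz i w) -> cz j w = T (cz i w)].

Lemma ct_trans_exists i j z : cdom i z -> cdom j z -> exists B T, ct_trans i j z B T /\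
  jacobian_mx T (cz i z) *m Omega n *m (jacobian_mx T (cz i z))^T = Omega n.
Proof.
move=> iz jz.
have [B [h hT]] := trans_map_exists iz jz; have [C [k kT]] := trans_map_exists jz iz.
have [oB Bz hC hE] := hT; have [oC Cz kC kE] := kT.
have hz : h (ccoord (c := bm_charts M) i (ct_base z)) = ccoord (c := bm_charts M) j (ct_base z) by rewrite -hE.
pose B0 := B `&` [set x | C (h x)].
have oB0 : open B0.
  rewrite openE => x [Bx Cx]; rewrite /interior; apply: filterI; first exact: open_nbhs_nbhs.
  have hc : {for x, continuous h}.
    by apply: (@cvg_mx R n _ (nbhs x) _ _ _).1 => a; exact: (Ck_continuous (hC a 0%N) Bx).
  by apply: hc; exact: open_nbhs_nbhs.
have hC0 a : Cinf B0 (fun x => h x 0 a) by move=> c; apply: Ck_sub (hC a c) => x [].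
have B0z : B0 (ccoord (c := bm_charts M) i (ct_base z)) by split=> //=; rewrite hz.
exists [set y | B0 (lsubmx y)], (ct_lift h k); split.
  split.
  - exact: open_lsubmx.
  - by rewrite /= lsubmx_cz.
  - by apply: ct_lift_smooth oB0 oC hC0 kC _ => x [].
  - move=> w iw jw [/=]; rewrite lsubmx_cz => Bw Cw.
    have hw := hE _ jw iw Bw.
    rewrite /ct_lift lsubmx_cz rsubmx_cz -hw /=; congr row_mx.
    apply: (ct_law jw iw); apply: (trans_map_jacobian kT jw iw); by rewrite hw.
apply: (ct_lift_symplectic oB0 oC hC0 kC); rewrite lsubmx_cz ?hz //.
have J1 := trans_map_jacobian hT iz jz Bz; have J2 := trans_map_jacobian kT jz iz Cz.
exact: (jacobian_inv jz iz J2 J1).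
Qed.

Lemma ct_trans_continuous i j z B T y : ct_trans i j z B T -> B y -> {for y, continuous T}.
Proof.
move=> [oB _ TC _] By.
by apply: (@cvg_mx R _ _ (nbhs y) _ _ _).1 => a; exact: (Ck_continuous (TC a 0%N) By).
Qed.

Lemma local_rep_trans i j z (A : set (cotangent M)) f g B T : cdom i z -> cdom j z ->
  ct_trans j i z B T -> local_rep (X := ct_charts M) i A f z g ->
  local_rep (X := ct_charts M) j A f z (g \o T).
Proof.
move=> iz jz hT [C [oC Cz gC fg]]; have [oB Bz TC TE] := hT.
have N : nbhs (cz j z) (B `&` [set y | C (T y)] `&` [set y | forall w, cdom j w -> cz j w = y -> cdom i w]).
  apply: filterI; last exact: (near_cz (bm_dom_open i) iz jz).
  apply: filterI; first exact: open_nbhs_nbhs.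
  by apply: (ct_trans_continuous hT Bz); apply: open_nbhs_nbhs; split=> //; rewrite -TE.
move: N; rewrite nbhsE => -[D [oD Dz] DP].
exists D; split=> // [k|w Aw jw Dw].
  apply: (@Ck_comp R _ _ k D C g T oD oC) => // [y /DP[[]]//|a].
  by apply: Ck_sub (TC a k) => y /DP[[]].
have [[Bw Cw] iw'] := DP _ Dw; have iw := iw' w jw erefl.
by rewrite /= -TE // fg // TE.
Qed.

Lemma gradient_comp N N' (g : 'rV[R]_N' -> R) (T : 'rV[R]_N -> 'rV[R]_N') y :
  C1at g (T y) -> (forall a, C1at (fun x => T x 0 a) y) ->
  gradient (g \o T) y = gradient g (T y) *m jacobian_mx T y.
Proof.
move=> gC TC; apply/rowP => l; rewrite !mxE.
have := @is_derive_chain R _ N' g T y (delta_mx 0 l) (\row_a pd l (fun x => T x 0 a) y) gC.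
case=> [a|_ ->]; first by rewrite mxE; exact: derivableP (C1at_derivable (TC a)).
by rewrite /dotp; apply: eq_bigr => a _; rewrite !mxE mulrC.
Qed.

Lemma ct_trans_C1 i j z B T : ct_trans i j z B T -> forall a, C1at (fun x => T x 0 a) (cz i z).
Proof. by move=> [oB Bz TC _] a; exact: (C1at_Ck oB Bz (TC a 1%N)). Qed.

(** The Hamilton field is well defined: gradients are transformed by the transpose
inverse of the matrix that transforms vectors, and the symplectic identity
exchanges the two. *)
Lemma hamvec_trans i j z (H : cotangent M -> R) d d' B T : cdom i z -> cdom j z -> nonzero z ->
  ct_trans i j z B T -> jacobian_mx T (cz i z) *m Omega n *m (jacobian_mx T (cz i z))^T = Omega n ->
  is_gradient (X := ct_charts M) i (@nonzero R m M) H z d ->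
  is_gradient (X := ct_charts M) j (@nonzero R m M) H z d' ->
  hamvec d' = hamvec d *m (jacobian_mx T (cz i z))^T.
Proof.
move=> iz jz nz hT sT Hd [_ [g gr ->]].
have [oB Bz TC TE] := hT.
have Hd' : is_gradient (X := ct_charts M) i (@nonzero R m M) H z (gradient (g \o T) (cz i z)).
  by split=> //; exists (g \o T) => //; exact: local_rep_trans hT gr.
rewrite (gradient_unique nz Hd Hd') gradient_comp ?TE //; last exact: ct_trans_C1 hT.
  by rewrite !hamvecE -{1}sT !mulmxA.
by rewrite -TE //; exact: local_rep_C1 gr.
Qed.

(** Smoothness asks for some chart at each point; by the change of coordinates any
chart will do. *)
Lemma local_rep_all i (A : set (cotangent M)) f z : A z -> cdom i z ->
  smooth_on (ct_charts M) A f -> exists g, local_rep (X := ct_charts M) i A f z g.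
Proof.
move=> Az iz /(_ _ Az)[j [jz [g gr]]].
have [B [T [hT _]]] := ct_trans_exists iz jz.
by exists (g \o T); exact: local_rep_trans hT gr.
Qed.

Lemma bcotangent_eq (w w' : bcotangent M) : bc_base w = bc_base w' -> bc_comp w = bc_comp w' -> w = w'.
Proof.
case: w w' => b c p1 p2 p3 [b' c' q1 q2 q3] /= bb cc; subst b' c'.
by congr BCotangent; exact: Prop_irrelevance.
Qed.

Lemma restriction_unique z (w w' : bcotangent M) : is_restriction z w -> is_restriction z w' -> w = w'.
Proof.
move=> [b c] [b' c']; apply: bcotangent_eq; first by rewrite -b -b'.
by apply/funext => i; rewrite c c'.
Qed.

Lemma dilate1 z : dilate 1 z = z.
Proof.
have [i iz] := bm_cover (ct_base z).
by apply: (@ct_eq _ _ _ i) => //=; rewrite scale1r.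
Qed.

Lemma local_rep_any i j z (A : set (cotangent M)) f g : cdom i z -> cdom j z ->
  local_rep (X := ct_charts M) i A f z g -> exists g', local_rep (X := ct_charts M) j A f z g'.
Proof.
move=> iz jz gr; have [B [T [hT _]]] := ct_trans_exists jz iz.
by exists (g \o T); exact: local_rep_trans hT gr.
Qed.

Lemma rho_continuous (rho : M -> R) : smooth_on (bm_charts M) setT rho -> continuous rho.
Proof.
move=> rC p; have [i [ip [g gr]]] := rC p I.
have cc : {for p, continuous (ccoord (c := bm_charts M) i)} := bm_coord_continuous ip.
have N1 : \forall q \near p, cdom (c := bm_charts M) i q by apply: open_nbhs_nbhs; split=> //; exact: bm_dom_open.
have N2 : \forall q \near p, forall w : M, setT w -> cdom (c := bm_charts M) i w -> cm i w = cm i q -> rho w = g (cm i q) :=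
  cc _ (local_rep_near gr).
have gc : g (cm i q) @[q --> p] --> g (cm i p) := cvg_comp _ _ cc (local_rep_continuous gr).
rewrite /continuous_at (local_rep_self gr) //; apply: cvg_trans gc; apply: near_eq_cvg.
by apply: filterS2 N1 N2 => q iq Hq; rewrite (Hq q).
Qed.

End CotangentCharts.

(** * Integral curves read in charts *)

Section RealCurves.
Context {R : realType}.

(** Connectedness of [[a, b]] for properties that are propagated to the right
across a neighbourhood of each point: one considers the supremum of the points
reached. *)
Lemma interval_propagation (E : R -> Prop) a b : a <= b -> E a ->
  (forall t, a <= t <= b -> exists2 e, 0 < e & forall r r', a <= r -> r <= r' -> r' <= b ->
     t - e < r -> r' < t + e -> E r -> E r') -> E b.
Proof.
move=> ab Ea H; pose S := [set x | a <= x <= b /\ E x].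
have Sa : S a by split=> //; rewrite lexx ab.
have Sub : ubound S b by move=> x [/andP[]].
have hs : has_sup S by split; [exists a|exists b].
pose t := sup S.
have at_ : a <= t by apply: sup_upper_bound.
have tb : t <= b by apply: ge_sup => //; exists a.
have [|e e0 He] := H t; first by rewrite at_ tb.
have [r [/andP[ar rb] Er] tr] := sup_adherent e0 hs.
have rt : r <= t by apply: sup_upper_bound => //; split=> //; rewrite ar rb.
case: (ltP b (t + e)) => bt; first exact: (He r b ar rb (lexx _) tr bt Er).
have t2 : r <= t + e / 2 by rewrite (le_trans rt) // lerDl divr_ge0 // ltW.
have t2b : t + e / 2 <= b.
  by rewrite (le_trans _ bt) // lerD2l ler_pdivrMr // ler_peMr ?(ltW e0) // ler1n.
have t2e : t + e / 2 < t + e by rewrite ltrD2l ltr_pdivrMr // ltr_pMr // ltr1n.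
have : t + e / 2 <= t.
  apply: sup_upper_bound => //; split; last exact: (He r _ ar t2 t2b tr t2e Er).
  by rewrite t2b (le_trans ar t2).
by rewrite gerDl leNgt divr_gt0.
Qed.

Lemma near_within_dist (P : R -> Prop) a b t : (\forall s \near within `[a, b] (nbhs t), P s) ->
  exists2 e, 0 < e & forall s, a <= s <= b -> `|s - t| < e -> P s.
Proof.
move=> /nbhs_ballP[e /= e0 H]; exists e => // s sab st; apply: H.
  by rewrite -ball_normE /= distrC.
by rewrite /= in_itv.
Qed.

Lemma near_within_dnbhs (P : R -> Prop) (A : set R) t : (\forall s \near within A (nbhs t), P s) ->
  \forall s \near within A t^', P s.
Proof. by move=> H; apply: (@nbhs_dnbhs _ t (fun s => A s -> P s) H). Qed.

Lemma quotient_cvg N (c : R -> 'rV[R]_N) (A : set R) t (v : 'rV[R]_N) :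
  (s - t)^-1 *: (c s - c t) @[s --> within A t^'] --> v ->
  c s @[s --> within A (nbhs t)] --> c t.
Proof.
move=> q; apply/cvgrPdist_le => e e0.
pose B := `|v| + 1; have B0 : 0 < B by rewrite ltr_wpDl.
have H1 : \forall s \near within A t^', `|v - (s - t)^-1 *: (c s - c t)| <= 1.
  by move/cvgrPdist_le : q; apply.
have {}H1 : \forall s \near t, s != t -> A s -> `|v - (s - t)^-1 *: (c s - c t)| <= 1 := H1.
suff : \forall s \near t, A s -> `|c t - c s| <= e by [].
near=> s => As.
case: (eqVneq s t) => [->|st]; first by rewrite subrr normr0 ltW.
have H2 : `|v - (s - t)^-1 *: (c s - c t)| <= 1 by apply: (near H1 s).
have H3 : `|(s - t)^-1 *: (c s - c t)| <= B.
  rewrite /B -lerBlDl (le_trans (lerB_dist _ _)) // distrC //.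
have st0 : s - t != 0 by rewrite subr_eq0.
have -> : c t - c s = (t - s) *: ((s - t)^-1 *: (c s - c t)).
  by rewrite -[t - s]opprB scaleNr scalerA mulfV // scale1r opprB.
rewrite normrZ; apply: (@le_trans _ _ (e / B * B)); last by rewrite divfK // gt_eqF.
apply: ler_pM => //; near: s.
by move: (@cvg_id R (nbhs t)) => /cvgrPdist_le; apply; rewrite divr_gt0.
Unshelve. all: by end_near. Qed.

Lemma within_is_derive (phi : R -> R) a b t v : a < t < b ->
  (s - t)^-1 * (phi s - phi t) @[s --> within `[a, b] t^'] --> v -> is_derive t (1 : R) phi v.
Proof.
move=> /andP[a_t tb] q; apply/is_deriveP; apply/cvgrPdist_le => e e0.
have /nbhs_ballP[d /= d0 dP] : \forall s \near t, s != t -> s \in `[a, b] -> `|v - (s - t)^-1 * (phi s - phi t)| <= e.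
  by move/cvgrPdist_le : q => /(_ e e0).
have [d1 /= d10 d1P] : \forall s \near t, s \in `[a, b].
  near=> s; rewrite in_itv /=; apply/andP; split; apply: ltW; near: s; [exact: lt_nbhsr|exact: lt_nbhsl].
near=> h.
have h0 : h != 0 by near: h; exact: nbhs_dnbhs_neq.
have hd : `|h| < d by near: h; apply: dnbhs0_lt.
have hd1 : `|h| < d1 by near: h; apply: dnbhs0_lt.
have -> : h *: 1 + t = t + h by rewrite [h *: 1]mulr1 addrC.
have := dP (t + h); rewrite [t + h - t]addrAC subrr add0r; apply.
- by rewrite -ball_normE /= opprD addrA subrr sub0r normrN.
- by rewrite -subr_eq0 addrAC subrr add0r.
- by apply: d1P; rewrite /ball_ /= opprD addrA subrr sub0r normrN.
Unshelve. all: by end_near. Qed.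

(** Rescales the part of a curve between [r0] and [r1] to the unit interval;
[r1 < r0] is allowed and runs it backwards. *)
Lemma affine_curve (phi v : R -> R) a b r0 r1 : continuous phi ->
  (forall t : R, a < t < b -> is_derive t (1 : R) phi (v t)) ->
  a <= r0 <= b -> a <= r1 <= b ->
  let psi := fun tau => phi (r0 + clamp 0 1 tau * (r1 - r0)) in
  continuous psi /\ forall tau : R, 0 < tau < 1 ->
    is_derive tau (1 : R) psi ((r1 - r0) * v (r0 + tau * (r1 - r0))).
Proof.
move=> cphi dphi r0ab r1ab psi; split.
  move=> tau; apply: (@continuous_comp _ _ _ (fun tau => r0 + clamp 0 1 tau * (r1 - r0)) phi); last exact: cphi.
  exact: (cvgD (cvg_cst _) (cvgM (@clamp_continuous R 0 1 tau) (cvg_cst _))).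
move=> tau tau01; case: (eqVneq r0 r1) => [r01|r01].
  rewrite r01 subrr mul0r (_ : psi = cst (phi r1)); first exact: is_derive_cst.
  by apply/funext => s; rewrite /psi r01 subrr mulr0 addr0.
have tab : a < r0 + tau * (r1 - r0) < b.
  move: tau01 r0ab r1ab => /andP[t0 t1] /andP[ar0 r0b] /andP[ar1 r1b].
  by move: r01; rewrite neq_lt => /orP[] r01; apply/andP; split; nra.
apply: (@near_eq_is_derive _ _ _ (phi \o (fun tau => r0 + tau * (r1 - r0)))).
  by near=> s; rewrite /psi /= (near (clamp_near tau01)).
rewrite mulrC; apply: is_derive1_comp; first exact: dphi.
have H := @is_derive_linear R R R (fun s => s * (r1 - r0)) tau 1.
have := is_deriveD (@is_derive_cst R R R r0 tau 1) (H _).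
rewrite mul1r add0r; apply.
by move=> x y z; rewrite /GRing.scale /=; ring.
Unshelve. all: by end_near. Qed.

Lemma within_dnbhs_proper a b t : a < b -> a <= t <= b ->
  ProperFilter (within `[a, b] t^' : set_system R).
Proof.
move=> ab /andP[at_ tb]; have FF : Filter (within `[a, b] t^') by exact: within_filter.
apply: Build_ProperFilter_ex FF.
move=> P HP; have {}HP : \forall s \near t, s != t -> s \in `[a, b] -> P s := HP.
have /nbhs_ballP[e /= e0 H] := HP.
case: (ltP a t) => at'.
  pose s := t - Num.min (e / 2) (t - a).
  have m0 : 0 < Num.min (e / 2) (t - a) by rewrite lt_min divr_gt0 // subr_gt0.
  have m1 : Num.min (e / 2) (t - a) <= e / 2 by rewrite ge_min lexx.
  have m2 : Num.min (e / 2) (t - a) <= t - a by rewrite ge_min lexx orbT.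
  exists s; apply: H; rewrite /s.
  - by rewrite -ball_normE /= opprB addrC subrK gtr0_norm //; lra.
  - by rewrite lt_eqF //; lra.
  - by rewrite in_itv /=; apply/andP; split; lra.
have ta : t = a by apply: le_anti; rewrite at_ at'.
pose s := t + Num.min (e / 2) (b - t).
have m0 : 0 < Num.min (e / 2) (b - t) by rewrite lt_min divr_gt0 // subr_gt0 ta.
have m1 : Num.min (e / 2) (b - t) <= e / 2 by rewrite ge_min lexx.
have m2 : Num.min (e / 2) (b - t) <= b - t by rewrite ge_min lexx orbT.
exists s; apply: H; rewrite /s.
- by rewrite -ball_normE /= opprD addrA subrr sub0r normrN gtr0_norm //; lra.
- by rewrite gt_eqF //; lra.
- by rewrite in_itv /=; apply/andP; split; lra.
Qed.

Lemma is_derive_within (F : R -> R) (A : set R) t v : is_derive t (1 : R) F v ->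
  (s - t)^-1 * (F s - F t) @[s --> within A t^'] --> v.
Proof.
move=> /is_deriveP q; apply/cvgrPdist_le => e e0.
have {}q : \forall h \near 0^', `|v - h^-1 *: (F (h *: 1 + t) - F t)| <= e.
  by move/cvgrPdist_le : q => /(_ e e0).
have /nbhs_ballP[d /= d0 dP] := q.
suff : \forall s \near t, s != t -> A s -> `|v - (s - t)^-1 * (F s - F t)| <= e by [].
near=> s => st _.
have h0 : s - t != 0 by rewrite subr_eq0.
have := dP (s - t); rewrite [(s - t) *: 1]mulr1 subrK; apply => //.
rewrite -ball_normE /= sub0r normrN distrC.
by near: s; move: (@cvg_id R (nbhs t)) => /cvgrPdist_lt; apply.
Unshelve. all: by end_near. Qed.

End RealCurves.

Section Curves.
Context {R : realType} {m : nat} {M : bmanifold R m}.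
Notation n := m.+1.
Notation cm i q := (@ccoord R _ _ (bm_charts M) i q).
Notation cz i z := (@ccoord R _ _ (ct_charts M) i z).
Implicit Types (i j : cidx (ct_charts M)) (z w : cotangent M) (H : cotangent M -> R).
Implicit Types (gamma : R -> cotangent M).

(** [local_rep] with its neighbourhood made explicit, so that one neighbourhood and
one smooth expression serve for all points of a curve. *)
Definition rep_on i (A : set (cotangent M)) (f : cotangent M -> R) (B : set 'rV[R]_(n + n)) (g : 'rV[R]_(n + n) -> R) :=
  [/\ open B, Cinf B g & forall w, A w -> cdom i w -> B (cz i w) -> f w = g (cz i w)].

Lemma rep_on_local_rep i A f B g z : rep_on i A f B g -> B (cz i z) -> local_rep (X := ct_charts M) i A f z g.
Proof. by move=> [oB gC fg] Bz; exists B. Qed.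

Lemma local_rep_on i A f g z : local_rep (X := ct_charts M) i A f z g ->
  exists2 B, rep_on i A f B g & B (cz i z).
Proof. by move=> [B [oB Bz gC fg]]; exists B. Qed.

Definition hamfield (g : 'rV[R]_(n + n) -> R) y := hamvec (gradient g y).

Lemma hamfield_smooth (B : set 'rV[R]_(n + n)) g : open B -> Cinf B g ->
  forall a, Cinf B (fun y => hamfield g y 0 a).
Proof.
move=> oB gC a k; case: (split_ordP a) => b ->.
  apply: (@Ck_eq _ _ _ _ (pd (rshift n b) g)) => //; last exact: CkS_pd (gC k.+1).
  by move=> y _; rewrite /hamfield /hamvec row_mxEl !mxE.
apply: (@Ck_eq _ _ _ _ (fun y => - pd (lshift n b) g y)) => //.
  by move=> y _; rewrite /hamfield /hamvec row_mxEr !mxE.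
by apply: Ck_opp => //; exact: CkS_pd (gC k.+1).
Qed.

Lemma ic_sub H a b a' b' gamma : a <= a' -> b' <= b -> integral_curve H a b gamma ->
  integral_curve H a' b' gamma.
Proof.
move=> aa bb ic t /andP[a't tb']; have [|nz [i [d [Hd ni q]]]] := ic t.
  by rewrite (le_trans aa) // (le_trans tb').
have sub (F : set_system R) : Filter F -> within `[a', b'] F `=>` within `[a, b] F.
  move=> FF A; rewrite /within /=; apply: filterS => s As.
  rewrite in_itv /= => /andP[s1 s2]; apply: As.
  by rewrite in_itv /= (le_trans aa) // (le_trans s2).
split=> //; exists i, d; split=> //.
- by move: ni; apply: sub.
- by apply: cvg_trans q; apply: cvg_app; exact: sub.
Qed.

(** The definition of an integral curve provides some chart at each time.  The
Hamilton equations hold in every chart, by the chain rule for [T] and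
[hamvec_trans]. *)
Lemma ic_chart H a b gamma t j : integral_curve H a b gamma -> a <= t <= b -> cdom j (gamma t) ->
  exists d, [/\ is_gradient (X := ct_charts M) j (@nonzero R m M) H (gamma t) d,
    \forall s \near within `[a, b] (nbhs t), cdom j (gamma s) &
    (s - t)^-1 *: (cz j (gamma s) - cz j (gamma t)) @[s --> within `[a, b] t^'] --> hamvec d].
Proof.
move=> ic tab jt; have [nz [i [d [Hd ni q]]]] := ic t tab.
have [it [g gr dE]] := Hd.
have ci := quotient_cvg q.
have N1 : \forall s \near within `[a, b] (nbhs t), forall w, cdom i w -> cz i w = cz i (gamma s) -> cdom j w :=
  ci _ (near_cz (bm_dom_open j) jt it).
have nj : \forall s \near within `[a, b] (nbhs t), cdom j (gamma s).
  by apply: filterS2 ni N1 => s is_ /(_ _ is_ erefl).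
have [B [T [hT sT]]] := ct_trans_exists it jt.
have [B' [T' [hT' _]]] := ct_trans_exists jt it.
have gr' := local_rep_trans it jt hT' gr.
exists (gradient (g \o T') (cz j (gamma t))).
have Hd' : is_gradient (X := ct_charts M) j (@nonzero R m M) H (gamma t) (gradient (g \o T') (cz j (gamma t))).
  by split=> //; exists (g \o T').
split=> //.
rewrite (hamvec_trans it jt nz hT sT Hd Hd').
have [oB Bz TC TE] := hT.
have N2 : \forall s \near within `[a, b] (nbhs t), B (cz i (gamma s)).
  by apply: ci; exact: open_nbhs_nbhs.
apply/cvg_mx => c.
have C1 := ct_trans_C1 hT c.
have ci' : cz i (gamma s) @[s --> within `[a, b] t^'] --> cz i (gamma t).
  by move=> P /ci /near_within_dnbhs.
have FF : Filter (within `[a, b] t^') by exact: within_filter.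
have := @chain_cvg R _ (fun y => T y 0 c) _ R (within `[a, b] t^') FF (fun s => s - t) (fun s => cz i (gamma s)) (hamvec d) C1 ci' q.
rewrite (_ : dotp _ _ = (hamvec d *m (jacobian_mx T (cz i (gamma t)))^T) 0 c); last first.
  by rewrite mxE /dotp; apply: eq_bigr => l _; rewrite !mxE.
apply: cvg_trans; apply: near_eq_cvg; near=> s.
have is_ : cdom i (gamma s) by near: s; exact: near_within_dnbhs.
have js : cdom j (gamma s) by near: s; exact: near_within_dnbhs.
have Bs : B (cz i (gamma s)) by near: s; exact: near_within_dnbhs.
rewrite -(TE _ is_ js Bs) -(TE _ it jt Bz); move: (cz j (gamma s)) (cz j (gamma t)) => u v.
by rewrite !mxE.
Unshelve. all: by end_near. Qed.

Lemma ic_chart_d H a b gamma t j d : integral_curve H a b gamma -> a <= t <= b ->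
  is_gradient (X := ct_charts M) j (@nonzero R m M) H (gamma t) d ->
  (s - t)^-1 *: (cz j (gamma s) - cz j (gamma t)) @[s --> within `[a, b] t^'] --> hamvec d.
Proof.
move=> ic tab Hd; have jt := Hd.1; have [d' [Hd' _ q]] := ic_chart ic tab jt.
by have [nz _] := ic t tab; rewrite (gradient_unique nz Hd Hd').
Qed.

Lemma ic_chart_cvg H a b gamma t j : integral_curve H a b gamma -> a <= t <= b -> cdom j (gamma t) ->
  cz j (gamma s) @[s --> within `[a, b] (nbhs t)] --> cz j (gamma t).
Proof. by move=> ic tab jt; have [d [_ _ /quotient_cvg]] := ic_chart ic tab jt. Qed.

Lemma ic_near_base H a b gamma t (A : set M) : integral_curve H a b gamma -> a <= t <= b ->
  open A -> A (ct_base (gamma t)) -> \forall s \near within `[a, b] (nbhs t), A (ct_base (gamma s)).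
Proof.
move=> ic tab oA At; have [nz [j [_ [[jt _] _ _]]]] := ic t tab.
have [_ [_ nj _]] := ic_chart ic tab jt.
have N1 : \forall s \near within `[a, b] (nbhs t), forall w, cdom j w -> cz j w = cz j (gamma s) -> A (ct_base w) :=
  ic_chart_cvg ic tab jt (near_cz oA At jt).
by apply: filterS2 nj N1 => s js /(_ _ js erefl).
Qed.

Lemma ic_fun H a b gamma t j (A : set (cotangent M)) f g d : integral_curve H a b gamma -> a <= t <= b ->
  (forall s, a <= s <= b -> A (gamma s)) ->
  is_gradient (X := ct_charts M) j (@nonzero R m M) H (gamma t) d ->
  local_rep (X := ct_charts M) j A f (gamma t) g ->
  (s - t)^-1 * (f (gamma s) - f (gamma t)) @[s --> within `[a, b] t^'] -->
    (hamvec d *m (gradient g (cz j (gamma t)))^T) 0 0.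
Proof.
move=> ic tab Ag Hd gr; have jt := Hd.1.
have q := ic_chart_d ic tab Hd; have [_ [_ nj _]] := ic_chart ic tab jt.
have c := ic_chart_cvg ic tab jt.
have c' : cz j (gamma s) @[s --> within `[a, b] t^'] --> cz j (gamma t).
  by move=> P /c /near_within_dnbhs.
have FF : Filter (within `[a, b] t^') by exact: within_filter.
have := @chain_cvg R _ g _ R (within `[a, b] t^') FF (fun s => s - t) (fun s => cz j (gamma s)) (hamvec d) (local_rep_C1 gr) c' q.
rewrite (_ : dotp _ _ = (hamvec d *m (gradient g (cz j (gamma t)))^T) 0 0); last first.
  by rewrite mxE /dotp; apply: eq_bigr => l _; rewrite !mxE.
have N2 : \forall s \near within `[a, b] (nbhs t), forall w, A w -> cdom j w -> cz j w = cz j (gamma s) -> f w = g (cz j (gamma s)) :=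
  c _ (local_rep_near gr).
apply: cvg_trans; apply: near_eq_cvg; near=> s.
have js : cdom j (gamma s) by near: s; exact: near_within_dnbhs.
have sab : a <= s <= b.
  suff : [set` `[a, b]] s by rewrite /= in_itv.
  by near: s; exact: withinT.
have fs : forall w, A w -> cdom j w -> cz j w = cz j (gamma s) -> f w = g (cz j (gamma s)).
  by near: s; exact: near_within_dnbhs.
by rewrite (fs (gamma s) (Ag _ sab) js erefl) -(local_rep_self gr (Ag _ tab) jt).
Unshelve. all: by end_near. Qed.

Lemma ic_fun_cvg H a b gamma t (A : set (cotangent M)) f : integral_curve H a b gamma -> a <= t <= b ->
  (forall s, a <= s <= b -> A (gamma s)) -> smooth_on (ct_charts M) A f ->
  f (gamma s) @[s --> within `[a, b] (nbhs t)] --> f (gamma t).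
Proof.
move=> ic tab Ag fC; have [j [jt [g gr]]] := fC _ (Ag _ tab).
have [_ [_ nj _]] := ic_chart ic tab jt.
have c := ic_chart_cvg ic tab jt.
have N2 : \forall s \near within `[a, b] (nbhs t), forall w, A w -> cdom j w -> cz j w = cz j (gamma s) -> f w = g (cz j (gamma s)) :=
  c _ (local_rep_near gr).
have gc : g (cz j (gamma s)) @[s --> within `[a, b] (nbhs t)] --> g (cz j (gamma t)).
  exact: (cvg_comp _ _ c (local_rep_continuous gr)).
rewrite (local_rep_self gr (Ag _ tab) jt).
apply: cvg_trans gc; apply: near_eq_cvg; near=> s.
have fs : forall w, A w -> cdom j w -> cz j w = cz j (gamma s) -> f w = g (cz j (gamma s)).
  by near: s.
have sab : a <= s <= b.
  suff : [set` `[a, b]] s by rewrite /= in_itv.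
  by near: s; exact: withinT.
rewrite (fs (gamma s)) //; first exact: Ag.
by near: s.
Unshelve. all: by end_near. Qed.

(** In a chart, an integral curve becomes a solution of the Hamilton equations in
the form required by the results on differential equations; clamping extends it
to the whole line. *)
Lemma chart_curve H a b gamma i B g : a <= b -> integral_curve H a b gamma ->
  rep_on i (@nonzero R m M) H B g ->
  (forall s, a <= s <= b -> cdom i (gamma s) /\ B (cz i (gamma s))) ->
  (forall k, continuous (fun t => cz i (gamma (clamp a b t)) 0 k)) /\
  forall t, a < t < b -> forall k,
    is_derive t (1 : R) (fun s => cz i (gamma (clamp a b s)) 0 k) (hamfield g (cz i (gamma t)) 0 k).
Proof.
move=> ab ic gr iB; split=> [k|t tab k].
  apply: (@continuous_clamp R R (fun s => cz i (gamma s) 0 k) a b ab) => t tab.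
  have [it Bt] := iB _ tab.
  exact: ((@cvg_mx R _ R (within `[a, b] (nbhs t)) _ _ _).2 (ic_chart_cvg ic tab it) k).
have tab' : a <= t <= b by move/andP: tab => [? ?]; rewrite !ltW.
have [it Bt] := iB _ tab'.
have Hd : is_gradient (X := ct_charts M) i (@nonzero R m M) H (gamma t) (gradient g (cz i (gamma t))).
  by split=> //; exists g => //; exact: rep_on_local_rep gr Bt.
have q := ic_chart_d ic tab' Hd.
apply: (@near_eq_is_derive _ _ _ (fun s => cz i (gamma s) 0 k)).
  by near=> s; rewrite (near (clamp_near tab)).
apply: within_is_derive tab _.
have FF : Filter (within `[a, b] t^') by exact: within_filter.
have := (@cvg_mx R _ R (within `[a, b] t^') FF _ _).2 q k.
apply: cvg_trans; apply: near_eq_cvg; near=> s; by rewrite !mxE.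
Unshelve. all: by end_near. Qed.

End Curves.

(** * Uniqueness and confinement of integral curves *)

Section Propagation.
Context {R : realType}.

Lemma interval_propagation_left (E : R -> Prop) a b : a <= b -> E b ->
  (forall t, a <= t <= b -> exists2 e, 0 < e & forall r r', a <= r' -> r' <= r -> r <= b ->
     t - e < r' -> r < t + e -> E r -> E r') -> E a.
Proof.
move=> ab Eb H; have := @interval_propagation R (fun t => E (- t)) (- b) (- a).
rewrite opprK lerN2 opprK; apply=> // t /andP[bt ta].
have [|e e0 He] := H (- t); first by rewrite lerNr ta lerNl.
exists e => // r r' br rr ra tr rt; apply: He; rewrite ?lerN2 //.
- by rewrite lerNr.
- by rewrite lerNl.
- by rewrite -opprD ltrN2.
- by rewrite ltrNl opprD opprK.
Qed.

Lemma common_radius (e1 e2 : R) : 0 < e1 -> 0 < e2 -> exists2 e, 0 < e & e <= e1 /\ e <= e2.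
Proof. by move=> e10 e20; exists (Num.min e1 e2); [rewrite lt_min e10|rewrite !ge_min !lexx orbT]. Qed.

End Propagation.

Section Uniqueness.
Context {R : realType} {m : nat} {M : bmanifold R m}.
Notation n := m.+1.
Notation cm i q := (@ccoord R _ _ (bm_charts M) i q).
Notation cz i z := (@ccoord R _ _ (ct_charts M) i z).
Implicit Types (i j : cidx (ct_charts M)) (z w : cotangent M) (H : cotangent M -> R).
Implicit Types (gamma : R -> cotangent M).

Lemma ic_shift H a b h gamma : integral_curve H a b gamma ->
  integral_curve H (a - h) (b - h) (fun t => gamma (t + h)).
Proof.
move=> ic t /andP[at_ tb].
have [|nz [i [d [Hd ni q]]]] := ic (t + h); first by rewrite -lerBlDr at_ -lerBrDr.
have sub s : s \in `[a - h, b - h] -> s + h \in `[a, b].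
  by rewrite !in_itv /= lerBlDr lerBrDr.
have shift : (s + h) @[s --> t] --> t + h.
  exact: (cvgD cvg_id (cvg_cst _)).
have sh1 : (s + h) @[s --> within `[a - h, b - h] (nbhs t)] --> within `[a, b] (nbhs (t + h)).
  move=> P HP; have HQ : \forall s \near t, s + h \in `[a, b] -> P (s + h) := shift _ HP.
  suff : \forall s \near t, s \in `[a - h, b - h] -> P (s + h) by [].
  by apply: filterS HQ => s Ps /sub /Ps.
have sh2 : (s + h) @[s --> within `[a - h, b - h] t^'] --> within `[a, b] (t + h)^'.
  move=> P HP; have {}HP : \forall s \near t + h, s != t + h -> s \in `[a, b] -> P s := HP.
  have HQ : \forall s \near t, s + h != t + h -> s + h \in `[a, b] -> P (s + h) := shift _ HP.
  suff : \forall s \near t, s != t -> s \in `[a - h, b - h] -> P (s + h) by [].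
  by apply: filterS HQ => s Ps st /sub; apply: Ps; rewrite (inj_eq (addIr h)).
split=> //; exists i, d; split=> //; first exact: (sh1 _ ni).
have q' := cvg_comp _ _ sh2 q.
apply: cvg_trans q'; apply: near_eq_cvg; apply: nearW => s /=.
by rewrite opprD addrACA subrr addr0.
Qed.

Lemma ic_near_chart H a b gamma t i e : integral_curve H a b gamma -> a <= t <= b -> cdom i (gamma t) ->
  0 < e -> exists2 d, 0 < d & forall s, a <= s <= b -> `|s - t| < d ->
    cdom i (gamma s) /\ `|cz i (gamma s) - cz i (gamma t)| < e.
Proof.
move=> ic tab it e0; have [_ [_ nj _]] := ic_chart ic tab it.
have c := ic_chart_cvg ic tab it.
have N : \forall s \near within `[a, b] (nbhs t), `|cz i (gamma t) - cz i (gamma s)| < e.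
  by move/cvgrPdist_lt : c; apply.
have [d1 d10 P1] := near_within_dist nj; have [d2 d20 P2] := near_within_dist N.
have [d d0 [dd1 dd2]] := common_radius d10 d20; exists d => // s sab sd; split.
  exact: P1 sab (lt_le_trans sd dd1).
by rewrite distrC; apply: P2 sab (lt_le_trans sd dd2).
Qed.

Lemma rep_on_ball i z A f : A z -> cdom i z -> smooth_on (ct_charts M) A f ->
  exists B g, rep_on i A f B g /\ exists2 r, 0 < r & forall y, `|y - cz i z| <= r -> B y.
Proof.
move=> Az iz fC; have [g /local_rep_on[B gr Bz]] := local_rep_all Az iz fC.
exists B, g; split=> //; have [oB _ _] := gr.
have /nbhs_ballP[r /= r0 rP] : nbhs (cz i z) B by exact: open_nbhs_nbhs.
exists (r / 2); first by rewrite divr_gt0.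
move=> y yr; apply: rP; rewrite -ball_normE /= distrC (le_lt_trans yr) //.
by rewrite ltr_pdivrMr // ltr_pMr // ltr1n.
Qed.

Lemma chart_curves_agree H a b gamma gamma' i (B : set 'rV[R]_(n + n)) g c r L r0 r1 : a <= b ->
  integral_curve H a b gamma -> integral_curve H a b gamma' ->
  rep_on i (@nonzero R m M) H B g -> 0 <= L -> (forall y, `|y - c| <= r -> B y) ->
  (forall y y', `|y - c| <= r -> `|y' - c| <= r -> `|hamfield g y - hamfield g y'| <= L * `|y - y'|) ->
  (forall s, a <= s <= b -> cdom i (gamma s) /\ `|cz i (gamma s) - c| <= r) ->
  (forall s, a <= s <= b -> cdom i (gamma' s) /\ `|cz i (gamma' s) - c| <= r) ->
  a <= r0 <= b -> a <= r1 <= b -> gamma r0 = gamma' r0 -> gamma r1 = gamma' r1.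
Proof.
move=> ab ic ic' gr L0 rB LP Bg Bg' r0ab r1ab e0.
have Bs s : a <= s <= b -> cdom i (gamma s) /\ B (cz i (gamma s)) by move=> /Bg[? /rB].
have Bs' s : a <= s <= b -> cdom i (gamma' s) /\ B (cz i (gamma' s)) by move=> /Bg'[? /rB].
have [cg dg] := chart_curve ab ic gr Bs; have [cg' dg'] := chart_curve ab ic' gr Bs'.
pose u (tau : R) := cz i (gamma (clamp a b (r0 + clamp 0 1 tau * (r1 - r0)))).
pose u' (tau : R) := cz i (gamma' (clamp a b (r0 + clamp 0 1 tau * (r1 - r0)))).
pose v (tau : R) := (r1 - r0) *: hamfield g (cz i (gamma (r0 + tau * (r1 - r0)))).
pose v' (tau : R) := (r1 - r0) *: hamfield g (cz i (gamma' (r0 + tau * (r1 - r0)))).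
have itv (tau : R) : 0 <= tau <= 1 -> a <= r0 + tau * (r1 - r0) <= b.
  move: r0ab r1ab => /andP[? ?] /andP[? ?] /andP[? ?]; apply/andP; split; nra.
have c01 (tau : R) : 0 <= tau <= 1 -> clamp a b (r0 + clamp 0 1 tau * (r1 - r0)) = r0 + tau * (r1 - r0).
  by move=> t01; rewrite (clamp_id t01) clamp_id // itv.
have o01 (tau : R) : 0 < tau < 1 -> 0 <= tau <= 1 by move=> /andP[? ?]; rewrite !ltW.
suff uu (t : R) : 0 <= t <= 1 -> u t = u' t.
  have := uu 1; rewrite ler01 lexx /u /u' => /(_ isT).
  rewrite c01 ?ler01 ?lexx // mul1r addrC subrK => eq1.
  by apply: (cz_inj (Bg _ r1ab).1 (Bg' _ r1ab).1).
move: t; apply: (@curves_agree R _ u u' v v' (`|r1 - r0| * L)).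
- by rewrite mulr_ge0.
- by move=> k; have [] := affine_curve (cg k) (fun s sab => dg s sab k) r0ab r1ab.
- by move=> k; have [] := affine_curve (cg' k) (fun s sab => dg' s sab k) r0ab r1ab.
- move=> t t01 k; have [_ /(_ t t01)] := affine_curve (cg k) (fun s sab => dg s sab k) r0ab r1ab.
  by rewrite [v t 0 k]mxE.
- move=> t t01 k; have [_ /(_ t t01)] := affine_curve (cg' k) (fun s sab => dg' s sab k) r0ab r1ab.
  by rewrite [v' t 0 k]mxE.
- move=> t t01; have t01' := o01 _ t01; rewrite /v /v' -scalerBr normrZ -mulrA ler_wpM2l //.
  by rewrite /u /u' c01 //; apply: LP; [exact: (Bg _ (itv _ t01')).2|exact: (Bg' _ (itv _ t01')).2].
- by rewrite /u /u' c01 ?lexx ?ler01 // mul0r addr0 e0.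
Qed.

Lemma between (a b r r' s : R) : a <= r <= b -> a <= r' <= b -> Num.min r r' <= s <= Num.max r r' -> a <= s <= b.
Proof. by rewrite ge_min le_max => /andP[? ?] /andP[? ?] /andP[/orP[]? /orP[]?]; apply/andP; split; lra. Qed.

Lemma between_dist (t d r r' s : R) : `|r - t| < d -> `|r' - t| < d ->
  Num.min r r' <= s <= Num.max r r' -> `|s - t| < d.
Proof. rewrite !ltr_norml ge_min le_max => /andP[? ?] /andP[? ?] /andP[/orP[]? /orP[]?]; apply/andP; split; lra. Qed.

(** If the curves are at different points at time [t], they are different at all
nearby times, by separation of base points or of coordinates.  Otherwise both are
near [t] in one chart, where uniqueness of solutions applies. *)
Lemma ic_unique_local H a b gamma gamma' t : smooth_on (ct_charts M) (@nonzero R m M) H ->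
  integral_curve H a b gamma -> integral_curve H a b gamma' -> a <= t <= b ->
  exists2 e, 0 < e & forall r r', a <= r <= b -> a <= r' <= b -> `|r - t| < e -> `|r' - t| < e ->
    gamma r = gamma' r -> gamma r' = gamma' r'.
Proof.
move=> HC ic ic' tab.
case: (pselect (ct_base (gamma t) = ct_base (gamma' t))) => [bb|bb]; last first.
  have := @bm_hausdorff R m M; rewrite open_hausdorff => /(_ _ _ (introN eqP bb)).
  move=> [[A A'] /= [] /set_mem At /set_mem At' [oA oA' AA]].
  have [e1 e10 P1] := near_within_dist (ic_near_base ic tab oA At).
  have [e2 e20 P2] := near_within_dist (ic_near_base ic' tab oA' At').
  have [e e0 [ee1 ee2]] := common_radius e10 e20; exists e => // r r' rab _ re _ E.
  have : (A `&` A') (ct_base (gamma r)).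
    by split; [apply: P1 => //; exact: lt_le_trans ee1|rewrite E; apply: P2 => //; exact: lt_le_trans ee2].
  by rewrite (eqP AA).
have [nz [i [_ [[it _] _ _]]]] := ic t tab.
have it' : cdom i (gamma' t) by move: it; rewrite /= bb.
case: (pselect (cz i (gamma t) = cz i (gamma' t))) => [cc|cc]; last first.
  pose D := `|cz i (gamma t) - cz i (gamma' t)|.
  have D0 : 0 < D by rewrite normr_gt0 subr_eq0; apply/eqP.
  have D2 : 0 < D / 2 by rewrite divr_gt0.
  have [e1 e10 P1] := ic_near_chart ic tab it D2.
  have [e2 e20 P2] := ic_near_chart ic' tab it' D2.
  have [e e0 [ee1 ee2]] := common_radius e10 e20; exists e => // r r' rab _ re _ E.
  have [_ h1] := P1 _ rab (lt_le_trans re ee1); have [_ h2] := P2 _ rab (lt_le_trans re ee2).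
  rewrite E distrC in h1; have := ler_distD (cz i (gamma' r)) (cz i (gamma t)) (cz i (gamma' t)).
  by rewrite -/D leNgt (splitr D) ltrD.
have [B [g [gr [r0 r00 r0B]]]] := rep_on_ball nz it HC.
have [oB gC _] := gr.
have [L L0 LP] := field_lip oB (ltW r00) r0B (hamfield_smooth oB gC).
have [e1 e10 P1] := ic_near_chart ic tab it r00.
have [e2 e20 P2] := ic_near_chart ic' tab it' r00.
have [e e0 [ee1 ee2]] := common_radius e10 e20; exists e => // r r' rab r'ab re r'e E.
pose a1 := Num.min r r'; pose b1 := Num.max r r'.
have bt s : a1 <= s <= b1 -> a <= s <= b by exact: between.
have bd s : a1 <= s <= b1 -> `|s - t| < e by exact: between_dist.
have a1b1 : a1 <= b1 by rewrite ge_min !le_max !lexx.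
have aa1 : a <= a1 by rewrite le_min; move/andP: rab => [-> _]; move/andP: r'ab => [-> _].
have bb1 : b1 <= b by rewrite ge_max; move/andP: rab => [_ ->]; move/andP: r'ab => [_ ->].
apply: (@chart_curves_agree H a1 b1 gamma gamma' i B g (cz i (gamma t)) r0 L r r') => //.
- exact: ic_sub ic.
- exact: ic_sub ic'.
- move=> s sab; have [js h] := P1 _ (bt _ sab) (lt_le_trans (bd _ sab) ee1).
  by split=> //; exact: ltW.
- move=> s sab; have [js h] := P2 _ (bt _ sab) (lt_le_trans (bd _ sab) ee2).
  by split=> //; rewrite cc; exact: ltW.
- by rewrite ge_min le_max !lexx.
- by rewrite ge_min le_max !lexx !orbT.
Qed.

Lemma ic_unique H a b gamma gamma' c : smooth_on (ct_charts M) (@nonzero R m M) H ->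
  integral_curve H a b gamma -> integral_curve H a b gamma' -> a <= c <= b ->
  gamma c = gamma' c -> forall t, a <= t <= b -> gamma t = gamma' t.
Proof.
move=> HC ic ic' cab cc t tab.
have near_ (s e r : R) : s - e < r -> r < s + e -> `|r - s| < e.
  by move=> h1 h2; rewrite ltr_norml; apply/andP; split; lra.
case: (leP c t) => ct.
  apply: (@interval_propagation R (fun s => gamma s = gamma' s) c t) => // s /andP[cs st].
  have [|e e0 He] := @ic_unique_local H a b gamma gamma' s HC ic ic'.
    by move: cab tab => /andP[? _] /andP[_ ?]; apply/andP; split; lra.
  exists e => // r r' h1 h2 h3 h4 h5; apply: He.
  - by move: cab tab => /andP[? _] /andP[_ ?]; apply/andP; split; lra.
  - by move: cab tab => /andP[? _] /andP[_ ?]; apply/andP; split; lra.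
  - by apply: near_ => //; lra.
  - by apply: near_ => //; lra.
apply: (@interval_propagation_left R (fun s => gamma s = gamma' s) t c) => //; first exact: ltW.
move=> s /andP[cs st].
have [|e e0 He] := @ic_unique_local H a b gamma gamma' s HC ic ic'.
  by move: cab tab => /andP[_ ?] /andP[? _]; apply/andP; split; lra.
exists e => // r r' h1 h2 h3 h4 h5; apply: He.
- by move: cab tab => /andP[_ ?] /andP[? _]; apply/andP; split; lra.
- by move: cab tab => /andP[_ ?] /andP[? _]; apply/andP; split; lra.
- by apply: near_ => //; lra.
- by apply: near_ => //; lra.
Qed.

(** Closed in the manifold, not only in the domain of the chart: the set is the
image of a compact piece of the half-space, and the manifold is Hausdorff. *)
Lemma chart_ball_closed i p : cdom (c := bm_charts M) i p -> exists2 r, 0 < r &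
  forall r', r' <= r -> closed [set q | cdom (c := bm_charts M) i q /\ `|cm i q - cm i p| <= r'].
Proof.
move=> ip; have /nbhs_ballP[r /= r0 rP] := near_coord_exists ip.
exists (r / 2); first by rewrite divr_gt0.
move=> r' rr; have rr' : r' < r by rewrite (le_lt_trans rr) // ltr_pdivrMr // ltr_pMr // ltr1n.
pose C := [set x : 'rV[R]_n | `|x - cm i p| <= r'] `&` @half_space R m.
have ex x : exists q, C x -> cdom (c := bm_charts M) i q /\ cm i q = x.
  case: (pselect (C x)) => [[xr hx]|nC]; last by exists p.
  have [||q iq qx] := rP x; last by exists q.
    by rewrite -ball_normE /= distrC (le_lt_trans xr).
  exact: hx.
have [psi psiP] := choice ex.
have Cc : compact C.
  apply: bounded_closed_compact.
    exists (r' + `|cm i p|); split; first exact: num_real.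
    move=> k kr x [xr _] /=; apply: ltW; apply: le_lt_trans kr.
    by rewrite -lerBlDr (le_trans (lerB_dist _ _)).
  apply: closedI.
    have cn : continuous (fun x : 'rV[R]_n => `|x - cm i p|).
      by move=> x; apply: (@cvg_norm _ _ _ (nbhs x)); apply: (@cvgB _ _ _ (nbhs x)); [exact: cvg_id|exact: cvg_cst].
    apply: (@preimage_closed _ _ (fun x : 'rV[R]_n => `|x - cm i p|) [set y | y <= r']).
      by move=> x _; exact: cn.
    exact: closed_le.
  apply: (@preimage_closed _ _ (fun x : 'rV[R]_n => x 0 ord0) [set y | 0 <= y]).
    by move=> x _; exact: coord_continuous.
  exact: closed_ge.
have <- : psi @` C = [set q | cdom (c := bm_charts M) i q /\ `|cm i q - cm i p| <= r'].
  apply/seteqP; split=> [q [x Cx <-]|q [iq qr]].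
    by have [iq qx] := psiP _ Cx; split=> //; rewrite qx; case: Cx.
  have Cq : C (cm i q) by split=> //; exact: chart_half.
  by exists (cm i q) => //; have [iq' qx] := psiP _ Cq; exact: (bm_coord_inj iq' iq qx).
apply: compact_closed; first exact: bm_hausdorff.
apply: continuous_compact Cc.
apply/(@subspace_continuousP _ C M psi) => x Cx A; rewrite nbhsE => -[A' [oA' A'x] AA].
have [iq qx] := psiP _ Cx.
have N := near_coord oA' A'x iq; rewrite qx in N.
suff : \forall y \near x, C y -> A (psi y) by [].
by apply: filterS N => y yP Cy; apply: AA; have [iy yy] := psiP _ Cy; exact: yP.
Qed.

Lemma ic_speed H a b gamma i B g K : a <= b -> integral_curve H a b gamma ->
  rep_on i (@nonzero R m M) H B g -> 0 <= K ->
  (forall t, a <= t <= b -> [/\ cdom i (gamma t), B (cz i (gamma t)) & `|hamfield g (cz i (gamma t))| <= K]) ->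
  `|cz i (gamma b) - cz i (gamma a)| <= K * (b - a).
Proof.
move=> ab ic gr K0 HB.
have [cg dg] := chart_curve ab ic gr (fun t tab => let: And3 h1 h2 _ := HB t tab in conj h1 h2).
apply: rV_norm_le => [|k]; first by rewrite mulr_ge0 // subr_ge0.
have -> : (cz i (gamma b) - cz i (gamma a)) 0 k =
    cz i (gamma (clamp a b b)) 0 k - cz i (gamma (clamp a b a)) 0 k.
  rewrite !clamp_id ?lexx ?ab //.
  by move: (cz i (gamma b)) (cz i (gamma a)) => u v; rewrite !mxE.
apply: (@lip_increment R (fun t => cz i (gamma (clamp a b t)) 0 k) (fun t => hamfield g (cz i (gamma t)) 0 k)) => //.
- exact: continuous_subspaceT (cg k).
- by move=> t tab; exact: dg.
- move=> t /andP[at_ tb]; apply: le_trans (coord_le_norm _ _) _.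
  by have [|_ _] := HB t; first by rewrite !ltW.
Qed.

(** Going backwards, the curve could leave the chart only through the complement
of the closed set of the hypothesis; as long as it has not left, its speed in the
chart bounds the distance covered. *)
Lemma ic_stay H a s gamma i B g c r K : integral_curve H a s gamma ->
  rep_on i (@nonzero R m M) H B g -> 0 < r -> (forall y, `|y - c| <= r -> B y) ->
  (forall y, `|y - c| <= r -> `|hamfield g y| <= K) ->
  closed [set q | cdom (c := bm_charts M) i q /\ `|cm i q - lsubmx c| <= r] ->
  cdom i (gamma s) -> `|cz i (gamma s) - c| <= r / 2 -> K * (s - a) <= r / 4 ->
  forall t, a <= t <= s -> cdom i (gamma t) /\ `|cz i (gamma t) - c| <= r.
Proof.
move=> ic gr r0 rB rK cl is_ cs Ksa t /andP[at_ ts].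
have K0 : 0 <= K by apply: le_trans (rK c _); rewrite ?subrr ?normr0 // ltW.
have lec z : `|cz i z - c| <= r -> `|cm i (ct_base z) - lsubmx c| <= r.
  by move=> h; rewrite -lsubmx_cz -linearB; apply: le_trans h; exact: norm_lsubmx.
pose E x := forall u, x <= u -> u <= s -> cdom i (gamma u) /\ `|cz i (gamma u) - cz i (gamma s)| <= K * (s - u).
have Eball x u : a <= x -> E x -> x <= u -> u <= s -> cdom i (gamma u) /\ `|cz i (gamma u) - c| <= r.
  move=> ax Ex xu us; have [iu h] := Ex u xu us; split=> //.
  have := ler_distD (cz i (gamma s)) (cz i (gamma u)) c.
  have : K * (s - u) <= K * (s - a) by rewrite ler_wpM2l //; lra.
  by move: h cs Ksa r0; lra.
suff Et : E t by exact: (Eball t t at_ Et (lexx _) ts).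
apply: (@interval_propagation_left R E t s) => //.
  move=> u su us; have -> : u = s by apply: le_anti; rewrite us su.
  by rewrite subrr normr0 subrr mulr0.
move=> x /andP[tx xs]; have xas : a <= x <= s by rewrite xs (le_trans at_ tx).
case: (pselect (cdom (c := bm_charts M) i (ct_base (gamma x)) /\ `|cm i (ct_base (gamma x)) - lsubmx c| <= r)) => [[ix _]|nx]; last first.
  have [e e0 He] := near_within_dist (ic_near_base ic xas (closed_openC cl) nx).
  exists e => // y y' ty' y'y ys xy' yx Ey; exfalso; apply: (He y).
  - by rewrite ys andbT; lra.
  - by rewrite ltr_norml; apply/andP; split; lra.
  - have [|iy /lec cy] := Eball y y _ Ey (lexx _) ys; first by lra.
    by split.
have r8 : 0 < r / 8 by rewrite divr_gt0.
have [e e0 He] := ic_near_chart ic xas ix r8.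
exists e => // y y' ty' y'y ys xy' yx Ey.
have nb u : y' <= u -> u <= y -> cdom i (gamma u) /\ `|cz i (gamma u) - c| <= r.
  move=> yu uy; have [||iu hu] := He u; first by apply/andP; split; lra.
    by rewrite ltr_norml; apply/andP; split; lra.
  have [||iy hy] := He y; first by apply/andP; split; lra.
    by rewrite ltr_norml; apply/andP; split; lra.
  split=> //; have [_ h] := Ey y (lexx _) ys.
  have := ler_distD (cz i (gamma x)) (cz i (gamma u)) c.
  have := ler_distD (cz i (gamma y)) (cz i (gamma x)) c.
  have := ler_distD (cz i (gamma s)) (cz i (gamma y)) c.
  have : K * (s - y) <= K * (s - a) by rewrite ler_wpM2l //; lra.
  rewrite [`|cz i (gamma x) - cz i (gamma y)|]distrC.
  by move: h cs Ksa r0 hy hu; lra.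
move=> u y'u us; case: (leP y u) => yu; first exact: Ey.
have [iu hu] := nb u y'u (ltW yu); split=> //.
have [_ h] := Ey y (lexx _) ys.
have : `|cz i (gamma y) - cz i (gamma u)| <= K * (y - u).
  apply: (ic_speed (ltW yu) _ gr K0); first by apply: ic_sub ic; lra.
  move=> v /andP[uv vy]; have [|iv hv] := nb v _ vy; first exact: le_trans uv.
  by split=> //; [exact: rB|exact: rK].
have := ler_distD (cz i (gamma y)) (cz i (gamma u)) (cz i (gamma s)).
rewrite [`|cz i (gamma u) - cz i (gamma y)|]distrC.
by move: h; rewrite !mulrBr; lra.
Qed.

Lemma rep_on_subset i A f (B B' : set 'rV[R]_(n + n)) g : open B' -> B' `<=` B -> rep_on i A f B g -> rep_on i A f B' g.
Proof.
move=> oB' BB [oB gC fg]; split=> //; first by move=> k; apply: Ck_sub (gC k).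
by move=> w Aw iw Bw; apply: fg => //; exact: BB.
Qed.

Lemma closed_chart_ball i z (N : set 'rV[R]_(n + n)) : cdom i z -> nbhs (cz i z) N ->
  exists r, [/\ 0 < r, forall y, `|y - cz i z| <= r -> N y &
    closed [set q | cdom (c := bm_charts M) i q /\ `|cm i q - lsubmx (cz i z)| <= r]].
Proof.
move=> iz /nbhs_ballP[r1 /= r10 r1P]; have [r2 r20 r2P] := chart_ball_closed iz.
have r12 : 0 < r1 / 2 by rewrite divr_gt0.
have [r r0 [rr1 rr2]] := common_radius r12 r20; exists r; split=> //.
  move=> y yr; apply: r1P; rewrite -ball_normE /= distrC; lra.
by rewrite lsubmx_cz; exact: r2P.
Qed.

End Uniqueness.

(** * Flowing backwards while integrating a function *)

Section FlowBack.
Context {R : realType} {m : nat} {M : bmanifold R m}.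
Notation n := m.+1.
Notation cm i q := (@ccoord R _ _ (bm_charts M) i q).
Notation cz i z := (@ccoord R _ _ (ct_charts M) i z).
Implicit Types (i j : cidx (ct_charts M)) (z w : cotangent M) (H : cotangent M -> R).
Implicit Types (gamma : R -> cotangent M).

(** The field [X / v] with one more component that integrates [h / v]. *)
Definition rescaled_lift N (X : 'rV[R]_N -> 'rV[R]_N) (h v : 'rV[R]_N -> R) (y : 'rV[R]_(N + 1)) : 'rV[R]_(N + 1) :=
  row_mx ((v (lsubmx y))^-1 *: X (lsubmx y)) (const_mx ((v (lsubmx y))^-1 * h (lsubmx y))).

Lemma Cinf_lsubmx N N' (O : set 'rV[R]_N) f : open O -> Cinf O f ->
  Cinf [set y : 'rV[R]_(N + N') | O (lsubmx y)] (fun y => f (lsubmx y)).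
Proof.
move=> oO fC k; apply: (@Ck_comp _ _ _ _ _ O) => //; first exact: open_lsubmx.
move=> b; apply: (@Ck_eq _ _ _ _ (fun y => y 0 (lshift N' b))); first exact: open_lsubmx.
  by move=> y _; rewrite mxE.
by apply: Ck_coord; exact: open_lsubmx.
Qed.

Lemma rescaled_lift_smooth N (O : set 'rV[R]_N) (X : 'rV[R]_N -> 'rV[R]_N) h v : open O -> (forall a, Cinf O (fun y => X y 0 a)) ->
  Cinf O h -> Cinf O v -> (forall y, O y -> v y != 0) ->
  forall a, Cinf [set y : 'rV[R]_(N + 1) | O (lsubmx y)] (fun y => rescaled_lift X h v y 0 a).
Proof.
move=> oO XC hC vC v0 a k; have oO' := @open_lsubmx R N 1 O oO.
have viC : Cinf O (fun y => (v y)^-1) by move=> j; apply: Ck_inv.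
case: (split_ordP a) => b ->.
  apply: (@Ck_eq _ _ _ _ (fun y => (v (lsubmx y))^-1 * X (lsubmx y) 0 b)) => //.
    by move=> y _; rewrite row_mxEl mxE.
  by apply: (@Cinf_lsubmx _ _ _ (fun y => (v y)^-1 * X y 0 b)) => // j; apply: Ck_mul => //; exact: XC.
apply: (@Ck_eq _ _ _ _ (fun y => (v (lsubmx y))^-1 * h (lsubmx y))) => //.
  by move=> y _; rewrite row_mxEr mxE.
by apply: (@Cinf_lsubmx _ _ _ (fun y => (v y)^-1 * h y)) => // j; apply: Ck_mul => //; exact: hC.
Qed.

(** The time 1 map of [theta *: X / v] and the integral of [f] picked up on the
way, as smooth functions [Psi] and [Z] of the starting point.  They are
characterised on integral curves: if [W] increases with speed [v] along the
curve and the increase from time [a] to time [s] is [- theta], then the point at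
time [a] is found by [Psi].  With [v = 1] this is the flow for a given time, with
[W = rho] the flow to the boundary. *)
Lemma flow_back H i (B : set 'rV[R]_(n + n)) g A f ft v c r v0 :
  rep_on i (@nonzero R m M) H B g -> rep_on i A f B ft -> Cinf B v ->
  0 < v0 -> (forall y, B y -> v0 <= v y) -> 0 < r -> (forall y, `|y - c| <= r -> B y) ->
  exists2 kappa, 0 < kappa & forall (P : set 'rV[R]_(n + n)) (theta : 'rV[R]_(n + n) -> R),
    open P -> Cinf P theta -> (forall p, P p -> `|p - c| <= r / 2) -> (forall p, P p -> `|theta p| <= kappa) ->
    exists (Psi : 'rV[R]_(n + n) -> 'rV[R]_(n + n)) (Z : 'rV[R]_(n + n) -> R),
    [/\ forall a, Cinf P (fun p => Psi p 0 a), Cinf P Z &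
      forall gamma a s (W F : R -> R), a <= s -> integral_curve H a s gamma ->
        (forall t, a <= t <= s -> [/\ A (gamma t), cdom i (gamma t) & `|cz i (gamma t) - c| <= r]) ->
        P (cz i (gamma s)) ->
        continuous W -> (forall t : R, a < t < s -> is_derive t (1 : R) W (v (cz i (gamma t)))) ->
        W s - W a = - theta (cz i (gamma s)) ->
        continuous F -> (forall t : R, a < t < s -> is_derive t (1 : R) F (f (gamma t))) ->
        cz i (gamma a) = Psi (cz i (gamma s)) /\ F a - F s = Z (cz i (gamma s))].
Proof.
move=> gr fr vC v00 vB r0 rB; have r0' := ltW r0.
have [oB gC _] := gr; have [_ ftC fE] := fr.
pose X := rescaled_lift (hamfield g) ft v.
pose ca : 'rV[R]_(n + n + 1) := row_mx c 0.
pose O := [set y : 'rV[R]_(n + n + 1) | B (lsubmx y)].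
have oO : open O by exact: open_lsubmx.
have vn0 y : B y -> v y != 0 by move=> /vB h; rewrite gt_eqF // (lt_le_trans v00).
have XC : forall a, Cinf O (fun y => X y 0 a).
  by apply: rescaled_lift_smooth => //; exact: hamfield_smooth.
have lca y : `|y - ca| <= r -> `|lsubmx y - c| <= r.
  by move=> h; rewrite -[c](row_mxKl c (0 : 'rV_1)) -linearB; apply: le_trans h; exact: norm_lsubmx.
have rO y : `|y - ca| <= r -> O y by move=> /lca /rB.
have [L L0 LP] := field_lip oO r0' rO XC.
have [C C0 CP] := bounded_on_ball r0' rB (fun y By => Ck_continuous (vC 0%N) By).
have [kappa k0 kP] := @flow_param R _ (n + n) O X ca r oO r0 rO XC.
exists kappa => // P theta oP thC Pr Pk.
pose iota (p : 'rV[R]_(n + n)) : 'rV[R]_(n + n + 1) := row_mx p 0.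
have rowB (p q : 'rV[R]_(n + n)) : row_mx p (0 : 'rV[R]_1) - row_mx q 0 = row_mx (p - q) 0.
  by rewrite opp_row_mx add_row_mx subr0.
have iC a : Cinf P (fun p => iota p 0 a).
  move=> k; case: (split_ordP a) => b ->.
    by apply: (@Ck_eq _ _ _ _ (fun p => p 0 b)) => // [p _|]; [rewrite row_mxEl|exact: Ck_coord].
  by apply: (@Ck_eq _ _ _ _ (fun p => 0)) => // [p _|]; [rewrite row_mxEr mxE|exact: Ck_cst].
have iPr p : P p -> `|iota p - ca| <= r / 2.
  by move=> /Pr h; rewrite rowB; apply: norm_row_mx => //; rewrite normr0 divr_ge0.
have [u [uP uC]] := kP P iota theta oP iC thC iPr Pk.
exists (fun p => lsubmx (u p 1)), (fun p => u p 1 0 (rshift (n + n) ord0)); split.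
- move=> a k; apply: (@Ck_eq _ _ _ _ (fun p => u p 1 0 (lshift 1 a))) => // [p _|]; first by rewrite mxE.
  exact: uC.
- exact: uC.
move=> gamma a s W F as_ ic gB Ps cW dW Wth cF dF.
set p := cz i (gamma s) in Ps Wth *.
have [u0 [cu du] ub] := uP p Ps.
have gB' t : a <= t <= s -> cdom i (gamma t) /\ B (cz i (gamma t)).
  by move=> /gB[_ ? /rB].
have [cg dg] := chart_curve as_ ic gr gB'.
have vg t : a < t < s -> v0 <= v (cz i (gamma t)).
  by move=> /andP[? ?]; apply: vB; have [|_ //] := gB' t; rewrite !ltW.
have Winc x y : a <= x -> x <= y -> y <= s -> v0 * (y - x) <= W y - W x.
  move=> ax xy ys; rewrite mulrBr.
  apply: (@le_increment R (fun t => v0 * t) W (fun=> v0) (fun t => v (cz i (gamma t)))) => //.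
  - by apply: continuous_subspaceT => t; exact: (cvgM (cvg_cst _) cvg_id).
  - exact: continuous_subspaceT cW.
  - move=> t _; have := @is_derive_linear R R R (fun s => v0 * s) t 1; rewrite mulr1; apply.
    by move=> x' y' z'; rewrite /GRing.scale /=; ring.
  - by move=> t /andP[? ?]; apply: dW; apply/andP; split; lra.
  - by move=> t /andP[? ?]; apply: vg; apply/andP; split; lra.
move: as_; rewrite le_eqVlt => /predU1P[as_|as_].
  have th0 : theta p = 0 by apply/eqP; rewrite -oppr_eq0 -Wth as_ subrr.
  have u1 : u p 1 = iota p.
    rewrite -u0; apply/rowP => k; apply/eqP; rewrite -subr_eq0 -normr_le0.
    rewrite -[leRHS](mul0r (1 - 0 : R)).
    apply: (@lip_increment R (fun t => u p t 0 k) (fun t => (theta p *: X (u p t)) 0 k)) => //.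
    - exact: continuous_subspaceT (cu k).
    - by move=> t t01; exact: du.
    - by move=> t _; rewrite th0 scale0r mxE normr0.
  by rewrite u1 /iota row_mxKl row_mxEr mxE as_ subrr.
have Was : 0 < W s - W a.
  by apply: (@lt_le_trans _ _ (v0 * (s - a))); [rewrite mulr_gt0 // subr_gt0|exact: Winc (lexx _) (ltW as_) (lexx _)].
have th0 : theta p != 0 by rewrite -oppr_eq0 -Wth gt_eqF.
have sab : a <= s <= s by rewrite lexx ltW.
have aab : a <= a <= s by rewrite lexx ltW.
pose pt (tau : R) := s + clamp 0 1 tau * (a - s).
(* the time of the rescaled flow reached when the curve is at pt tau *)
pose alpha (tau : R) := (theta p)^-1 * (W (pt tau) - W s).
(* the curve run backwards from time s, with the integral of f *)
pose cc (tau : R) : 'rV[R]_(n + n + 1) :=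
  row_mx (cz i (gamma (clamp a s (pt tau)))) (const_mx (F (pt tau) - F s)).
pose uu (tau : R) := u p (alpha tau).
have o01 (tau : R) : 0 < tau < 1 -> 0 <= tau <= 1 by move=> /andP[? ?]; rewrite !ltW.
have ptE (tau : R) : 0 <= tau <= 1 -> pt tau = s + tau * (a - s) by move=> h; rewrite /pt clamp_id.
have ptin (tau : R) : 0 < tau < 1 -> a < pt tau < s.
  by move=> h; rewrite ptE ?o01 //; move/andP: h => [? ?]; apply/andP; split; nra.
have [cWp dWp] := affine_curve cW dW sab aab.
have [cFp dFp] := affine_curve cF dF sab aab.
have calpha : continuous alpha.
  by move=> t; exact: (cvgM (cvg_cst _) (cvgB (cWp t) (cvg_cst _))).
have dalpha (tau : R) : 0 < tau < 1 -> is_derive tau (1 : R) alpha ((theta p)^-1 * ((a - s) * v (cz i (gamma (pt tau))))).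
  move=> h; have hd := dWp _ h; rewrite -(ptE _ (o01 _ h)) in hd.
  have hd2 := is_deriveB hd (is_derive_cst (W s) tau (1 : R)).
  have := @is_deriveZ R R R _ (theta p)^-1 tau 1 _ hd2; rewrite subr0; exact.
have aitv (tau : R) : 0 < tau < 1 -> 0 < alpha tau < 1.
  move=> h; have /andP[h1 h2] := ptin _ h.
  have w1 : 0 < W (pt tau) - W a.
    by apply: lt_le_trans (Winc _ _ (lexx _) (ltW h1) (ltW h2)); rewrite mulr_gt0 // subr_gt0.
  have w2 : 0 < W s - W (pt tau).
    by apply: lt_le_trans (Winc _ _ (ltW h1) (ltW h2) (lexx _)); rewrite mulr_gt0 // subr_gt0.
  have tE : theta p = - (W s - W a) by rewrite Wth opprK.
  have -> : alpha tau = (W s - W (pt tau)) / (W s - W a).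
    by rewrite /alpha tE invrN mulNr -mulrN opprB mulrC.
  by rewrite divr_gt0 //= ltr_pdivrMr // mul1r; lra.
have pt1 : pt 1 = a by rewrite ptE ?ler01 ?lexx // mul1r; ring.
have pt0 : pt 0 = s by rewrite ptE ?ler01 ?lexx // mul0r addr0.
have alpha1 : alpha 1 = 1.
  rewrite /alpha pt1.
  by rewrite -[W a - W s]opprB Wth opprK mulVf.
have alpha0 : alpha 0 = 0.
  by rewrite /alpha pt0 subrr mulr0.
have Xl (y y' : 'rV[R]_(n + n + 1)) : `|lsubmx y - c| <= r -> `|lsubmx y' - c| <= r ->
    `|X y - X y'| <= L * `|y - y'|.
  move=> yr yr'; have XE (x : 'rV[R]_(n + n + 1)) : X x = X (iota (lsubmx x)) by rewrite /X /rescaled_lift /iota row_mxKl.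
  rewrite (XE y) (XE y'); apply: le_trans (LP _ _ _ _) _.
  - by rewrite rowB; apply: norm_row_mx => //; rewrite normr0.
  - by rewrite rowB; apply: norm_row_mx => //; rewrite normr0.
  - rewrite ler_wpM2l // rowB; apply: norm_row_mx; last by rewrite normr0.
    by rewrite -linearB; exact: norm_lsubmx.
suff cu1 : cc 1 = uu 1.
  move: cu1; rewrite /cc /uu alpha1 pt1 clamp_id // => <-.
  by rewrite row_mxKl row_mxEr mxE.
have t1 : ((0 : R) <= 1) && ((1 : R) <= 1) by rewrite ler01 lexx.
apply: (@curves_agree R _ cc uu (fun tau => ((a - s) * v (cz i (gamma (pt tau)))) *: X (cc tau))
   (fun tau => ((a - s) * v (cz i (gamma (pt tau)))) *: X (uu tau)) (`|a - s| * C * L)) t1.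
- by rewrite !mulr_ge0.
- move=> k; case: (split_ordP k) => b ->.
    by under eq_fun do rewrite row_mxEl; exact: (affine_curve (cg b) (fun t h => dg t h b) sab aab).1.
  by under eq_fun do rewrite row_mxEr mxE; move=> t; exact: (cvgB (cFp t) (cvg_cst _)).
- move=> k t; exact: (@continuous_comp _ _ _ alpha (fun t => u p t 0 k) t (calpha t) (cu k _)).
- move=> t h k; have h' := o01 _ h; have /andP[ha hs] := ptin _ h.
  have hp : a <= pt t <= s by rewrite !ltW.
  have [Ap ip rp] := gB _ hp.
  have lc : lsubmx (cc t) = cz i (gamma (pt t)) by rewrite /cc row_mxKl clamp_id.
  have vn : v (cz i (gamma (pt t))) != 0 by apply: vn0; exact: rB.
  pose w := cz i (gamma (pt t)); rewrite -/w in vn lc rp *.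
  have XE : ((a - s) * v w) *: X (cc t) = row_mx ((a - s) *: hamfield g w) (const_mx ((a - s) * f (gamma (pt t)))).
    rewrite /X /rescaled_lift lc scale_row_mx !scalerA mulfK // (fE _ Ap ip (rB _ rp)); congr row_mx.
    by apply/rowP => l; rewrite !mxE mulrA mulfK.
  rewrite XE; case: (split_ordP k) => b ->.
    under eq_fun do rewrite row_mxEl.
    have := (affine_curve (cg b) (fun t h => dg t h b) sab aab).2 t h; rewrite -(ptE _ h') -/w.
    by rewrite row_mxEl [X in _ -> is_derive _ _ _ X]mxE; exact.
  under eq_fun do rewrite row_mxEr mxE.
  have hd := dFp _ h; rewrite -(ptE _ h') in hd.
  have := is_deriveB hd (is_derive_cst (F s) t (1 : R)); rewrite subr0.
  by rewrite row_mxEr mxE; exact.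
- move=> t h k; have hd := du _ (aitv _ h) k.
  have := is_derive1_comp hd (dalpha _ h).
  rewrite [X in is_derive _ _ _ X -> _](_ : _ = (((a - s) * v (cz i (gamma (pt t)))) *: X (uu t)) 0 k) //.
  by rewrite !mxE /uu; field.
- move=> t h; have /andP[ha hs] := ptin _ h.
  have hp : a <= pt t <= s by rewrite !ltW.
  have [_ _ rp] := gB _ hp.
  rewrite -scalerBr normrZ normrM -!mulrA ler_wpM2l // ler_pM //; first exact: CP.
  apply: Xl; first by rewrite /cc row_mxKl clamp_id.
  by apply: lca; apply: ub; exact: o01 (aitv _ h).
- rewrite /cc /uu alpha0 u0 pt0 clamp_id // subrr /iota.
  by congr row_mx; apply/rowP => k; rewrite !mxE.
Qed.

End FlowBack.

(** * The integral of f along bicharacteristics as a function on Gamma *)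

Section Xray.
Context {R : realType} {m : nat} {M : bmanifold R m}.
Notation n := m.+1.
Notation cm i q := (@ccoord R _ _ (bm_charts M) i q).
Notation cz i z := (@ccoord R _ _ (ct_charts M) i z).
Implicit Types (i j : cidx (ct_charts M)) (z : cotangent M) (w : bcotangent M).
Context (H : cotangent M -> R) (HC : smooth_on (ct_charts M) (@nonzero R m M) H).

Lemma continuous_rho_along (rho : M -> R) a b gamma : smooth_on (bm_charts M) setT rho -> a <= b ->
  integral_curve H a b gamma -> continuous (fun t => rho (ct_base (gamma (clamp a b t)))).
Proof.
move=> rC ab ic; apply: (@continuous_clamp R R (fun t => rho (ct_base (gamma t))) a b ab) => t tab A At.
have := rho_continuous rC At; rewrite /= nbhsE => -[A' [oA' A't] AA].
by apply: filterS (ic_near_base ic tab oA' A't) => s /AA.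
Qed.

Lemma continuous_along (A : set (cotangent M)) f a b gamma : smooth_on (ct_charts M) A f -> a <= b ->
  integral_curve H a b gamma -> (forall s, a <= s <= b -> A (gamma s)) ->
  continuous (fun t => f (gamma (clamp a b t))).
Proof.
move=> fC ab ic Ag; apply: (@continuous_clamp R R (fun t => f (gamma t)) a b ab) => t tab.
exact: ic_fun_cvg ic tab Ag fC.
Qed.

Lemma is_derive_along i (A : set (cotangent M)) f a b gamma (B : set 'rV[R]_(n + n)) g h t : integral_curve H a b gamma ->
  (forall s, a <= s <= b -> A (gamma s)) ->
  rep_on i (@nonzero R m M) H B g -> rep_on i A f B h -> a < t < b -> cdom i (gamma t) -> B (cz i (gamma t)) ->
  is_derive t (1 : R) (fun t => f (gamma (clamp a b t)))
    ((hamfield g (cz i (gamma t)) *m (gradient h (cz i (gamma t)))^T) 0 0).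
Proof.
move=> ic Ag gr hr tab it Bt; have tab' : a <= t <= b by move/andP: tab => [? ?]; rewrite !ltW.
apply: (@near_eq_is_derive _ _ _ (fun t => f (gamma t))).
  by near=> s; rewrite (near (clamp_near tab)).
apply: within_is_derive tab _; apply: (ic_fun ic tab' Ag (f := f)); last exact: rep_on_local_rep hr Bt.
by split=> //; exists g => //; exact: rep_on_local_rep gr Bt.
Unshelve. all: by end_near. Qed.

(* gam w is the unit bicharacteristic issued from zeta w, and C is a closed
   subset of U that contains the base points of all the zeta w *)
Context (rho : M -> R) (U V : set M) (UV0 : U `&` V = set0).
Context (rC : smooth_on (bm_charts M) setT rho) (rge0 : forall p, 0 <= rho p) (rU : forall p, U p -> rho p = 0).
Context (UU : set (bcotangent M)) (zeta : bcotangent M -> cotangent M) (ell : bcotangent M -> R).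
Context (zres : forall w, UU w -> is_restriction (zeta w) w).
Context (ell0 : forall w, UU w -> 0 < ell w).
Context (gam : bcotangent M -> R -> cotangent M).
Context (gam_bichar : forall w, UU w -> unit_bichar H 0 (ell w) (gam w)).
Context (gam0 : forall w, UU w -> gam w 0 = zeta w).
Context (gamV : forall w, UU w -> V (ct_base (gam w (ell w)))).
Context (gam_nV : forall w, UU w -> forall s, 0 <= s < ell w -> ~ V (ct_base (gam w s))).
Context (gam_nU : forall w, UU w -> forall s, 0 < s < ell w -> ~ U (ct_base (gam w s))).
Context (C : set M) (Cclosed : closed C) (CU : C `<=` U) (zC : forall w, UU w -> C (ct_base (zeta w))).
Context (Hhom : forall z lambda, nonzero z -> 0 < lambda -> H (dilate lambda z) = lambda ^+ 2 * H z).

Let SG := cosphere H `&` Gamma H UU zeta ell.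

Lemma gam_ic w : UU w -> integral_curve H 0 (ell w) (gam w).
Proof. by move=> /gam_bichar[]. Qed.

Lemma gam_sub w a b : UU w -> 0 <= a -> b <= ell w -> integral_curve H a b (gam w).
Proof. by move=> /gam_ic ic a0 bl; exact: ic_sub ic. Qed.

Lemma gam_notU w s : UU w -> 0 < s <= ell w -> ~ U (ct_base (gam w s)).
Proof.
move=> hw /andP[s0]; rewrite le_eqVlt => /predU1P[->|sl]; last by apply: gam_nU; rewrite ?s0.
move=> Us; have : (U `&` V) (ct_base (gam w (ell w))) by split=> //; exact: gamV.
by rewrite UV0.
Qed.

Lemma gam_SG w s : UU w -> 0 <= s <= ell w -> SG (gam w s).
Proof.
move=> hw /andP[s0 sl]; have [ic cs] := gam_bichar hw.
split; first by apply: cs; rewrite s0.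
exists 1, w, s, (gam w s); split; rewrite ?dilate1 //; first by rewrite s0.
exists (gam w); split=> //; last exact: gam0.
split=> [|t /andP[t0 ts]]; first exact: ic_sub ic.
by apply: cs; rewrite t0 (le_trans ts).
Qed.

Lemma bichar_gam w gamma s : UU w -> 0 <= s <= ell w -> integral_curve H 0 s gamma -> gamma 0 = zeta w ->
  forall t, 0 <= t <= s -> gamma t = gam w t.
Proof.
move=> hw /andP[s0 sl] ic g0; apply: (ic_unique (c := 0) HC ic (gam_sub hw (lexx _) sl)); first by rewrite lexx.
by rewrite g0 gam0.
Qed.

(** Homogeneity of H makes the unit points of the conic set Gamma the points of the
bicharacteristics themselves. *)
Lemma SG_gam z : SG z -> exists w s, [/\ UU w, 0 <= s <= ell w & z = gam w s].
Proof.
move=> [[nz Hz] [lam [w [s [y [lam0 hw sl [gamma [[ic cs] g0 gs]] zE]]]]]].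
have s0 : 0 <= s by move/andP: sl => [].
exists w, s; split=> //; rewrite zE -gs.
have ss : 0 <= s <= s by rewrite lexx s0.
rewrite -(bichar_gam hw sl ic g0 ss); have [ny Hy] := cs s ss.
have lam1 : lam = 1.
  have := Hhom ny lam0; rewrite gs -zE Hz -gs Hy => /esym /eqP; rewrite -[X in _ == X]mul1r.
  rewrite (inj_eq (mulIf _)) ?invr_neq0 ?pnatr_eq0 // sqrf_eq1 => /orP[/eqP //|/eqP l].
  by move: lam0; rewrite l oppr_gt0 ltr10.
by rewrite lam1 dilate1.
Qed.

(** Backwards from the common point the two curves agree, up to the shift
[s' - s]; hence the initial point of the first one is the point at time [s' - s] of
the second one, and it lies over [U]. *)
Lemma gam_inj w w' s s' : UU w -> UU w' -> 0 <= s <= ell w -> 0 <= s' <= ell w' ->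
  gam w s = gam w' s' -> w = w' /\ s = s'.
Proof.
wlog ss : w w' s s' / s <= s'.
  move=> hwl hw hw' hs hs' E; case: (leP s s') => ss; first exact: hwl.
  by have [-> ->] := hwl _ _ _ _ (ltW ss) hw' hw hs' hs (esym E).
move=> hw hw' /andP[s0 sl] /andP[s'0 sl'] E.
have h0 : 0 <= s' - s by rewrite subr_ge0.
have ic' : integral_curve H 0 s (fun t => gam w' (t + (s' - s))).
  apply: ic_sub (ic_shift (h := s' - s) (gam_ic hw')); first by rewrite sub0r oppr_le0.
  by rewrite lerBrDr addrC subrK.
have EE := ic_unique (c := s) HC (gam_sub hw (lexx _) sl) ic'.
have E0 : gam w 0 = gam w' (s' - s).
  rewrite EE ?add0r ?lexx ?s0 //; by rewrite addrC subrK.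
have {E0 EE}ss' : s' - s = 0.
  apply/eqP; apply/negP => /negP sn; apply: (@gam_notU w' (s' - s) hw').
    by rewrite lt_neqAle eq_sym sn h0 /=; lra.
  by rewrite -E0 gam0 //; apply: CU; exact: zC.
have {}ss' : s = s' by lra.
split=> //; subst s'.
have E1 : gam w 0 = gam w' 0.
  apply: (ic_unique (a := 0) (b := s) (c := s) HC); rewrite ?lexx ?s0 //.
  - exact: gam_sub.
  - exact: gam_sub.
apply: (@restriction_unique _ _ _ (zeta w)); first exact: zres.
by rewrite -gam0 // E1 gam0 //; exact: zres.
Qed.

Context (f : cotangent M -> R) (fC : smooth_on (ct_charts M) SG f).
Context (F : bcotangent M -> R -> R) (cF : forall w, UU w -> continuous (F w)) (F0 : forall w, UU w -> F w 0 = 0)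
  (dF : forall w, UU w -> forall t, 0 <= t <= ell w -> is_derive t (1 : R) (F w) (f (gam w t))).
Context (phi : cotangent M -> R) (phiE : forall w s, UU w -> 0 <= s <= ell w -> phi (gam w s) = F w s).

Definition rep_at w t := exists i, cdom i (gam w t) /\ exists g, local_rep (X := ct_charts M) i SG phi (gam w t) g.

Lemma SG_nonzero z : SG z -> nonzero z.
Proof. by case=> -[]. Qed.

Lemma speed_bound i (B : set 'rV[R]_(n + n)) g c r : rep_on i (@nonzero R m M) H B g -> 0 <= r ->
  (forall y, `|y - c| <= r -> B y) -> exists2 K, 0 <= K & forall y, `|y - c| <= r -> `|hamfield g y| <= K.
Proof.
move=> [oB gC _] r0 rB.
have [K K0 KP] := bounded_family_on_ball r0 rB (fun a y By => Ck_continuous (hamfield_smooth oB gC a 0%N) By).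
by exists K => // y yr; apply: rV_norm_le => // k; exact: KP.
Qed.

(** Near [gam w t], [phi] at a point is its value a time [sig] earlier plus the
integral of [f] in between.  The set [C] is avoided near [gam w t], which excludes
bicharacteristics that started less than [sig] before. *)
Lemma rep_transport w t : UU w -> 0 < t <= ell w ->
  exists2 e, 0 < e & forall r r', 0 <= r -> r <= r' -> r' <= ell w -> t - e < r -> r' < t + e ->
    rep_at w r -> rep_at w r'.
Proof.
move=> hw tl; have t0 : 0 <= t <= ell w by move/andP: tl => [? ->]; rewrite ltW.
have SGt := gam_SG hw t0; have [i it] : exists i : cidx (ct_charts M), cdom i (gam w t) := bm_cover _.
have nC : (~` C) (ct_base (gam w t)) by move=> /CU; exact: gam_notU.
set c := cz i (gam w t).
have [gH grH] := local_rep_all (SG_nonzero SGt) it HC.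
have [ft grf] := local_rep_all SGt it fC.
have [B1 rH B1c] := local_rep_on grH; have [B2 rf B2c] := local_rep_on grf.
have [oB1 _ _] := rH; have [oB2 _ _] := rf.
pose B := B1 `&` B2; have oB : open B by exact: openI.
have {}rH : rep_on i (@nonzero R m M) H B gH by apply: rep_on_subset rH => // y [].
have {}rf : rep_on i SG f B ft by apply: rep_on_subset rf => // y [].
have NB : nbhs c (B `&` [set y | forall z, cdom i z -> cz i z = y -> (~` C) (ct_base z)]).
  apply: filterI; first by apply: open_nbhs_nbhs; split=> //; split.
  exact: (near_cz (closed_openC Cclosed) nC it).
have [r [r0 rN cl]] := closed_chart_ball it NB; rewrite -/c in rN cl.
(* on the ball of radius r there are smooth expressions of H and f, and no base point in C *)
have rB y : `|y - c| <= r -> B y by move=> /rN[].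
have [K K0 KP] := speed_bound rH (ltW r0) rB.
have vC : Cinf B (fun=> 1 : R) by move=> k; exact: Ck_cst.
have [kappa k0 fb] := flow_back rH rf vC ltr01 (fun y _ => lexx 1) r0 rB.
have K1 : 0 < 4 * (K + 1) by rewrite mulr_gt0 // ltr_wpDl.
have d10 : 0 < r / (4 * (K + 1)) by rewrite divr_gt0.
(* during a time del, curves move by at most r / 4 in the chart *)
have [del del0 [delr delk]] := common_radius d10 k0.
have Kdel x : x <= del -> K * x <= r / 4.
  move=> xd; apply: (@le_trans _ _ ((K + 1) * del)).
    by apply: (@le_trans _ _ (K * del)); [exact: ler_wpM2l|rewrite ler_wpM2r ?(ltW del0) // lerDl].
  apply: (@le_trans _ _ ((K + 1) * (r / (4 * (K + 1))))); first by rewrite ler_wpM2l // addr_ge0.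
  by rewrite le_eqVlt; apply/orP; left; apply/eqP; field; rewrite gt_eqF // ltr_wpDl.
have r4 : 0 < r / 4 by rewrite divr_gt0.
have [e1 e10 He] := ic_near_chart (gam_ic hw) t0 it r4.
have del2 : 0 < del / 2 by rewrite divr_gt0.
have [e e0 [ee1 ed]] := common_radius e10 del2.
exists e => // s1 s2 s10 s12 s2l ts1 s2t Hs1.
pose sig := s2 - s1; have sig0 : 0 <= sig by rewrite subr_ge0.
have sigd : sig <= del by rewrite /sig; lra.
have nearc s : s1 <= s -> s <= s2 -> cdom i (gam w s) /\ `|cz i (gam w s) - c| < r / 4.
  move=> h1 h2; apply: He; first by rewrite (le_trans s10) // (le_trans h2).
  apply: lt_le_trans ee1; rewrite ltr_distl (lt_le_trans ts1 h1) /=.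
  exact: le_lt_trans s2t.
pose P := [set y : 'rV[R]_(n + n) | `|y - c| < r / 2].
have oP : open P.
  have -> : P = ball c (r / 2) by apply/seteqP; split=> y; rewrite -ball_normE /= /P /= distrC.
  exact: ball_open.
have [|||Psi [Z [PsiC ZC PsiP]]] := fb P (fun=> - sig) oP.
- by move=> k; exact: Ck_cst.
- by move=> p /ltW.
- by move=> p _; rewrite normrN ger0_norm // (le_trans sigd).
have step v s : UU v -> sig <= s -> s <= ell v -> P (cz i (gam v s)) ->
    (forall t, s - sig <= t <= s -> cdom i (gam v t) /\ `|cz i (gam v t) - c| <= r) ->
    cz i (gam v (s - sig)) = Psi (cz i (gam v s)) /\ F v (s - sig) - F v s = Z (cz i (gam v s)).
  move=> hv ss sl Ps Hr.
  have inl x : s - sig <= x <= s -> 0 <= x <= ell v by move=> /andP[h1 h2]; rewrite (le_trans _ h1) ?subr_ge0 // (le_trans h2).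
  apply: (PsiP (gam v) (s - sig) s id (F v)) => //.
  - by rewrite gerBl.
  - by apply: gam_sub => //; rewrite subr_ge0.
  - by move=> x hx; have [ix cx] := Hr x hx; split=> //; exact: gam_SG (inl _ hx).
  - by move=> x; exact: cvg_id.
  - by rewrite opprK; ring.
  - exact: cF.
  - by move=> x /andP[? ?]; apply: dF => //; apply: inl; rewrite !ltW.
have [i2 c2] := nearc s2 s12 (lexx _); have [i1 c1] := nearc s1 (lexx _) s12.
have Ps2 : P (cz i (gam w s2)).
  by apply: lt_le_trans c2 _; rewrite ler_pM2l // lef_pV2 ?posrE // ler_nat.
have [j [j1 [g0 grj]]] := Hs1.
have [g1 [B3 [oB3 B3s g1C g1E]]] := local_rep_any j1 i1 grj.
have s2sig : s2 - sig = s1 by rewrite /sig opprB addrC subrK.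
have [E1 _] : cz i (gam w (s2 - sig)) = Psi (cz i (gam w s2)) /\ F w (s2 - sig) - F w s2 = Z (cz i (gam w s2)).
  apply: step => //; first by rewrite /sig gerBl.
  move=> x /andP[x1 x2]; rewrite s2sig in x1.
  have [ix cx] := nearc x x1 x2; split=> //; apply: le_trans (ltW cx) _.
  by rewrite ler_pdivrMr // ler_peMr ?(ltW r0) // ler1n.
rewrite s2sig in E1.
have NP : nbhs (cz i (gam w s2)) (P `&` [set y | B3 (Psi y)]).
  apply: filterI; first exact: open_nbhs_nbhs.
  have cPsi : {for cz i (gam w s2), continuous Psi}.
    apply: (@cvg_mx R _ _ (nbhs (cz i (gam w s2))) _ _ _).1 => k.
    exact: (Ck_continuous (PsiC k 0%N) Ps2).
  by apply: cPsi; apply: open_nbhs_nbhs; split=> //; rewrite -E1.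
move: NP; rewrite nbhsE => -[D [oD Ds2] DP].
exists i; split=> //; exists (fun y => g1 (Psi y) - Z y); exists D; split=> //.
  have DP1 : D `<=` P by move=> y /DP[].
  move=> k; apply: Ck_add => //; last by apply: Ck_opp => //; apply: Ck_sub (ZC k).
  by apply: (@Ck_comp _ _ _ _ _ B3) => // [y /DP[]|a] //; apply: Ck_sub (PsiC a k).
move=> z' SGz iz Dz; have [v [s [hv sl zE]]] := SG_gam SGz.
have [Pz B3z] := DP _ Dz; have /andP[s0 sl'] := sl.
have stay a : 0 <= a -> a <= s -> s - a <= del -> forall x, a <= x <= s -> cdom i (gam v x) /\ `|cz i (gam v x) - c| <= r.
  move=> a0 as_ sad; apply: (ic_stay (gam_sub hv a0 sl') rH r0 rB KP cl); rewrite -?zE //; last exact: Kdel.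
  exact: ltW.
(* otherwise the initial point of the bicharacteristic would be in the ball, which avoids C *)
have ssig : sig <= s.
  case: (leP sig s) => // ss; exfalso.
  have [||||i0 c0] := stay 0 _ _ _ 0; rewrite ?lexx ?s0 //; first by rewrite subr0 (le_trans (ltW ss)).
  by have [_ /(_ _ i0 erefl)] := rN _ c0; apply; rewrite gam0 //; exact: zC.
rewrite zE in Dz Pz B3z *.
have p1 : 0 <= s - sig by rewrite subr_ge0.
have p2 : s - sig <= s by rewrite gerBl.
have p3 : s - (s - sig) <= del by rewrite opprB addrC subrK.
have [E2 E3] := step v s hv ssig sl' Pz (stay _ p1 p2 p3).
have hs : 0 <= s - sig <= ell v by rewrite p1 (le_trans p2).
have [|is_ _] := stay _ p1 p2 p3 (s - sig); first by rewrite lexx.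
rewrite phiE // -E3 -E2 -(g1E (gam v (s - sig))) ?phiE //; first by ring.
- exact: gam_SG.
- by rewrite E2.
Qed.

(* all the initial points are in one chart, on a part of which rho increases
   along the Hamilton field with speed at least v0 *)
Context (i0 : cidx (ct_charts M)) (B0 : set 'rV[R]_(n + n)) (gH rt : 'rV[R]_(n + n) -> R) (v0 : R).
Context (rH : rep_on i0 (@nonzero R m M) H B0 gH)
  (rr : rep_on i0 setT (fun z => rho (ct_base z)) B0 rt) (v00 : 0 < v0).
Let vel y : R := (hamfield gH y *m (gradient rt y)^T) 0 0.
Context (velC : Cinf B0 vel) (vel_ge : forall y, B0 y -> v0 <= vel y).
Context (z_i0 : forall w, UU w -> cdom i0 (zeta w) /\ B0 (cz i0 (zeta w))).

(** Near [zeta w], flowing backwards along [X / vel] for the time [rho] leads to the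
initial point of the bicharacteristic, where [phi] is 0. *)
Lemma rep_start w : UU w -> exists g, local_rep (X := ct_charts M) i0 SG phi (zeta w) g.
Proof.
move=> hw; have [iz Bz] := z_i0 hw; have SGz : SG (zeta w) by rewrite -gam0 //; apply: gam_SG; rewrite // lexx ltW // ell0.
set c := cz i0 (zeta w).
have [ft grf] := local_rep_all SGz iz fC.
have [B2 rf B2c] := local_rep_on grf.
have [oB0 _ _] := rH; have [oB2 _ _] := rf.
pose B := B0 `&` B2; have oB : open B by exact: openI.
have BB0 : B `<=` B0 by move=> y [].
have rH' : rep_on i0 (@nonzero R m M) H B gH by apply: rep_on_subset rH.
have rr' : rep_on i0 setT (fun z => rho (ct_base z)) B rt by apply: rep_on_subset rr.
have {}rf : rep_on i0 SG f B ft by apply: rep_on_subset rf => // y [].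
have NB : nbhs c B by apply: open_nbhs_nbhs; split=> //; split.
have [r [r0 rB cl]] := closed_chart_ball iz NB; rewrite -/c in rB cl.
have [K K0 KP] := speed_bound rH' (ltW r0) rB.
have vC : Cinf B vel by move=> k; apply: Ck_sub (velC k).
have [kappa k0 fb] := flow_back rH' rf vC v00 (fun y By => vel_ge (BB0 y By)) r0 rB.
have K1 : 0 < 4 * (K + 1) by rewrite mulr_gt0 // ltr_wpDl.
pose del := r / (4 * (K + 1)); have del0 : 0 < del by rewrite divr_gt0.
have Kdel x : x <= del -> K * x <= r / 4.
  move=> xd; apply: (@le_trans _ _ ((K + 1) * del)).
    by apply: (@le_trans _ _ (K * del)); [exact: ler_wpM2l|rewrite ler_wpM2r ?(ltW del0) // lerDl].
  by rewrite le_eqVlt /del; apply/orP; left; apply/eqP; field; rewrite gt_eqF // ltr_wpDl.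
(* rho is too small on P for a curve that stays in the chart during the time del *)
have vd : 0 < v0 * del / 2 by rewrite divr_gt0 // mulr_gt0.
have [eps eps0 [epsk epsd]] := common_radius k0 vd.
have [_ rtC rtE] := rr'.
have Bc : B c by apply: rB; rewrite subrr normr0 ltW.
have rtc : rt c = 0 by rewrite -(rtE (zeta w)) //; apply: rU; apply: CU; exact: zC.
have NP : nbhs c [set y | `|y - c| <= r / 2 /\ `|rt y| <= eps].
  near=> y; split.
    rewrite distrC; near: y; move: (@cvg_id _ (nbhs c)) => /(@cvgrPdist_le R _ _ (nbhs c) (nbhs_filter c) _ _).1; apply.
    by rewrite divr_gt0.
  have -> : `|rt y| = `|rt c - rt y| by rewrite rtc sub0r normrN.
  near: y; have cr : {for c, continuous rt}.
    exact: (Ck_continuous (rtC 0%N)).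
  by move: cr => /(@cvgrPdist_le R _ _ (nbhs c) (nbhs_filter c) _ _).1; apply.
move: NP; rewrite nbhsE => -[P [oP Pc] PP].
have PB : P `<=` B by move=> y /PP[h _]; apply: rB; lra.
have [|||Psi [Z [_ ZC PsiP]]] := fb P (fun y => - rt y) oP.
- by move=> k; apply: Ck_opp => //; apply: Ck_sub (rtC k).
- by move=> p /PP[].
- by move=> p /PP[_ h]; rewrite normrN (le_trans h).
exists (fun y => - Z y), P; split=> //; first by move=> k; apply: Ck_opp => //; exact: ZC.
move=> z' SGz' iz' Pz; have [v [s [hv sl zE]]] := SG_gam SGz'.
have /andP[s0 sl'] := sl; have [zr ze] := PP _ Pz.
have stay a : 0 <= a -> a <= s -> s - a <= del -> forall x, a <= x <= s -> cdom i0 (gam v x) /\ `|cz i0 (gam v x) - c| <= r.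
  move=> a0 as_ sad; apply: (ic_stay (gam_sub hv a0 sl') rH' r0 rB KP cl); rewrite -?zE //; exact: Kdel.
pose W a x := rho (ct_base (gam v (clamp a s x))).
have dW a : 0 <= a -> a <= s -> s - a <= del -> forall x : R, a < x < s -> is_derive x (1 : R) (W a) (vel (cz i0 (gam v x))).
  move=> a0 as_ sad x xas; have [|ix cx] := stay a a0 as_ sad x; first by move/andP: xas => [? ?]; rewrite !ltW.
  apply: (@is_derive_along i0 setT (fun z => rho (ct_base z)) a s (gam v) B gH rt x) => //; last exact: rB.
  exact: gam_sub.
have cW a : 0 <= a -> a <= s -> continuous (W a).
  by move=> a0 as_; apply: (continuous_rho_along rC as_); exact: gam_sub.
have Ws a : a <= s -> W a s = rt (cz i0 z').
  by move=> as_; rewrite /W clamp_id ?as_ ?lexx // -zE; apply: rtE => //; exact: PB.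
(* rho is nonnegative and decreases backwards with speed at least v0 *)
have sdel : s <= del.
  case: (leP s del) => // ss; exfalso.
  have a0 : 0 <= s - del by lra.
  have as_ : s - del <= s by lra.
  have sad : s - (s - del) <= del by lra.
  have inc : v0 * s - v0 * (s - del) <= W (s - del) s - W (s - del) (s - del).
    apply: (@le_increment R (fun t => v0 * t) (W (s - del)) (fun=> v0) (fun t => vel (cz i0 (gam v t)))) => //.
    - by apply: continuous_subspaceT => t; exact: (cvgM (cvg_cst _) cvg_id).
    - by apply: continuous_subspaceT; exact: cW.
    - move=> t _; have := @is_derive_linear R R R (fun s => v0 * s) t 1; rewrite mulr1; apply.
      by move=> x' y' z1; rewrite /GRing.scale /=; ring.
    - exact: dW.
    - move=> t /andP[t1 t2]; have [|_ ct] := stay _ a0 as_ sad t; first by rewrite !ltW.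
      by apply: vel_ge; apply: BB0; exact: rB.
  have W0 : 0 <= W (s - del) (s - del) by exact: rge0.
  move: inc; rewrite Ws // -mulrBr opprB addrC subrK => inc.
  have := ler_norm (rt (cz i0 z')); move: vd; lra.
have s0s : s - 0 <= del by rewrite subr0.
have [||||||||_ E] := PsiP (gam v) 0 s (W 0) (F v) s0.
- exact: gam_sub.
- by move=> x xs; have [ix cx] := stay 0 (lexx _) s0 s0s x xs; split=> //; apply: gam_SG => //; lra.
- by rewrite -zE.
- exact: cW.
- exact: dW.
- rewrite Ws // opprK -zE /W clamp_id ?lexx // gam0 // rU ?subr0 //.
  by apply: CU; exact: zC.
- exact: cF.
- by move=> x /andP[? ?]; apply: dF => //; lra.
by rewrite zE phiE // -E F0 // sub0r opprK.
Unshelve. all: by end_near. Qed.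

Lemma phi_smooth : smooth_on (ct_charts M) SG phi.
Proof.
move=> z /SG_gam[w [s [hw /andP[s0 sl] ->]]].
suff : rep_at w s by [].
(* at time 0 the expression of rep_start serves on a neighbourhood, later rep_transport applies *)
apply: (@interval_propagation R (rep_at w) 0 s s0).
  by exists i0; rewrite gam0 //; split; [case: (z_i0 hw)|exact: rep_start].
move=> t /andP[]; rewrite le_eqVlt => /predU1P[<- _|t0 ts]; last first.
  have [|e e0 He] := @rep_transport w t hw; first by rewrite t0 (le_trans ts).
  by exists e => // r r' ? ? ?; apply: He => //; lra.
have [iz Bz] := z_i0 hw; have [g [B [oB Bc gC gE]]] := rep_start hw.
have l0 : ((0 : R) <= 0) && ((0 : R) <= ell w) by rewrite lexx ltW // ell0.
have /nbhs_ballP[d /= d0 dB] : nbhs (cz i0 (zeta w)) B by exact: open_nbhs_nbhs.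
rewrite -gam0 // in iz dB.
have [e e0 He] := ic_near_chart (gam_ic hw) l0 iz d0.
exists e => // r r' r0 rr0 rs _; rewrite add0r => r'e _.
have [||ir cr] := He r'; [by apply/andP; split; lra|by rewrite subr0 ger0_norm //; lra|].
exists i0; split=> //; exists g, B; split=> //.
by apply: dB; rewrite -ball_normE /= distrC.
Qed.

(** Both sides are limits of the same difference quotients along the
bicharacteristic through [z]. *)
Lemma phi_deriv z : SG z -> XH_deriv H SG phi z (f z).
Proof.
move=> SGz; have [w [t [hw tl zE]]] := SG_gam SGz.
have [i [iz [g gr]]] := phi_smooth SGz.
have [gh grh] := local_rep_all (SG_nonzero SGz) iz HC.
have Hd : is_gradient (X := ct_charts M) i (@nonzero R m M) H z (gradient gh (cz i z)) by split=> //; exists gh.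
exists i, (gradient gh (cz i z)), (gradient g (cz i z)); split=> //; first by split=> //; exists g.
rewrite zE in iz gr Hd *.
have q1 := ic_fun (gam_ic hw) tl (fun s sl => gam_SG hw sl) Hd gr.
have q2 := @is_derive_within R (F w) `[0, ell w] t _ (dF hw tl).
have PF := within_dnbhs_proper (ell0 hw) tl.
suff q3 : (s - t)^-1 * (phi (gam w s) - phi (gam w t)) @[s --> within `[0, ell w] t^'] --> f (gam w t).
  exact: (@cvg_unique R (@Rhausdorff R) _ (fmap_proper_filter _ PF) _ _ q3 q1).
apply: cvg_trans q2; apply: near_eq_cvg; near=> s.
have sl : 0 <= s <= ell w.
  suff : [set` `[0, ell w]] s by rewrite /= in_itv.
  by near: s; exact: withinT.
by rewrite !phiE.
Unshelve. all: by end_near. Qed.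

End Xray.

(** * Charts at incoming points and the theorem *)

Section IncomingPoints.
Context {R : realType} {m : nat} {M : bmanifold R m}.
Notation n := m.+1.
Notation cm i q := (@ccoord R _ _ (bm_charts M) i q).
Notation cz i z := (@ccoord R _ _ (ct_charts M) i z).

(** The choices that make the neighbourhood of [z0] small: a chart where the speed
of [rho] along the Hamilton field is bounded below, and a closed part [C] of [U] that
contains the base points of the boundary covectors with coordinates in [O]. *)
Lemma incoming_chart (H : cotangent M -> R) (rho : M -> R) (U : set M) (z0 : cotangent M) :
  smooth_on (bm_charts M) setT rho -> (forall p, 0 <= rho p) -> (forall p, rho p = 0 <-> bdry p) ->
  bdry_open U -> U (ct_base z0) -> (exists2 v, drho_Hxi H rho z0 v & 0 < v) ->
  exists (i : cidx (ct_charts M)) (O B : set 'rV[R]_(n + n)) (g rt : 'rV[R]_(n + n) -> R) (v : R) (C : set M),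
    [/\ cdom i z0, open O, O (cz i z0) & O `<=` B] /\
    [/\ closed C, C `<=` U & forall z, cdom i z -> O (cz i z) -> bdry (ct_base z) -> C (ct_base z)] /\
    [/\ rep_on i (@nonzero R m M) H B g, rep_on i setT (fun z => rho (ct_base z)) B rt, 0 < v,
      Cinf B (fun y => (hamfield g y *m (gradient rt y)^T) 0 0) &
      forall y, B y -> v <= (hamfield g y *m (gradient rt y)^T) 0 0].
Proof.
move=> rC r0 rb [A oA UA] Uz [v [i [d [e [Hd He vE]]]] v0].
have [iz [g grg dE]] := Hd; have [_ [h grh eE]] := He.
have [B1 rg B1c] := local_rep_on grg; have [oB1 gC gE] := rg.
have [B2 [oB2 B2c hC hE]] := grh.
pose rt (y : 'rV[R]_(n + n)) := h (lsubmx y).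
pose B12 := B1 `&` [set y | B2 (lsubmx y)].
have oB12 : open B12 by apply: openI => //; exact: open_lsubmx.
have rtC : Cinf B12 rt.
  by move=> k; apply: Ck_sub (@Cinf_lsubmx R n n B2 h oB2 hC k) => // y [].
pose vel y := (hamfield g y *m (gradient rt y)^T) 0 0.
have velC : Cinf B12 vel.
  move=> k; apply: (@Ck_eq _ _ _ _ (fun y => \sum_l hamfield g y 0 l * pd l rt y)) => //.
    by move=> y _; rewrite /vel mxE; apply: eq_bigr => l _; rewrite !mxE.
  apply: Ck_sum => // l; apply: Ck_mul => //; last by apply: CkS_pd; exact: (rtC k.+1).
  by apply: Ck_sub (hamfield_smooth oB1 gC l k) => // y [].
set c := cz i z0 in B1c.
have lc : lsubmx c = cm i (ct_base z0) by exact: lsubmx_cz.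
have B12c : B12 c by split=> //=; rewrite lc.
have velc : vel c = v.
  rewrite /vel vE /hamfield -dE /hamvec.
  have -> : gradient rt c = row_mx e 0.
    rewrite eE; apply/rowP => l; case: (split_ordP l) => b ->.
      by rewrite row_mxEl !mxE pd_lsubmx lc.
    by rewrite row_mxEr !mxE pd_lsubmx0.
  by rewrite tr_row_mx mul_row_col trmx0 mulmx0 addr0.
have v2 : 0 < v / 2 by rewrite divr_gt0.
have NB : nbhs c [set y | B12 y /\ v / 2 <= vel y].
  have N1 : nbhs c B12 by exact: open_nbhs_nbhs.
  have cv : {for c, continuous vel} := Ck_continuous (velC 0%N) B12c.
  have := (@cvgrPdist_lt R _ _ (nbhs c) (nbhs_filter c) _ _).1 cv (v / 2) v2.
  apply: filterS2 N1 => y By; rewrite velc => vy; split=> //.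
  by move: vy; rewrite ltr_norml; clear; lra.
move: (NB); rewrite nbhsE => -[B [oB Bc] BB].
have [r1 r10 r1P] := chart_ball_closed iz.
have Az : A (ct_base z0) by move: Uz; rewrite UA => -[].
have /nbhs_ballP[r2 /= r20 r2P] := near_coord oA Az iz.
have r22 : 0 < r2 / 2 by rewrite divr_gt0.
have [r r00 [rr1 rr2]] := common_radius r10 r22.
(* Kr is closed in M and contained in the open set A that cuts out U *)
pose Kr := [set q | cdom (c := bm_charts M) i q /\ `|cm i q - cm i (ct_base z0)| <= r].
have NO : nbhs c [set y | B y /\ `|y - c| <= r].
  near=> y; split; first by near: y; exact: open_nbhs_nbhs.
  rewrite distrC; near: y; move: (@cvg_id _ (nbhs c)) => /(@cvgrPdist_le R _ _ (nbhs c) (nbhs_filter c) _ _).1; exact.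
move: NO; rewrite nbhsE => -[D [oO Oc] OB].
have B12' : B `<=` B12 by move=> y /BB[].
exists i, D, B, g, rt, (v / 2), (Kr `&` @bdry R m M); split; [|split]; split=> //.
- by move=> y /OB[].
- apply: closedI; first exact: r1P.
  have -> : @bdry R m M = rho @^-1` [set y | y <= 0].
    apply/seteqP; split=> p /=; first by move=> /rb ->.
    by move=> rp; apply/rb/le_anti; rewrite rp r0.
  apply: preimage_closed; last exact: closed_le.
  by move=> p _; exact: rho_continuous.
- move=> p [[ip pr] bp]; rewrite UA; split=> //.
  apply: (r2P (cm i p)) => //; rewrite -ball_normE /= distrC; move: pr rr2 r20; clear; lra.
- move=> z iz' /OB[_ zr] bz; split=> //; split=> //.
  by rewrite -lc -lsubmx_cz -linearB; apply: le_trans zr; exact: norm_lsubmx.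
- by apply: rep_on_subset rg => // y /B12'[].
- split=> //; first by move=> k; apply: Ck_sub (rtC k).
  by move=> w _ iw /B12'[_ Bw]; rewrite /rt lsubmx_cz; apply: hE => //; rewrite -lsubmx_cz.
- by move=> k; apply: Ck_sub (velC k).
- by move=> y /BB[].
Unshelve. all: by end_near. Qed.

Lemma xray_clamp (f : cotangent M -> R) gamma l : 0 <= l -> xray f gamma l =
  (\int[@lebesgue_measure R]_(t in `[0, l]) f (gamma (clamp 0 l t)))%R.
Proof.
by move=> l0; apply: eq_Rintegral => t; rewrite inE /= in_itv /= => t0l; rewrite clamp_id.
Qed.

Lemma xray_XH_deriv (H : cotangent M -> R) A f phi gamma l : smooth_on (ct_charts M) A f ->
  smooth_on (ct_charts M) A phi -> (forall z, A z -> XH_deriv H A phi z (f z)) -> 0 < l ->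
  integral_curve H 0 l gamma -> (forall t, 0 <= t <= l -> A (gamma t)) ->
  xray f gamma l = phi (gamma l) - phi (gamma 0).
Proof.
move=> fC pC Hp l0 ic Ag; rewrite xray_clamp ?ltW //.
have cf := continuous_along fC (ltW l0) ic Ag; have cp := continuous_along pC (ltW l0) ic Ag.
have [F [cF F0 dF ->]] := primitive_on cf l0.
have H1 : F l - phi (gamma (clamp 0 l l)) = F 0 - phi (gamma (clamp 0 l 0)).
  apply: (@constant_on R (fun t => F t - phi (gamma (clamp 0 l t))) 0 l (ltW l0)).
    by move=> t; exact: (cvgB (cF t) (cp t)).
  move=> t t0l; have t0l' : 0 <= t <= l by move/andP: t0l => [? ?]; rewrite !ltW.
  have d1 := dF t t0l'; rewrite clamp_id // in d1.
  suff d2 : is_derive t (1 : R) (fun t => phi (gamma (clamp 0 l t))) (f (gamma t)).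
    by have := is_deriveB d1 d2; rewrite subrr; exact.
  apply: (@near_eq_is_derive _ _ _ (fun t => phi (gamma t))).
    by near=> s; rewrite (near (clamp_near t0l)).
  apply: within_is_derive t0l _.
  have [i [d [e [Hd [_ [g gr ->]] ->]]]] := Hp _ (Ag _ t0l').
  exact: ic_fun ic t0l' Ag Hd gr.
move: H1; rewrite !clamp_id ?lexx ?ltW // F0 sub0r => H1.
by move: H1; move: (F l) (phi (gamma l)) (phi (gamma 0)) => x y z; clear; lra.
Unshelve. all: by end_near. Qed.

End IncomingPoints.

Theorem theorem3p1 (R : realType) (m : nat) (hm : (2 <= m.+1)%N)
    (M : bmanifold R m) (H : cotangent M -> R) (hH : hamiltonian H)
    (rho : M -> R) (hrho : boundary_defining rho)
    (U V : set M) (hU : bdry_open U) (hV : bdry_open V) (hUV : U `&` V = set0)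
    (z0 : cotangent M) (w0 : bcotangent M) (l0 : R)
    (hz0 : cosphere H z0) (hz0U : U (ct_base z0)) (hw0 : is_restriction z0 w0)
    (hinc : exists2 v, drho_Hxi H rho z0 v & 0 < v)
    (hhit : first_hit H rho U V z0 l0) :
  exists (UU0 : set (bcotangent M)) (W0 : set (cotangent M)),
    [/\ chart_open (bc_charts M) UU0, UU0 w0,
        chart_open (ct_charts M) W0, W0 z0 &
    forall (UU : set (bcotangent M)) (W : set (cotangent M))
        (zeta : bcotangent M -> cotangent M) (ell : bcotangent M -> R),
      chart_open (bc_charts M) UU -> UU w0 -> UU `<=` UU0 ->
      chart_open (ct_charts M) W -> W z0 -> W `<=` W0 ->
      admissible H rho U V W UU zeta ell ->
      let Gam := Gamma H UU zeta ell in
      let SGam := cosphere H `&` Gam in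
      forall f : cotangent M -> R, smooth_on (ct_charts M) SGam f ->
        (forall gamma l, Gamma_bichar H UU zeta ell gamma l ->
           xray f gamma l = 0)
        <->
        (exists phi : cotangent M -> R,
          [/\ smooth_on (ct_charts M) SGam phi,
              forall z, SGam z -> XH_deriv H SGam phi z (f z) &
              forall z,
                (cosphere H `&` (Gamma_over H UU zeta ell U `|`
                                 Gamma_over H UU zeta ell V)) z ->
                phi z = 0])].
Proof.
have [HC _ Hhom _] := hH; have [rC rge0 rb _] := hrho.
have rU p : U p -> rho p = 0 by case: hU => A _ -> [_ /rb].
have [i0 [D [B [gH [rt [v0 [C [[i0z oO Oz OB] [[Ccl CU CO] [rH rr v00 velC vel_ge]]]]]]]]]] :=
  incoming_chart rC rge0 rb hU hz0U hinc.
(* a restriction on the neighbourhood of z0 suffices: it controls the base points too *)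
exists setT, [set z | cdom (c := ct_charts M) i0 z /\ D (ccoord (c := ct_charts M) i0 z)]; split=> //.
- by move=> w _; have [i iw] := bm_cover (bc_base w); exists i; split=> //; exists setT; split=> //; exact: openT.
- by move=> z [iz Oz']; exists i0; split=> //; exists D.
move=> UU W zeta ell _ _ _ _ _ WW0 [UUU hz _ _] Gam SGam f fC.
have exgam w : exists g, UU w ->
    [/\ unit_bichar H 0 (ell w) g, g 0 = zeta w, V (ct_base (g (ell w))),
     forall s, 0 <= s < ell w -> ~ V (ct_base (g s)) & forall s, 0 < s < ell w -> ~ U (ct_base (g s))].
  case: (pselect (UU w)) => [hw|]; last by move=> nw; exists (fun=> zeta w).
  by have [_ _ _ [_ [g [? ? ? [? ?] _]]]] := hz w hw; exists g.
have [gam gamP] := choice exgam.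
have zres w : UU w -> is_restriction (zeta w) w by case/hz.
have ell0 w : UU w -> 0 < ell w by case/hz => _ _ _ [].
have gb w : UU w -> unit_bichar H 0 (ell w) (gam w) by case/gamP.
have g0 w : UU w -> gam w 0 = zeta w by case/gamP.
have gV w : UU w -> V (ct_base (gam w (ell w))) by case/gamP.
have gnV w : UU w -> forall s, 0 <= s < ell w -> ~ V (ct_base (gam w s)) by case/gamP.
have gnU w : UU w -> forall s, 0 < s < ell w -> ~ U (ct_base (gam w s)) by case/gamP.
have zi0 w : UU w -> cdom (c := ct_charts M) i0 (zeta w) /\ D (ccoord (c := ct_charts M) i0 (zeta w)).
  by move=> /hz[/WW0].
have zB w : UU w -> cdom (c := ct_charts M) i0 (zeta w) /\ B (ccoord (c := ct_charts M) i0 (zeta w)).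
  by move=> /zi0[? /OB].
have zC w : UU w -> C (ct_base (zeta w)).
  move=> hw; have [iz Oz'] := zi0 w hw; apply: CO => //; apply/rb/rU.
  by have [-> _] := zres w hw; exact: UUU.
have in0 w : UU w -> 0 <= (0 : R) <= ell w by move=> /ell0 h; rewrite lexx ltW.
have inl w : UU w -> 0 <= ell w <= ell w by move=> /ell0 h; rewrite lexx ltW.
have ends z w s : UU w -> 0 <= s <= ell w -> z = gam w s -> U (ct_base z) \/ V (ct_base z) ->
    s = 0 \/ s = ell w.
  move=> hw /andP[s0 sl] -> [Uz|Vz].
    left; apply/eqP; apply/negP => /negP sn.
    by apply: (@gam_notU _ _ _ _ _ hUV _ _ _ gV gnU w s hw _ Uz); rewrite lt_neqAle eq_sym sn s0.
  right; apply/eqP; apply/negP => /negP sn.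
  by apply: (gnV w hw s _ Vz); rewrite s0 lt_neqAle sn.
split=> [hx|[phi [pC Hp p0]] gamma l [w [hw -> [ic _] gz]]]; last first.
  have gE := bichar_gam HC gb g0 hw (inl w hw) ic gz.
  have Ag t : 0 <= t <= ell w -> SGam (gamma t) by move=> tl; rewrite gE //; exact: gam_SG.
  rewrite (xray_XH_deriv fC pC Hp (ell0 w hw) ic Ag) !p0 ?subrr //.
    have [cs GS] := Ag _ (in0 w hw); split; [exact: cs|apply: or_introl; split; first exact: GS].
    by rewrite /= gz; exact/CU/zC.
  have [cs GS] := Ag _ (inl w hw); split; [exact: cs|apply: or_intror; split; first exact: GS].
  by rewrite /= gE ?inl //; exact: gV.
have exF w : exists F : R -> R, UU w -> [/\ continuous F, F 0 = 0,
    forall t, 0 <= t <= ell w -> is_derive t (1 : R) F (f (gam w t)) & F (ell w) = 0].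
  case: (pselect (UU w)) => [hw|]; last by move=> nw; exists (fun=> 0).
  have l0w := ell0 w hw; have [ic _] := gb w hw.
  have Ag t : 0 <= t <= ell w -> SGam (gam w t) by move=> tl; exact: gam_SG.
  have [F [cF F0 dF IF]] := primitive_on (continuous_along fC (ltW l0w) ic Ag) l0w.
  exists F => _; split=> //; first by move=> t tl; have := dF t tl; rewrite clamp_id.
  rewrite -IF; have <- := xray_clamp f (gam w) (ltW l0w).
  by apply: hx; exists w; split=> //; [exact: gb|exact: g0].
have [F FP] := choice exF.
have exphi z : exists x, forall w s, UU w -> 0 <= s <= ell w -> z = gam w s -> x = F w s.
  case: (pselect (exists w s, [/\ UU w, 0 <= s <= ell w & z = gam w s])) => [[w [s [hw sl zE]]]|nz]; last first.
    by exists 0 => w s hw sl zE; exfalso; apply: nz; exists w, s.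
  exists (F w s) => w' s' hw' sl' zE'; have E := etrans (esym zE) zE'.
  by have [-> ->] := gam_inj HC hUV zres gb g0 gV gnU CU zC hw hw' sl sl' E.
have [phi phiP] := choice exphi.
have phiE w s : UU w -> 0 <= s <= ell w -> phi (gam w s) = F w s by move=> hw sl; exact: phiP.
have cF w : UU w -> continuous (F w) by case/FP.
have F0 w : UU w -> F w 0 = 0 by case/FP.
have dF w : UU w -> forall t, 0 <= t <= ell w -> is_derive t (1 : R) (F w) (f (gam w t)) by case/FP.
exists phi; split.
- exact: (phi_smooth HC hUV rC rge0 rU ell0 gb g0 gV gnU Ccl CU zC Hhom fC cF F0 dF phiE rH rr v00 velC vel_ge zB).
- exact: (phi_deriv HC hUV rC rge0 rU ell0 gb g0 gV gnU Ccl CU zC Hhom fC cF F0 dF phiE rH rr v00 velC vel_ge zB).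
move=> z [cs GUV].
have [GS UVz] : Gam z /\ (U (ct_base z) \/ V (ct_base z)).
  by case: GUV => -[? ?]; split=> //; [left|right].
have [w [s [hw sl zE]]] := SG_gam HC gb g0 Hhom (conj cs GS).
rewrite zE phiE //; have [->|->] := ends z w s hw sl zE UVz; first exact: F0.
by have [_ _ _ ->] := FP w hw.
Qed.
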